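(* Let $\Lambda$ be the graded $k$-algebra given by generators and relations in the context, and define graded left $\Lambda$-modules (with generators in degree $0$) $$Z_\lambda=\frac{\Lambda e_\lambda}{\Lambda v_{0,p}+\Lambda v_{p,-p}+\Lambda w_{-p,p}+\Lambda w_{p,0}},\qquad Z_\gamma=\frac{\Lambda e_\gamma}{\Lambda v_{p,0}},\qquad Z_\mu=\frac{\Lambda e_\mu}{\Lambda w_{0,p}}.$$ Then $Z_\lambda$, $Z_\gamma$ and $Z_\mu$ are Koszul.
   Context: Let $k$ be an algebraically closed field of characteristic $p>3$. Let $W=\{(p,0),(-p,p),(0,-p)\}$ and $-W=\{(-p,0),(p,-p),(0,p)\}$ in $\mathbb{Z}^2$. Let $\mathbb{K}=k e_\lambda\oplus k e_\gamma\oplus k e_\mu$ with $e_\lambda,e_\gamma,e_\mu$ orthogonal idempotents summing to $1$, and let $V$ be the 12-dimensional $\mathbb{K}$-bimodule with - $e_\lambda Ve_\gamma$ with basis $v_\alpha$ ($\alpha\in W$), $e_\gamma Ve_\lambda$ with basis $v_\alpha$ ($\alpha\in -W$), - $e_\mu Ve_\lambda$ with basis $w_\alpha$ ($\alpha\in W$), $e_\lambda Ve_\mu$ with basis $w_\alpha$ ($\alpha\in -W$), and all other $e_\sigma Ve_\tau=0$. Write $v_{i,j}=v_{(i,j)}$, $w_{i,j}=w_{(i,j)}$. Then $\Lambda=T_{\mathbb{K}}(V)/(R)$ where the relations are, for $\alpha,\beta\in -W$: - $v_\alpha v_{-\beta}=0$ for $\alpha\ne\beta$, and $v_\alpha v_{-\alpha}=v_\beta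 v_{-\beta}$ for all $\alpha,\beta$; - $w_{-\alpha}w_\beta=0$ for $\alpha\neq\beta$, and $w_{-\alpha}w_\alpha=w_{-\beta}w_\beta$ for all $\alpha,\beta$; - $w_{-\alpha}v_{-\beta}+w_{-\beta}v_{-\alpha}=0$ for all $\alpha,\beta$; - $v_\alpha w_\beta+v_\beta w_\alpha=0$ for all $\alpha,\beta$; - $v_{-\alpha}v_\beta+w_\beta w_{-\alpha}=0$ for $\alpha\ne\beta$, and $v_{-\alpha}v_\alpha+w_\alpha w_{-\alpha}=v_{-\beta}v_\beta+w_\beta w_{-\beta}$ for all $\alpha,\beta$. $\Lambda$ is graded with the $e_\alpha$ in degree $0$ and $V$ in degree $1$ (the $K$-grading). ($\Lambda$ is the basic algebra of a non-semisimple singular block of the restricted enveloping algebra of $\mathfrak{sl}_3(k)$, it is a Koszul algebra, and $Z_\lambda,Z_\gamma,Z_\mu$ correspond to the Verma modules.) A graded module $N$ over a Koszul algebra $\Lambda$ is Koszul if it has a graded projective resolution $\cdots\to P^1\to P^0\to N\to0$ in which $P^i$ is generated by its degree $i$ part, $P^i=\Lambda P^i_i$, for every $i$ (a linear resolution). Equivalently, $\operatorname{Ext}^{i,j}_\Lambda(N,\Lambda/\Lambda_{>0})=0$ unless $i=j$, where $i$ is homological and $j$ internal degree. *)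

(* Defs.v *)
From HB Require Import structures.
From mathcomp Require Import all_boot all_order all_algebra finmap.
From mathcomp Require Import boolp classical_sets.
From mathcomp Require Import monalg.

Set Implicit Arguments.
Unset Strict Implicit.
Unset Printing Implicit Defensive.

Import GRing.Theory.

Local Open Scope classical_set_scope.
Local Open Scope ring_scope.
Local Open Scope quotient_scope.

(** * Quotient of an algebra by the two-sided ideal generated by a set *)

Section Ideal.
Variable A : nzRingType.

Definition two_sided_ideal (I : set A) : Prop :=
  [/\ I 0, forall x y, I x -> I y -> I (x - y),
      forall a x, I x -> I (a * x) & forall a x, I x -> I (x * a)].

Definition ideal_gen (X : set A) : set A :=
  [set x | forall I, two_sided_ideal I -> X `<=` I -> I x].

Lemma ideal_genP (X : set A) : two_sided_ideal (ideal_gen X).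
Proof.
split=> [I [] //|x y Ix Iy I HI XI|a x Ix I HI XI|a x Ix I HI XI];
  case: (HI) => I0 IB Il Ir.
- by apply: IB; [apply: Ix | apply: Iy].
- by apply: Il; apply: Ix.
- by apply: Ir; apply: Ix.
Qed.

Lemma ideal_gen_sub (X : set A) : X `<=` ideal_gen X.
Proof. by move=> x Xx I _; apply. Qed.

(* The quotient ring is required to be nontrivial, as MathComp algebras are. *)
Record relations := Relations {
  rel_set :> set A;
  rel_proper : ~ ideal_gen rel_set 1 }.

Variable X : relations.

Definition ideal_pred : {pred A} := fun x => `[< ideal_gen X x >].

Lemma ideal_predE x : (x \in ideal_pred) = `[< ideal_gen X x >].
Proof. by []. Qed.

Lemma ideal_zmod_closed : zmod_closed ideal_pred.
Proof.
have [I0 IB _ _] := ideal_genP X.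
split=> [|x y]; first by rewrite ideal_predE; apply/asboolP.
rewrite !ideal_predE => /asboolP Ix /asboolP Iy.
by apply/asboolP; apply: IB.
Qed.

HB.instance Definition _ := GRing.isZmodClosed.Build A ideal_pred
  ideal_zmod_closed.

Lemma ideal_predMl a x : x \in ideal_pred -> a * x \in ideal_pred.
Proof.
have [_ _ Il _] := ideal_genP X; rewrite !ideal_predE => /asboolP Ix.
by apply/asboolP; apply: Il.
Qed.

Lemma ideal_predMr a x : x \in ideal_pred -> x * a \in ideal_pred.
Proof.
have [_ _ _ Ir] := ideal_genP X; rewrite !ideal_predE => /asboolP Ix.
by apply/asboolP; apply: Ir.
Qed.

Definition quot_ring := {ideal_quot ideal_pred}.
HB.instance Definition _ := GRing.Zmodule.on quot_ring.

Definition quot_pi (x : A) : quot_ring := \pi_{ideal_quot ideal_pred} x.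

Lemma quot_pi_eq x y : quot_pi x = quot_pi y <-> ideal_gen X (x - y).
Proof.
rewrite /quot_pi; split=> [/eqP|Ixy].
  by rewrite -Quotient.idealrBE ideal_predE => /asboolP.
by apply/eqP; rewrite -Quotient.idealrBE ideal_predE; apply/asboolP.
Qed.

Lemma quot_pi_surj (u : quot_ring) : {x | u = quot_pi x}.
Proof. by exists (repr (u : {ideal_quot ideal_pred})); rewrite /quot_pi reprK. Qed.

Lemma quot_piB : zmod_morphism quot_pi.
Proof. by move=> x y; rewrite /quot_pi raddfB. Qed.
HB.instance Definition _ := GRing.isZmodMorphism.Build A quot_ring quot_pi
  quot_piB.

Definition quot_repr (u : quot_ring) : A := projT1 (quot_pi_surj u).

Lemma quot_reprK : cancel quot_repr quot_pi.
Proof. by move=> u; rewrite -(projT2 (quot_pi_surj u)). Qed.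

Definition quot_one : quot_ring := quot_pi 1.
Definition quot_mul (u v : quot_ring) : quot_ring :=
  quot_pi (quot_repr u * quot_repr v).

Lemma quot_mulE x y : quot_mul (quot_pi x) (quot_pi y) = quot_pi (x * y).
Proof.
have [_ IB Il Ir] := ideal_genP X.
have [I0 _ _ _] := ideal_genP X.
have rP z : ideal_gen X (quot_repr (quot_pi z) - z).
  by apply/quot_pi_eq; rewrite quot_reprK.
rewrite /quot_mul; set x' := quot_repr (quot_pi x).
set y' := quot_repr (quot_pi y).
apply/quot_pi_eq.
have -> : x' * y' - x * y = x' * (y' - y) - (- ((x' - x) * y)).
  by rewrite opprK mulrBr mulrBl addrA subrK.
apply: (IB); first by apply: (Il); apply: rP.
by rewrite -[- _]sub0r; apply: IB => //; by apply: Ir; apply: rP.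
Qed.

Lemma quot_mulA : associative quot_mul.
Proof.
move=> u v w; rewrite -(quot_reprK u) -(quot_reprK v) -(quot_reprK w).
by rewrite !quot_mulE mulrA.
Qed.

Lemma quot_mul1 : left_id quot_one quot_mul.
Proof. by move=> u; rewrite -(quot_reprK u) quot_mulE mul1r. Qed.

Lemma quot_mulr1 : right_id quot_one quot_mul.
Proof. by move=> u; rewrite -(quot_reprK u) quot_mulE mulr1. Qed.

Lemma quot_mulDl : left_distributive quot_mul +%R.
Proof.
move=> u v w; rewrite -(quot_reprK u) -(quot_reprK v) -(quot_reprK w).
by rewrite -raddfD !quot_mulE mulrDl raddfD.
Qed.

Lemma quot_mulDr : right_distributive quot_mul +%R.
Proof.
move=> u v w; rewrite -(quot_reprK u) -(quot_reprK v) -(quot_reprK w).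
by rewrite -raddfD !quot_mulE mulrDr raddfD.
Qed.

Lemma quot_one_neq0 : quot_one != 0.
Proof.
apply/eqP; rewrite /quot_one -(raddf0 quot_pi) => /quot_pi_eq.
by rewrite subr0; exact: rel_proper.
Qed.

HB.instance Definition _ := GRing.Zmodule_isNzRing.Build quot_ring
  quot_mulA quot_mul1 quot_mulr1 quot_mulDl quot_mulDr quot_one_neq0.

Lemma quot_pi_monoid : monoid_morphism quot_pi.
Proof. by split=> // x y; rewrite -quot_mulE. Qed.
HB.instance Definition _ := GRing.isMonoidMorphism.Build A quot_ring quot_pi
  quot_pi_monoid.

Section Lift.
Variables (S : nzRingType) (f : {rmorphism A -> S}).
Hypothesis fX : forall x, rel_set X x -> f x = 0.

Definition quot_lift (u : quot_ring) : S := f (quot_repr u).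

Lemma quot_lift_ker x : ideal_gen X x -> f x = 0.
Proof.
move/(_ [set z | f z = 0]); apply=> //.
split=> /= [|x1 x2 h1 h2|a x1 h|a x1 h]; first exact: rmorph0.
- by rewrite rmorphB h1 h2 subr0.
- by rewrite rmorphM h mulr0.
- by rewrite rmorphM h mul0r.
Qed.

Lemma quot_liftE x : quot_lift (quot_pi x) = f x.
Proof.
apply/eqP; rewrite -subr_eq0 -rmorphB; apply/eqP/quot_lift_ker.
by apply/quot_pi_eq; rewrite quot_reprK.
Qed.

Lemma quot_liftB : zmod_morphism quot_lift.
Proof.
move=> u v; rewrite -(quot_reprK u) -(quot_reprK v) -raddfB.
by rewrite !quot_liftE rmorphB.
Qed.

Lemma quot_liftM : monoid_morphism quot_lift.
Proof.
split=> [|u v]; first by rewrite -(rmorph1 quot_pi) quot_liftE rmorph1.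
rewrite -(quot_reprK u) -(quot_reprK v) -rmorphM.
by rewrite !quot_liftE rmorphM.
Qed.
End Lift.
End Ideal.

Lemma ideal_proper (A S : nzRingType) (f : {rmorphism A -> S}) (X : set A) :
  (forall x, X x -> f x = 0) -> ~ ideal_gen X 1.
Proof.
move=> fX /(_ [set z | f z = 0]) /=; rewrite rmorph1.
have key : (1 : S) = 0 -> False by move/eqP; rewrite oner_eq0.
move=> h; apply/key/h; last exact: fX.
split=> /= [|x1 x2 h1 h2|a x1 h'|a x1 h']; first exact: rmorph0.
- by rewrite rmorphB h1 h2 subr0.
- by rewrite rmorphM h' mulr0.
- by rewrite rmorphM h' mul0r.
Qed.

Section QuotAlg.
Variables (k : comNzRingType) (A : algType k) (X : relations A).

Definition quot_scale (c : k) (u : quot_ring X) : quot_ring X :=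
  quot_pi X (c%:A) * u.

Fact quot_scaleA a b v : quot_scale a (quot_scale b v) = quot_scale (a * b) v.
Proof. by rewrite /quot_scale mulrA -rmorphM -scalerAl mul1r scalerA. Qed.
Fact quot_scale1 : left_id 1 quot_scale.
Proof. by move=> v; rewrite /quot_scale scale1r rmorph1 mul1r. Qed.
Fact quot_scaleDr : right_distributive quot_scale +%R.
Proof. by move=> a u v; rewrite /quot_scale mulrDr. Qed.
Fact quot_scaleDl v : {morph quot_scale^~ v : a b / a + b}.
Proof. by move=> a b; rewrite /quot_scale scalerDl rmorphD mulrDl. Qed.

HB.instance Definition _ := GRing.Zmodule_isLmodule.Build k (quot_ring X)
  quot_scaleA quot_scale1 quot_scaleDr quot_scaleDl.

Fact quot_scaleAl (c : k) (u v : quot_ring X) : c *: (u * v) = (c *: u) * v.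
Proof. exact: mulrA. Qed.
HB.instance Definition _ := GRing.Lmodule_isLalgebra.Build k (quot_ring X)
  quot_scaleAl.

Fact quot_scaleAr (c : k) (u v : quot_ring X) : c *: (u * v) = u * (c *: v).
Proof.
have sE (w : quot_ring X) : c *: w = quot_pi X (c%:A) * w by [].
rewrite -(quot_reprK u) -(quot_reprK v) !sE.
move: (quot_repr u) (quot_repr v) => x y.
rewrite -(rmorphM (quot_pi X) x) -(rmorphM (quot_pi X) _ y).
rewrite -(rmorphM (quot_pi X)) -(rmorphM (quot_pi X)).
by rewrite -!scalerAl !mul1r scalerAr.
Qed.
HB.instance Definition _ := GRing.Lalgebra_isAlgebra.Build k (quot_ring X)
  quot_scaleAr.

Fact quot_piZ : scalable (quot_pi X).
Proof.
move=> c x; have -> : c *: quot_pi X x = quot_pi X (c%:A) * quot_pi X x by [].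
by rewrite -rmorphM -scalerAl mul1r.
Qed.
HB.instance Definition _ := GRing.isScalable.Build k A (quot_ring X) *:%R
  (quot_pi X) quot_piZ.
End QuotAlg.

(** * Free algebras *)

Fact malg_scaleAr (k : comNzRingType) (K : monomType) (c : k)
  (x y : {malg k[K]}) : c *: (x * y) = x * (c *: y).
Proof.
apply/malgP => m; rewrite mcoeffZ mcoeffMl.
rewrite (mcoeffMlw m (fsubset_refl (msupp x)) (msuppZ_le c y)).
rewrite mulr_sumr; apply: eq_bigr => i _.
rewrite mulr_sumr; apply: eq_bigr => j _.
by rewrite mcoeffZ mulrCA mulrnAr.
Qed.

(* The free associative unital k-algebra on I: the monoid algebra of words. *)
Definition free_alg (k : comNzRingType) (I : choiceType) :=
  {malg k[{fmonom I}]}.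

Section FreeAlg.
Variables (k : comNzRingType) (I : choiceType).

HB.instance Definition _ := GRing.Lalgebra.on (free_alg k I).

HB.instance Definition _ := GRing.Lalgebra_isAlgebra.Build k (free_alg k I)
  (@malg_scaleAr k {fmonom I}).

Definition free_gen (i : I) : free_alg k I := << fmu i >>.

End FreeAlg.

(** * Submodules and quotient modules *)

Section Span.
Variables (A : nzRingType) (M : lmodType A) (s : seq M).

(* The submodule A s_0 + A s_1 + ... + A s_n. *)
Definition lin_span : {pred M} :=
  fun x => `[< exists a : 'I_(size s) -> A, x = \sum_i a i *: s`_i >].

Lemma span_submod_closed : GRing.submod_closed lin_span.
Proof.
split=> [|c x y].
  apply/asboolP; exists (fun=> 0).
  by rewrite big1 // => i _; rewrite scale0r.
move=> /asboolP[a ->] /asboolP[b ->]; apply/asboolP.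
exists (fun i => c * a i + b i).
rewrite scaler_sumr -big_split; apply: eq_bigr => i _.
by rewrite scalerDl scalerA.
Qed.
HB.instance Definition _ := GRing.isSubmodClosed.Build A M lin_span
  span_submod_closed.

Record span_mod := SpanMod { span_val : M; span_valP : span_val \in lin_span }.
HB.instance Definition _ := [isSub for span_val].
HB.instance Definition _ := [Choice of span_mod by <:].
HB.instance Definition _ := [SubChoice_isSubLmodule of span_mod by <:].

End Span.

Section QuotMod.
Variables (A : nzRingType) (M : lmodType A) (U : submodClosed M).

Definition sub_pred : {pred M} := fun x => x \in U.
Fact sub_pred_zmod_closed : zmod_closed sub_pred.
Proof.
have E x : (x \in sub_pred) = (x \in U) by [].
split=> [|x y]; rewrite !E; first exact: rpred0.
by move=> Ux Uy; rewrite -scaleN1r rpredD // rpredZ.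
Qed.
HB.instance Definition _ := GRing.isZmodClosed.Build M sub_pred
  sub_pred_zmod_closed.

Definition quot_mod := {ideal_quot sub_pred}.
HB.instance Definition _ := GRing.Zmodule.on quot_mod.

Definition mod_pi (x : M) : quot_mod := \pi_{ideal_quot sub_pred} x.

Lemma mod_pi_eq x y : mod_pi x = mod_pi y <-> x - y \in U.
Proof.
by rewrite /mod_pi; split=> [/eqP|Uxy]; last apply/eqP;
  rewrite -Quotient.idealrBE.
Qed.

Definition mod_repr (u : quot_mod) : M := repr (u : {ideal_quot sub_pred}).
Lemma mod_reprK : cancel mod_repr mod_pi.
Proof. by move=> u; rewrite /mod_pi /mod_repr reprK. Qed.

Lemma mod_piB : zmod_morphism mod_pi.
Proof. by move=> x y; rewrite /mod_pi raddfB. Qed.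
HB.instance Definition _ := GRing.isZmodMorphism.Build M quot_mod mod_pi mod_piB.

Definition mod_scale (a : A) (u : quot_mod) : quot_mod := mod_pi (a *: mod_repr u).

Lemma mod_scaleE a x : mod_scale a (mod_pi x) = mod_pi (a *: x).
Proof.
apply/mod_pi_eq; rewrite -scalerBr; apply: rpredZ.
by apply/mod_pi_eq; rewrite mod_reprK.
Qed.

Fact mod_scaleA a b v : mod_scale a (mod_scale b v) = mod_scale (a * b) v.
Proof. by rewrite -(mod_reprK v) !mod_scaleE scalerA. Qed.
Fact mod_scale1 : left_id 1 mod_scale.
Proof. by move=> v; rewrite -(mod_reprK v) mod_scaleE scale1r. Qed.
Fact mod_scaleDr : right_distributive mod_scale +%R.
Proof.
move=> a u v; rewrite -(mod_reprK u) -(mod_reprK v).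
by rewrite -raddfD !mod_scaleE scalerDr raddfD.
Qed.
Fact mod_scaleDl v : {morph mod_scale^~ v : a b / a + b}.
Proof.
move=> a b; rewrite -(mod_reprK v) !mod_scaleE -raddfD.
by rewrite scalerDl.
Qed.
HB.instance Definition _ := GRing.Zmodule_isLmodule.Build A quot_mod
  mod_scaleA mod_scale1 mod_scaleDr mod_scaleDl.

Fact mod_piZ : scalable mod_pi.
Proof. by move=> a x; rewrite -mod_scaleE. Qed.
HB.instance Definition _ := GRing.isScalable.Build A M quot_mod *:%R mod_pi mod_piZ.

End QuotMod.

Section LeftIdealQuotient.
Variables (A : nzRingType) (e : A) (s : seq A).

(* A e, as a submodule of the regular left module A. *)
Definition left_ideal := span_mod [:: e : A^o].
HB.instance Definition _ := GRing.Lmodule.on left_ideal.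

Definition left_sub : {pred left_ideal} :=
  fun x => span_val x \in lin_span (s : seq A^o).

Lemma left_sub_submod_closed : GRing.submod_closed left_sub.
Proof.
have vP (x : left_ideal) : (x \in left_sub) = (val x \in lin_span (s : seq A^o)).
  by [].
split=> [|c x y]; rewrite !vP ?raddf0 ?rpred0 // => hx hy.
by rewrite linearP rpredD // rpredZ.
Qed.
HB.instance Definition _ := GRing.isSubmodClosed.Build A left_ideal left_sub
  left_sub_submod_closed.

(* A e / (A s_0 + ... + A s_n) when all the s_i lie in A e. *)
Definition left_quot := quot_mod left_sub.
HB.instance Definition _ := GRing.Lmodule.on left_quot.

End LeftIdealQuotient.

(** * Graded modules, linear resolutions *)

Section Graded.
Variables (A : nzRingType) (Adeg : nat -> set A).

(* M is the internal direct sum of the G i, and Adeg n *: G i <= G (n + i). *)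
Definition graded_module (M : lmodType A) (G : int -> set M) : Prop :=
  [/\ forall i, G i 0 /\ (forall x y, G i x -> G i y -> G i (x - y)),
      forall (n : nat) (i : int) a x, Adeg n a -> G i x -> G (n%:Z + i) (a *: x)
    & forall x : M, exists! f : {fsfun int -> M with 0},
        (forall i, G i (f i)) /\ x = \sum_(i <- finsupp f) f i].

Definition projective (P : lmodType A) : Prop :=
  forall (M N : lmodType A) (g : {linear M -> N}) (f : {linear P -> N}),
    (forall y, exists x, g x = y) ->
    exists h : {linear P -> M}, forall x, g (h x) = f x.

(* P = A P_i *)
Definition generated_in_degree (P : lmodType A) (G : int -> set P) (i : int) :
    Prop :=
  forall x : P, exists s : seq P, (forall y, y \in s -> G i y) /\ x \in lin_span s.

Definition degree_preserving (M N : lmodType A) (GM : int -> set M)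
    (GN : int -> set N) (f : M -> N) : Prop :=
  forall i x, GM i x -> GN i (f x).

Definition has_linear_resolution (N : lmodType A) (GN : int -> set N) : Prop :=
  exists (P : nat -> lmodType A) (GP : forall i, int -> set (P i))
         (d : forall i, {linear P i.+1 -> P i}) (eps : {linear P 0%N -> N}),
    [/\ forall i, [/\ graded_module (GP i), projective (P i)
                    & generated_in_degree (GP i) i%:Z],
        degree_preserving (GP 0%N) GN eps /\
          (forall i, degree_preserving (GP i.+1) (GP i) (d i)),
        forall y, exists x, eps x = y,
        forall x, eps x = 0 <-> exists y, d 0%N y = x
      & forall i x, d i x = 0 <-> exists y, d i.+1 y = x].

Definition Koszul_module (N : lmodType A) (GN : int -> set N) : Prop :=
  graded_module GN /\ has_linear_resolution GN.

End Graded.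

(** * The algebra Lambda *)

Section RmorphVanish.
Variables (T S : nzRingType) (f : {rmorphism T -> S}).
Lemma rmorph_vanishM x y : f x = 0 -> f (x * y) = 0.
Proof. by rewrite rmorphM => ->; rewrite mul0r. Qed.
Lemma rmorph_vanishD x y : f x = 0 -> f y = 0 -> f (x + y) = 0.
Proof. by rewrite rmorphD => -> ->; rewrite addr0. Qed.
Lemma rmorph_vanishB x y : f x = 0 -> f y = 0 -> f (x - y) = 0.
Proof. by rewrite rmorphB => -> ->; rewrite subr0. Qed.
End RmorphVanish.

Definition vertex := 'I_3.
HB.instance Definition _ := Finite.on vertex.
Definition vl : vertex := @Ordinal 3 0 isT.
Definition vg : vertex := @Ordinal 3 1 isT.
Definition vm : vertex := @Ordinal 3 2 isT.

Section Lambda.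
Variables (k : comNzRingType) (p : nat).

Definition W : seq (int * int) := [:: (p%:Z, 0); (- p%:Z, p%:Z); (0, - p%:Z)].
(* -W *)
Definition mW : seq (int * int) := [:: (- p%:Z, 0); (p%:Z, - p%:Z); (0, p%:Z)].

Definition weight := seq_sub (W ++ mW).

(* The basis of V: inl a stands for v_a and inr a for w_a. *)
Definition arrow := (weight + weight)%type.

(* The basis vector x lies in e_(lv x) V e_(rv x). *)
Definition lv (x : arrow) : vertex :=
  match x with
  | inl a => if ssval a \in W then vl else vg
  | inr a => if ssval a \in W then vm else vl
  end.
Definition rv (x : arrow) : vertex :=
  match x with
  | inl a => if ssval a \in W then vg else vl
  | inr a => if ssval a \in W then vl else vm
  end.

Definition gen := (vertex + arrow)%type.
Definition gen_alg := free_alg k gen.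
Definition fe (s : vertex) : gen_alg := free_gen k (inl s).
Definition fa (x : arrow) : gen_alg := free_gen k (inr x).

(* T_K(V) is the k-algebra generated by K and V, subject to the multiplication
   table of K and the K-bimodule structure of V. *)
Inductive tensor_rel : gen_alg -> Prop :=
| rel_idem s t : tensor_rel (fe s * fe t - (if s == t then fe s else 0))
| rel_unit : tensor_rel (1 - \sum_s fe s)
| rel_left s x : tensor_rel (fe s * fa x - (if s == lv x then fa x else 0))
| rel_right s x : tensor_rel (fa x * fe s - (if s == rv x then fa x else 0)).

(* The character e_lambda |-> 1, all other generators |-> 0. *)
Definition aug_word (m : {fmonom gen}) : k :=
  (all (pred1 (inl vl : gen)) m)%:R.
Fact aug_word_mmorphism : mmorphism aug_word.
Proof.
split=> [m1 m2|]; last by rewrite /aug_word fm1.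
by rewrite /aug_word fmM all_cat -natrM mulnb.
Qed.
HB.instance Definition _ :=
  monalg.isMultiplicative.Build _ k aug_word aug_word_mmorphism.

Definition aug : {rmorphism gen_alg -> k} := mmap idfun aug_word.

Lemma aug_gen i : aug (free_gen k i) = (i == inl vl)%:R.
Proof. by rewrite /aug /= mmapU mul1r /aug_word fmU /= andbT. Qed.

Lemma aug_tensor x : tensor_rel x -> aug x = 0.
Proof.
case=> [s t||s a|s a].
- rewrite rmorphB rmorphM !aug_gen; have [->|st] := eqVneq s t.
    by rewrite aug_gen; case: (_ == _); rewrite ?mulr1 ?mulr0 subrr.
  rewrite rmorph0 subr0 -natrM mulnb.
  suff -> : (inl s == inl vl :> gen) && (inl t == inl vl :> gen) = false by [].
  by apply: contraNF st => /andP[hs ht]; rewrite (eqP (hs : s == vl)) eq_sym.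
- rewrite rmorphB rmorph1 rmorph_sum (bigD1 vl) //= big1 => [|s sl].
    by rewrite aug_gen eqxx addr0 subrr.
  by rewrite aug_gen [_ == _](negbTE sl).
- by rewrite rmorphB rmorphM (aug_gen (inr a)) mulr0 sub0r; case: ifP;
    rewrite ?rmorph0 ?aug_gen oppr0.
- by rewrite rmorphB rmorphM (aug_gen (inr a)) mul0r sub0r; case: ifP;
    rewrite ?rmorph0 ?aug_gen oppr0.
Qed.

Definition tensor_relations : relations gen_alg :=
  Relations (ideal_proper aug_tensor).

Definition tensor := quot_ring tensor_relations.
HB.instance Definition _ := GRing.Algebra.on tensor.

(* Junk value 0 outside W and mW. *)
Definition tv (a : int * int) : tensor :=
  if insub a is Some b then quot_pi tensor_relations (fa (inl b)) else 0.
Definition tw (a : int * int) : tensor :=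
  if insub a is Some b then quot_pi tensor_relations (fa (inr b)) else 0.

Inductive lambda_rel : tensor -> Prop :=
| rel_vv0 a b of a \in mW & b \in mW & a != b : lambda_rel (tv a * tv (- b))
| rel_vv a b of a \in mW & b \in mW :
    lambda_rel (tv a * tv (- a) - tv b * tv (- b))
| rel_ww0 a b of a \in mW & b \in mW & a != b : lambda_rel (tw (- a) * tw b)
| rel_ww a b of a \in mW & b \in mW :
    lambda_rel (tw (- a) * tw a - tw (- b) * tw b)
| rel_wv a b of a \in mW & b \in mW :
    lambda_rel (tw (- a) * tv (- b) + tw (- b) * tv (- a))
| rel_vw a b of a \in mW & b \in mW :
    lambda_rel (tv a * tw b + tv b * tw a)
| rel_vvww0 a b of a \in mW & b \in mW & a != b :
    lambda_rel (tv (- a) * tv b + tw b * tw (- a))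
| rel_vvww a b of a \in mW & b \in mW :
    lambda_rel ((tv (- a) * tv a + tw a * tw (- a))
                - (tv (- b) * tv b + tw b * tw (- b))).

HB.instance Definition _ := GRing.isZmodMorphism.Build tensor k
  (quot_lift aug) (quot_liftB (X := tensor_relations) aug_tensor).
HB.instance Definition _ := GRing.isMonoidMorphism.Build tensor k
  (quot_lift aug) (quot_liftM (X := tensor_relations) aug_tensor).

Definition tensor_aug : {rmorphism tensor -> k} :=
  quot_lift (X := tensor_relations) aug.

Lemma tensor_aug_v a : tensor_aug (tv a) = 0.
Proof.
rewrite /tv; case: insub => [b|]; last exact: rmorph0.
by rewrite [LHS]quot_liftE ?aug_gen //; exact: aug_tensor.
Qed.

Lemma tensor_aug_w a : tensor_aug (tw a) = 0.
Proof.
rewrite /tw; case: insub => [b|]; last exact: rmorph0.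
by rewrite [LHS]quot_liftE ?aug_gen //; exact: aug_tensor.
Qed.

Lemma aug_lambda x : lambda_rel x -> tensor_aug x = 0.
Proof.
move: tensor_aug tensor_aug_v tensor_aug_w => f fv fw.
case=> [a b|a b|a b|a b|a b|a b|a b|a b] *.
- exact: rmorph_vanishM.
- by apply: rmorph_vanishB; apply: rmorph_vanishM.
- exact: rmorph_vanishM.
- by apply: rmorph_vanishB; apply: rmorph_vanishM.
- by apply: rmorph_vanishD; apply: rmorph_vanishM.
- by apply: rmorph_vanishD; apply: rmorph_vanishM.
- by apply: rmorph_vanishD; apply: rmorph_vanishM.
- by apply: rmorph_vanishB; apply: rmorph_vanishD; apply: rmorph_vanishM.
Qed.

Definition lambda_relations : relations tensor :=
  Relations (ideal_proper aug_lambda).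

Definition Lambda := quot_ring lambda_relations.
HB.instance Definition _ := GRing.Algebra.on Lambda.

Definition Lpi (x : gen_alg) : Lambda :=
  quot_pi lambda_relations (quot_pi tensor_relations x).

Definition Le (s : vertex) : Lambda := Lpi (fe s).
Definition Lv (a : int * int) : Lambda := quot_pi lambda_relations (tv a).
Definition Lw (a : int * int) : Lambda := quot_pi lambda_relations (tw a).

(* All relations are homogeneous for the number of arrows in a word; the degree n
   part of Lambda is the image of the words with n arrows. *)
Definition word_degree (m : {fmonom gen}) : nat :=
  count (fun g : gen => if g is inr _ then true else false) m.

Definition free_deg (n : nat) : set gen_alg :=
  [set f | forall m, m \in msupp f -> word_degree m = n].

Definition Lambda_deg (n : nat) : set Lambda := Lpi @` free_deg n.

(* The grading induced from Lambda on Lambda e / (Lambda s_0 + ...). *)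
Definition left_quot_deg (e : Lambda) (s : seq Lambda) (i : int) :
    set (left_quot e s) :=
  match i with
  | Posz n => [set u | exists x : left_ideal e,
                  Lambda_deg n (span_val x) /\ u = mod_pi (@left_sub _ e s) x]
  | Negz _ => [set 0]
  end.

Definition Z_lambda_rels : seq Lambda :=
  [:: Lv (0, p%:Z); Lv (p%:Z, - p%:Z); Lw (- p%:Z, p%:Z); Lw (p%:Z, 0)].
Definition Z_gamma_rels : seq Lambda := [:: Lv (p%:Z, 0)].
Definition Z_mu_rels : seq Lambda := [:: Lw (0, p%:Z)].

Definition Z_lambda := left_quot (Le vl) Z_lambda_rels.
HB.instance Definition _ := GRing.Lmodule.on Z_lambda.
Definition Z_gamma := left_quot (Le vg) Z_gamma_rels.
HB.instance Definition _ := GRing.Lmodule.on Z_gamma.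
Definition Z_mu := left_quot (Le vm) Z_mu_rels.
HB.instance Definition _ := GRing.Lmodule.on Z_mu.

Definition Z_lambda_deg : int -> set Z_lambda :=
  @left_quot_deg (Le vl) Z_lambda_rels.
Definition Z_gamma_deg : int -> set Z_gamma :=
  @left_quot_deg (Le vg) Z_gamma_rels.
Definition Z_mu_deg : int -> set Z_mu :=
  @left_quot_deg (Le vm) Z_mu_rels.

End Lambda.

(* Main.v *)
Require Import Defs.
From HB Require Import structures.
From mathcomp Require Import all_boot all_order all_algebra finmap.
From mathcomp Require Import boolp classical_sets functions monalg.

Set Implicit Arguments.
Unset Strict Implicit.
Unset Printing Implicit Defensive.

Import GRing.Theory.
Local Open Scope ring_scope.

(** Number the elements (p,0), (-p,p), (0,-p) of W by 1, 2, 3; let v_i, w_i be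
    the arrows indexed by W and v'_i, w'_i those indexed by the opposite
    weights.  The relations say that v'_i v_j and w_i w'_j are Kronecker deltas
    times a common element, that w_i v_j and v'_i w'_j are alternating in i, j,
    and that v_i v'_j + w'_j w_i is a Kronecker delta times a common element.

    Z_gamma = Lambda e_gamma / Lambda v_1 has an explicit linear resolution.
    With S = k[x, y], put P^(2m) = Lambda e_gamma (x) S_m + Lambda e_mu (x) S_(m-1)
    and P^(2m+1) = Lambda e_lambda (x) S_m; the differential multiplies on the
    right by v_1 and w_1 along a fixed monomial, by v'_2 and w'_2 while lowering
    the exponent of x, and by v'_3 and w'_3 while lowering the exponent of y.
    So it is glued from the complexes Lambda e_mu -> Lambda e_lambda ->
    Lambda e_gamma given by w_1 and v_1 and from Koszul complexes in x and y.
    Its exactness is a diagram chase that uses only five facts about right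
    multiplications in Lambda; they are collected in strand_datum, and
    sdiff_exact is the chase.  Exchanging v with w', v' with w, gamma with mu
    and 1 with 3 preserves the relations, so Z_mu is resolved in the same way.
    Finally right multiplication by w_2 embeds Z_mu, shifted by one, into the
    syzygy Lambda v_1 of Z_gamma with quotient Z_lambda; the embedding lifts to
    an explicit chain map and the mapping cone resolves Z_lambda (cone_Koszul).

    It remains to know Lambda well enough to prove the five facts.  It has a
    basis of 48 words on which the arrows act on the right by sparse integer
    matrices.  These matrices satisfy the relations, so they represent Lambda
    and give coordinates of its elements.  Conversely the relations of Lambda
    express every product of a basis word and an arrow as the matrices predict
    (mul_table_correct), so an element is recovered from its coordinates.  Each of
    the facts then follows from an identity between integer matrices
    (exact_certP), checked by evaluation, and the grading of Lambda is by the
    length of the basis words.  The characteristic enters through 2, which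
    has to be inverted in 2 w_i v_i = 0 and 2 v'_i w'_i = 0. *)

(** * Graded rings and modules *)

Section GradedByProjections.
Variables (A : nzRingType) (Adeg : nat -> set A) (M : lmodType A).
Variables (G : int -> set M) (pr : int -> M -> M) (s : seq int).
Hypothesis prB : forall j, zmod_morphism (pr j).
Hypothesis pr_deg : forall j x, G j (pr j x).
Hypothesis pr_id : forall j x, G j x -> pr j x = x.
Hypothesis pr_ne : forall i j x, i != j -> G j x -> pr i x = 0.
Hypothesis s_uniq : uniq s.
Hypothesis pr_sum : forall x, x = \sum_(j <- s) pr j x.
Hypothesis degZ : forall (n : nat) (i : int) a x,
  Adeg n a -> G i x -> G (n%:Z + i) (a *: x).

Let pr0 j : pr j 0 = 0.
Proof. by rewrite -{1}(subrr 0) prB subrr. Qed.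

Let prD j x y : pr j (x + y) = pr j x + pr j y.
Proof.
have prN z : pr j (- z) = - pr j z by rewrite -sub0r prB pr0 sub0r.
by rewrite -{1}[y]opprK prB prN opprK.
Qed.

Let pr_bigsum j (r : seq int) (F : int -> M) :
  pr j (\sum_(i <- r) F i) = \sum_(i <- r) pr j (F i).
Proof. by apply: (big_morph (pr j)) => [x y|]; [exact: prD | exact: pr0]. Qed.

(* Off the bound s all projections vanish. *)
Let pr_off j x : j \notin s -> pr j x = 0.
Proof.
move=> js; rewrite (pr_sum x) pr_bigsum big_seq big1 // => i is_.
by apply: (@pr_ne j i) => //; apply: contraNneq js => ->.
Qed.

(** Projections onto the homogeneous parts, almost all of them zero, determine
    the decomposition: the component of degree j has to be pr j x. *)
Lemma graded_by_projections : graded_module Adeg G.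
Proof.
split=> // [i|x].
  split=> [|x y Gx Gy]; first by rewrite -(pr0 i); exact: pr_deg.
  by rewrite -(pr_id Gx) -(pr_id Gy) -prB; exact: pr_deg.
pose f : {fsfun int -> M with 0} := [fsfun j in [fset j in s]%fset => pr j x].
have fE j : f j = pr j x.
  rewrite fsfunE in_fset /=; case: ifPn => // js.
  by rewrite pr_off.
have supp_s j : j \in finsupp f -> j \in s.
  by rewrite mem_finsupp; apply: contraNT => js; rewrite fE pr_off.
exists f; split.
  split=> [i|]; first by rewrite fE.
  rewrite {1}(pr_sum x) (eq_bigr f) => [|i _]; last by rewrite fE.
  rewrite (bigID (mem (finsupp f))) /= [X in _ + X]big1 ?addr0 => [|i]; last first.
    by rewrite mem_finsupp negbK => /eqP.
  rewrite -big_filter.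
  apply: perm_big; apply: uniq_perm; rewrite ?filter_uniq ?fset_uniq //.
  by move=> j; rewrite mem_filter; apply: andb_idr; exact: supp_s.
move=> g [Gg xE]; apply/fsfunP => j; rewrite fE xE pr_bigsum.
have [jg|jg] := boolP (j \in finsupp g); last first.
  rewrite (fsfun_dflt jg) big_seq big1 // => i ig.
  by apply: (@pr_ne j i) => //; apply: contraNneq jg => ->.
rewrite (bigD1_seq j) //= (pr_id (Gg j)) big1 ?addr0 // => i ij.
by apply: (@pr_ne j i) => //; rewrite eq_sym.
Qed.

End GradedByProjections.

(** A grading given by its projections; htop bounds the degrees that occur, as
    Lambda is finite dimensional. *)
Record ring_grading (A : nzRingType) (Adeg : nat -> set A) := RingGrading {
  hcomp : nat -> A -> A;
  htop : nat;
  hcompB : forall n, zmod_morphism (hcomp n);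
  hcomp_deg : forall n x, Adeg n (hcomp n x);
  hcomp_id : forall n x, Adeg n x -> hcomp n x = x;
  hcomp_ne : forall m n x, m != n -> Adeg n x -> hcomp m x = 0;
  hcomp_sum : forall x, x = \sum_(n < htop) hcomp n x;
  hdegM : forall m n x y, Adeg m x -> Adeg n y -> Adeg (m + n)%N (x * y) }.

Section RingGrading.
Variables (A : nzRingType) (Adeg : nat -> set A) (gr : ring_grading Adeg).
Local Notation cmp := (hcomp gr).

Lemma hcomp0 n : cmp n 0 = 0.
Proof. by rewrite -{1}(subrr 0) hcompB subrr. Qed.

Lemma hcompN n x : cmp n (- x) = - cmp n x.
Proof. by rewrite -sub0r hcompB hcomp0 sub0r. Qed.

Lemma hcompD n x y : cmp n (x + y) = cmp n x + cmp n y.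
Proof. by rewrite -{1}[y]opprK hcompB hcompN opprK. Qed.

Lemma hcomp_bigsum n (J : Type) (r : seq J) (F : J -> A) :
  cmp n (\sum_(i <- r) F i) = \sum_(i <- r) cmp n (F i).
Proof. by apply: (big_morph (cmp n)) => [x y|]; [exact: hcompD|exact: hcomp0]. Qed.

Lemma hdeg0 n : Adeg n 0.
Proof. by rewrite -(hcomp0 n); exact: hcomp_deg. Qed.

Lemma hdegD n x y : Adeg n x -> Adeg n y -> Adeg n (x + y).
Proof.
by move=> hx hy; rewrite -(hcomp_id gr hx) -(hcomp_id gr hy) -hcompD; exact: hcomp_deg.
Qed.

Lemma hcomp_top n x : (htop gr <= n)%N -> cmp n x = 0.
Proof.
move=> le_n; rewrite (hcomp_sum gr x) hcomp_bigsum big1 // => i _.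
apply: (hcomp_ne _ _ (hcomp_deg gr i x)).
by rewrite neq_ltn (leq_trans (ltn_ord i) le_n) orbT.
Qed.

(** Multiplication by a homogeneous element shifts components.  Hence left
    ideals generated by homogeneous elements are graded. *)
Lemma hcompMr d n x y : Adeg d y -> cmp (n + d)%N (x * y) = cmp n x * y.
Proof.
move=> dy; rewrite {1}(hcomp_sum gr x) mulr_suml hcomp_bigsum.
have xy i := hdegM gr (hcomp_deg gr i x) dy.
have [lt_n|le_n] := ltnP n (htop gr); last first.
  rewrite (hcomp_top _ le_n) mul0r big1 // => i _.
  by rewrite (hcomp_ne gr _ (xy i)) // eqn_add2r neq_ltn (leq_trans (ltn_ord i)) ?orbT.
rewrite (bigD1 (Ordinal lt_n)) //= (hcomp_id gr (xy n)) big1 ?addr0 // => i ni.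
by rewrite (hcomp_ne gr _ (xy i)) // eqn_add2r eq_sym.
Qed.

Lemma hcompMr_lt d n x y : Adeg d y -> (n < d)%N -> cmp n (x * y) = 0.
Proof.
move=> dy lt_nd; rewrite (hcomp_sum gr x) mulr_suml hcomp_bigsum big1 // => i _.
rewrite (hcomp_ne gr _ (hdegM gr (hcomp_deg gr i x) dy)) //.
by rewrite neq_ltn (leq_trans lt_nd) // leq_addl.
Qed.

(** Modules are graded by integers although the ring lives in natural degrees. *)
Definition zdeg (j : int) : set A := if j is Posz n then Adeg n else [set 0]%classic.
Definition zcomp (j : int) (x : A) : A := if j is Posz n then cmp n x else 0.

Lemma zcompB j : zmod_morphism (zcomp j).
Proof. by case: j => n x y /=; rewrite ?subr0 // hcompB. Qed.

Lemma zcomp0 j : zcomp j 0 = 0.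
Proof. by case: j => n //=; exact: hcomp0. Qed.

Lemma zcomp_deg j x : zdeg j (zcomp j x).
Proof. by case: j => n //=; exact: hcomp_deg. Qed.

Lemma zdeg0 j : zdeg j 0.
Proof. by case: j => n //=; exact: hdeg0. Qed.

Lemma zdegD j x y : zdeg j x -> zdeg j y -> zdeg j (x + y).
Proof. by case: j => n /=; [exact: hdegD | move=> -> ->; rewrite addr0]. Qed.

Lemma zcomp_id j x : zdeg j x -> zcomp j x = x.
Proof. by case: j => n /=; [exact: hcomp_id | move=> ->]. Qed.

Lemma zcomp_ne i j x : i != j -> zdeg j x -> zcomp i x = 0.
Proof.
case: i => m; case: j => n //= nm; first exact: hcomp_ne.
by move=> ->; exact: hcomp0.
Qed.

Lemma zdegMl n j a x : Adeg n a -> zdeg j x -> zdeg (n%:Z + j) (a * x).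
Proof.
case: j => m na /=; first exact: hdegM.
by move=> ->; rewrite mulr0; exact: zdeg0.
Qed.

Lemma zdegMr j n x a : zdeg j x -> Adeg n a -> zdeg (j + n%:Z) (x * a).
Proof.
case: j => m /=; first exact: hdegM.
by move=> -> _; rewrite mul0r; exact: zdeg0.
Qed.

Lemma zcompMr j d x y : Adeg d y -> zcomp (j + d%:Z) (x * y) = zcomp j x * y.
Proof.
case: j => n dy; first exact: hcompMr.
rewrite /= mul0r; case: (ltnP n d) => [lt_nd|le_dn].
  rewrite (_ : Negz n + d%:Z = (d - n.+1)%N%:Z); last first.
    by rewrite NegzE addrC subzn.
  by rewrite /= (hcompMr_lt _ dy) // ltn_subrL (leq_ltn_trans _ lt_nd).
suff -> : Negz n + d%:Z = Negz (n - d)%N by [].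
by rewrite !NegzE -subSn // -subzn ?opprB 1?addrC // leqW.
Qed.

End RingGrading.

Section LinSpan.
Variables (A : nzRingType) (Adeg : nat -> set A) (gr : ring_grading Adeg).

Lemma lin_spanP (M : lmodType A) (s : seq M) x :
  reflect (exists a : nat -> A, x = \sum_(i < size s) a i *: s`_i)
          (x \in lin_span s).
Proof.
apply: (iffP (asboolP _)) => -[a ->]; last by exists (fun i : 'I__ => a i).
exists (fun i => if insub i is Some j then a j else 0).
by apply: eq_bigr => i _; rewrite valK.
Qed.

Lemma lin_span1P (M : lmodType A) (e : M) x :
  reflect (exists a : A, x = a *: e) (x \in lin_span [:: e]).
Proof.
apply: (iffP (lin_spanP _ _)) => -[a ->].
  by exists (a 0); rewrite big_ord_recl big_ord0 addr0.
by exists (fun=> a); rewrite big_ord_recl big_ord0 addr0.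
Qed.

Lemma hcomp_lin_span d (s : seq A) n (x : A) :
  (forall y, y \in s -> Adeg d y) ->
  x \in lin_span (s : seq A^o) -> hcomp gr n x \in lin_span (s : seq A^o).
Proof.
move=> ds /lin_spanP[a ->]; apply/lin_spanP.
exists (fun i => if (d <= n)%N then hcomp gr (n - d) (a i) else 0).
rewrite hcomp_bigsum; apply: eq_bigr => i _.
have dsi : Adeg d (s`_i : A) by apply: ds; exact: mem_nth.
case: leqP => [le_dn|lt_nd]; last by rewrite scale0r (hcompMr_lt _ _ dsi lt_nd).
by rewrite -{1}(subnK le_dn) hcompMr.
Qed.

End LinSpan.

(** ** Cyclic modules with homogeneous relations *)
Section QuotientGrading.
Variables (A : nzRingType) (Adeg : nat -> set A) (gr : ring_grading Adeg).
Variables (e : A) (s : seq A).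
Hypothesis (deg_e : Adeg 0%N e) (deg_s : forall y, y \in s -> Adeg 1%N y).

Definition quot_deg (i : int) : set (left_quot e s) :=
  match i with
  | Posz n => [set u | exists x : left_ideal e,
                  Adeg n (span_val x) /\ u = mod_pi (@left_sub _ e s) x]%classic
  | Negz _ => [set 0]%classic
  end.

Local Notation qpi := (mod_pi (@left_sub A e s)).

Fact left_comp_subproof n (x : left_ideal e) :
  hcomp gr n (span_val x) \in lin_span [:: e : A^o].
Proof.
apply: (@hcomp_lin_span _ _ _ 0%N [:: e]) (span_valP x) => y.
by rewrite inE => /eqP ->.
Qed.

Definition left_comp n (x : left_ideal e) : left_ideal e :=
  SpanMod (left_comp_subproof n x).

Lemma left_compB n : zmod_morphism (left_comp n).
Proof.
move=> x y; apply: (@val_inj _ _ (left_ideal e)).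
by have := hcompB gr n (span_val x : A) (span_val y : A).
Qed.

Lemma left_comp_pi n x y : qpi x = qpi y -> qpi (left_comp n x) = qpi (left_comp n y).
Proof.
move=> /mod_pi_eq xy; apply/mod_pi_eq; rewrite -left_compB.
exact: hcomp_lin_span deg_s xy.
Qed.

Definition quot_comp (j : int) (u : left_quot e s) : left_quot e s :=
  if j is Posz n then qpi (left_comp n (mod_repr u)) else 0.

Lemma quot_compE (n : nat) x : quot_comp n (qpi x) = qpi (left_comp n x).
Proof. by apply: left_comp_pi; rewrite mod_reprK. Qed.

Lemma quot_graded : graded_module Adeg quot_deg.
Proof.
have lid n (x : left_ideal e) : Adeg n (span_val x) -> left_comp n x = x.
  by move=> dx; apply: (@val_inj _ _ (left_ideal e)); rewrite /= hcomp_id.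
have lne m n (x : left_ideal e) : m != n -> Adeg n (span_val x) -> left_comp m x = 0.
  by move=> mn dx; apply: (@val_inj _ _ (left_ideal e)); rewrite raddf0 /= (hcomp_ne gr mn).
apply: (@graded_by_projections _ _ _ _ quot_comp
          [seq i%:Z | i <- iota 0 (htop gr)]).
- move=> [n|n] u v /=; last by rewrite subr0.
  rewrite -(mod_reprK u) -(mod_reprK v) -raddfB.
  by rewrite -!/(quot_comp n _) !quot_compE left_compB raddfB.
- by case=> [n|n] u //=; exists (left_comp n (mod_repr u)); split; first exact: hcomp_deg.
- case=> [n|n] u; last by move=> ->.
  by move=> [x [dx ->]]; rewrite quot_compE lid.
- case=> [m|m] [n|n] u //= mn.
  + by move=> [x [dx ->]]; rewrite -/(quot_comp m _) quot_compE (lne m n) ?raddf0.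
  + move=> ->; rewrite -/(quot_comp m _) -(raddf0 (mod_pi (@left_sub A e s))) quot_compE.
    by rewrite -{1}(subrr 0) left_compB subrr.
- by rewrite map_inj_uniq ?iota_uniq // => m n [].
- move=> u; rewrite -(mod_reprK u) big_map.
  under eq_bigr do rewrite quot_compE.
  rewrite -raddf_sum; congr mod_pi; apply: (@val_inj _ _ (left_ideal e)).
  rewrite raddf_sum /= [LHS](hcomp_sum gr) /=.
  by rewrite -(big_mkord xpredT (fun i => hcomp gr i _)) /index_iota subn0.
- move=> n [m|m] a u da /=.
    move=> [x [dx ->]]; exists (a *: x).
    by split; [exact: hdegM | rewrite linearZ].
  move=> ->; rewrite scaler0; case: (n%:Z + Negz m) => // l.
  by exists 0; split; [have := hdeg0 gr l | rewrite raddf0].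
Qed.

End QuotientGrading.

(** * Graded projective modules with a basis of idempotents *)

(** The direct sum of the left ideals A (E i), for i in S, is realised inside
    the functions from a fixed index type I to A.  All terms of a complex then
    share one ambient module, and one map of that module induces all the
    differentials. *)
Section Based.
Variables (A : nzRingType) (I : choiceType) (E : I -> A).
Local Notation T := (I -> A^o).

Definition based (S : seq I) : {pred T} :=
  fun x => `[< forall i, (x i : A) * E i = x i /\ (i \notin S -> x i = 0) >].

Variable S : seq I.

Lemma basedP (x : T) :
  reflect (forall i, (x i : A) * E i = x i /\ (i \notin S -> x i = 0)) (x \in based S).
Proof. exact: asboolP. Qed.

Lemma based_submod_closed : GRing.submod_closed (based S).
Proof.
split=> [|c x y].
  by apply/basedP => i; rewrite mul0r.
move=> /basedP xS /basedP yS; apply/basedP => i.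
have xyE : (c *: x + y) i = c * (x i : A) + (y i : A) by [].
have [xE x0] := xS i; have [yE y0] := yS i; split=> [|iS].
  by rewrite xyE mulrDl -mulrA xE yE.
by rewrite xyE x0 // y0 // mulr0 addr0.
Qed.
HB.instance Definition _ := GRing.isSubmodClosed.Build A T (based S)
  based_submod_closed.

Record based_mod := BasedMod { bval : T; bvalP : bval \in based S }.
HB.instance Definition _ := [isSub for bval].
HB.instance Definition _ := [Choice of based_mod by <:].
HB.instance Definition _ := [SubChoice_isSubLmodule of based_mod by <:].

Lemma bval_idem (x : based_mod) i : (bval x i : A) * E i = bval x i.
Proof. by have /basedP/(_ i)[] := bvalP x. Qed.

Lemma bval_off (x : based_mod) i : i \notin S -> bval x i = 0.
Proof. by have /basedP/(_ i)[] := bvalP x. Qed.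

Lemma bval_inj (x y : based_mod) : bval x =1 bval y -> x = y.
Proof. by move=> xy; apply: val_inj; exact: funext. Qed.

Lemma bvalZ a (x : based_mod) i : bval (a *: x) i = a * (bval x i : A).
Proof. by []. Qed.
Lemma bval_sum (J : Type) (r : seq J) (F : J -> based_mod) i :
  bval (\sum_(j <- r) F j) i = \sum_(j <- r) bval (F j) i.
Proof. by apply: (big_morph (fun x : based_mod => bval x i)). Qed.

Hypothesis E_idem : forall i, E i * E i = E i.

Fact unit_vec_subproof i :
  (fun j => if (j == i) && (i \in S) then E i else 0 : A^o) \in based S.
Proof.
apply/basedP => j; have [->|] := eqVneq j i; last by rewrite /= mul0r.
by case: (i \in S) => //=; rewrite ?E_idem ?mul0r.
Qed.
Definition unit_vec i : based_mod := BasedMod (unit_vec_subproof i).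

Lemma unit_vec_sum (x : based_mod) :
  x = \sum_(i <- undup S) (bval x i : A) *: unit_vec i.
Proof.
apply: bval_inj => j; rewrite bval_sum.
have [jS|jS] := boolP (j \in S); last first.
  rewrite bval_off // big_seq big1 // => i; rewrite mem_undup => iS.
  rewrite bvalZ /=; case: eqVneq => [ji|]; last by rewrite mulr0.
  by rewrite ji iS in jS.
rewrite (bigD1_seq j) ?undup_uniq ?mem_undup // big1 ?addr0 => [|i ij].
  by rewrite bvalZ /= eqxx jS bval_idem addr0.
by rewrite bvalZ /= eq_sym (negbTE ij) mulr0.
Qed.

(** A map is determined by the images of the vectors E i, and a linear map
    takes any values m i there once x i is used as the coefficient. *)
Lemma based_projective : projective (based_mod : lmodType A).
Proof.
move=> M N g f g_surj.
have [m mP] := choice (fun i => g_surj (f (unit_vec i))).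
pose h (x : based_mod) : M := \sum_(i <- undup S) (bval x i : A) *: m i.
have h_lin : linear h.
  move=> a x y; rewrite /h scaler_sumr -big_split; apply: eq_bigr => i _ /=.
  by rewrite scalerA -scalerDl.
pose hL : {linear based_mod -> M} :=
  HB.pack h (GRing.isLinear.Build A based_mod M *:%R h h_lin).
exists hL => x; rewrite [in RHS](unit_vec_sum x) !raddf_sum /=.
by apply: eq_bigr => i _; rewrite !linearZ /= mP.
Qed.

Variables (Adeg : nat -> set A) (gr : ring_grading Adeg) (n : nat).
Hypothesis E_deg : forall i, Adeg 0%N (E i).

(** The generators E i are placed in degree n. *)
Definition based_deg (j : int) : set based_mod :=
  [set x | forall i, zdeg Adeg (j - n%:Z) (bval x i)]%classic.

Fact based_comp_subproof j (x : based_mod) :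
  (fun i => zcomp gr (j - n%:Z) (bval x i) : A^o) \in based S.
Proof.
apply/basedP => i; split=> [|iS]; last by rewrite bval_off // zcomp0.
by rewrite -(zcompMr gr _ _ (E_deg i)) addr0 bval_idem.
Qed.
Definition based_comp j (x : based_mod) : based_mod :=
  BasedMod (based_comp_subproof j x).

Lemma based_graded : graded_module Adeg based_deg.
Proof.
apply: (@graded_by_projections _ _ _ _ based_comp
          [seq n%:Z + i%:Z | i <- iota 0 (htop gr)]).
- by move=> j x y; apply: bval_inj => i; have := zcompB gr (j - n%:Z) (bval x i : A) (bval y i : A).
- by move=> j x i; exact: zcomp_deg.
- by move=> j x dx; apply: bval_inj => i /=; rewrite zcomp_id.
- move=> i j x ij dx; apply: bval_inj => l /=.
  by rewrite (zcomp_ne gr _ (dx l)) //; apply: contra ij => /eqP/addIr ->.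
- by rewrite map_inj_uniq ?iota_uniq // => i j /addrI[].
- move=> x; apply: bval_inj => i; rewrite bval_sum big_map [LHS](hcomp_sum gr).
  rewrite -(big_mkord xpredT (fun j => hcomp gr j _)) /index_iota subn0.
  by apply: eq_bigr => j _; rewrite /= addrC addKr.
- by move=> m j a x da dx i; rewrite bvalZ -addrA; exact: (zdegMl gr).
Qed.

Lemma based_generated : generated_in_degree based_deg n%:Z.
Proof.
move=> x; exists [seq unit_vec i | i <- undup S]; split.
  move=> y /mapP[i iS ->] j /=; rewrite subrr /=.
  by case: ifP => _; [exact: E_deg | exact: (hdeg0 gr)].
apply/lin_spanP; exists (fun l => nth 0 [seq (bval x i : A) | i <- undup S] l).
rewrite {1}(unit_vec_sum x) -[in RHS](big_mkord xpredT
  (fun l => nth 0 [seq (bval x i : A) | i <- undup S] l *: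
            nth 0 [seq unit_vec i | i <- undup S] l)).
rewrite size_map; case: S (undup S) => [|i0 S'] u.
  case: u => [|i0 u]; first by rewrite big_nil big_geq.
  rewrite (big_nth i0); apply: eq_big_nat => l /andP[_ lt_l].
  by rewrite !(nth_map i0).
rewrite (big_nth i0); apply: eq_big_nat => l /andP[_ lt_l].
by rewrite !(nth_map i0).
Qed.

End Based.

(** ** A criterion for linear resolutions

    A single endomorphism D of the functions from I to A that multiplies by
    elements of degree 1 and lowers the level of indices by one; the indices of
    level n are listed by supp n.  Exactness may be tested with a preimage of
    any support, as the preimage can be truncated to the right level. *)
Section Resolution.
Variables (A : nzRingType) (Adeg : nat -> set A) (gr : ring_grading Adeg).
Variables (I : choiceType) (E : I -> A) (supp : nat -> seq I) (D : (I -> A^o) -> (I -> A^o)).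
Local Notation T := (I -> A^o).
Definition trunc (S : seq I) (x : T) : T := fun i => if i \in S then x i else 0.

Hypothesis E_idem : forall i, E i * E i = E i.
Hypothesis E_deg : forall i, Adeg 0%N (E i).
Hypothesis D_lin : linear D.
Hypothesis D_val : forall x i, (D x i : A) * E i = D x i.
Hypothesis D_deg : forall j (x : T),
  (forall i, zdeg Adeg j (x i)) -> forall i, zdeg Adeg (j + 1) (D x i).
Hypothesis D_trunc : forall n x, D (trunc (supp n.+1) x) = trunc (supp n) (D x).
Hypothesis DD : forall n x, (forall i, (x i : A) * E i = x i) ->
  forall i, i \in supp n -> D (D x) i = 0.
Hypothesis D_exact : forall n x, x \in based E (supp n.+1) -> D x = 0 ->
  exists y, (forall i, (y i : A) * E i = y i) /\ forall i, i \in supp n.+1 -> D y i = x i.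

Variables (e : A) (s : seq A) (i0 : I).
Hypothesis supp0 : supp 0%N = [:: i0].
Hypothesis E0 : E i0 = e.
Hypothesis deg_s : forall y, y \in s -> Adeg 1%N y.
Hypothesis D_aug : forall x : A, x * e = x -> x \in lin_span (s : seq A^o) <->
  exists y, (forall i, (y i : A) * E i = y i) /\ D y i0 = x.

Local Notation P n := (based_mod E (supp n)).

Lemma trunc_based S x : (forall i, (x i : A) * E i = x i) -> trunc S x \in based E S.
Proof.
move=> xE; apply/basedP => i; rewrite /trunc; split=> [|/negbTE -> //].
by case: ifP => // _; rewrite mul0r.
Qed.

Lemma trunc_id S x : x \in based E S -> trunc S x = x.
Proof.
move=> /basedP xS; apply: funext => i; rewrite /trunc.
by case: ifPn => // /(xS i).2.
Qed.

Fact diff_subproof n (x : P n.+1) : D (bval x) \in based E (supp n).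
Proof.
by rewrite -(trunc_id (bvalP x)) D_trunc; apply: trunc_based => i; exact: D_val.
Qed.
Definition diff n (x : P n.+1) : P n := BasedMod (diff_subproof x).

Lemma diff_linear n : linear (@diff n).
Proof. by move=> a x y; apply: val_inj; rewrite linearP /= -D_lin. Qed.
HB.instance Definition _ n :=
  GRing.isLinear.Build A (P n.+1) (P n) *:%R (@diff n) (@diff_linear n).

Fact augment_subproof (x : P 0%N) : bval x i0 \in lin_span [:: e : A^o].
Proof. by apply/lin_span1P; exists (bval x i0); rewrite -[LHS]bval_idem E0. Qed.
Definition augment (x : P 0%N) : left_quot e s :=
  mod_pi (@left_sub A e s) (SpanMod (augment_subproof x)).

Lemma augment_linear : linear augment.
Proof.
move=> a x y; rewrite /augment -linearP; congr mod_pi.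
by apply: (@val_inj _ _ (left_ideal e)); rewrite linearP.
Qed.
HB.instance Definition _ :=
  GRing.isLinear.Build A (P 0%N) (left_quot e s) *:%R augment augment_linear.

Lemma augment_eq0 x : augment x = 0 <-> (bval x i0 : A) \in lin_span (s : seq A^o).
Proof.
rewrite /augment -[X in _ = X](raddf0 (mod_pi (@left_sub A e s))).
by split=> [/mod_pi_eq|xs]; last apply/mod_pi_eq; rewrite subr0.
Qed.

Theorem based_Koszul : Koszul_module Adeg (@quot_deg A Adeg e s).
Proof.
have e_deg : Adeg 0%N e by rewrite -E0.
split; first exact: (quot_graded gr).
exists (fun n => P n : lmodType A), (fun n => based_deg Adeg n),
  (fun n => @diff n : {linear _ -> _}), (augment : {linear _ -> _}).
split.
- move=> n; split; [exact: (based_graded _ gr n E_deg)|exact: based_projective|].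
  exact: (based_generated E_idem gr n E_deg).
- split=> [j x dx|n j x dx i].
    move: (dx i0); rewrite subr0; case: j {dx} => [n|n] dx /=.
      by exists (SpanMod (augment_subproof x)).
    apply/augment_eq0; rewrite [bval x i0]dx; exact: rpred0.
  have -> : j - n%:Z = j - n.+1%:Z + 1 by rewrite -addn1 PoszD opprD addrA subrK.
  exact: D_deg.
- move=> u; pose y : left_ideal e := mod_repr u.
  have /lin_span1P[a ya] := span_valP y.
  have xS : trunc (supp 0%N) (fun i => a * E i : A^o) \in based E (supp 0%N).
    by apply: trunc_based => i; rewrite -mulrA E_idem.
  exists (BasedMod xS); rewrite -(mod_reprK u); congr mod_pi.
  apply: (@val_inj _ _ (left_ideal e)).
  by rewrite /= /trunc supp0 inE eqxx E0 [RHS]ya.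
- move=> x; rewrite augment_eq0 D_aug; last by rewrite -E0 bval_idem.
  split=> [[y [yE yx]]|[y <-]]; last by exists (bval y); split=> // i; exact: bval_idem.
  exists (BasedMod (trunc_based (supp 1%N) yE)); apply: bval_inj => i /=.
  have S0 j : (j \in supp 0%N) = (j == i0) by rewrite supp0 inE.
  rewrite D_trunc /trunc S0; case: eqP => [->//|/eqP ii0].
  by rewrite bval_off // S0.
- move=> n x; split=> [dx|[y <-]]; last first.
    apply: bval_inj => i /=.
    have [iS|iS] := boolP (i \in supp n); first by apply: (DD _ iS) => l; exact: bval_idem.
    by rewrite -[D _ i]/(bval (diff (diff y)) i) bval_off.
  have Dx : D (bval x) = 0 by move/(congr1 (@bval _ _ _ _)): dx.
  have [y [yE yx]] := D_exact (bvalP x) Dx.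
  exists (BasedMod (trunc_based (supp n.+2) yE)); apply: bval_inj => i /=.
  rewrite D_trunc /trunc; case: ifP => [/yx //|/negbT iS].
  by rewrite bval_off.
Qed.

End Resolution.

(** * The resolution of Z_gamma and of Z_mu *)

(** Indices of the basis vectors of the resolution.  The pair (m, n) stands for
    the monomial x^m y^n; Some false marks the copies of A e0, None those of
    A e1 and Some true those of A e2, so that e0, e1, e2 are e_gamma, e_lambda,
    e_mu for Z_gamma. *)
Definition sidx := (option bool * (nat * nat))%type.

(** The homological degree. *)
Definition slev (i : sidx) : nat :=
  (i.2.1 + i.2.2).*2 + (if i.1 is Some k then if k then 2 else 0 else 1).

Definition ssupp (n : nat) : seq sidx :=
  [seq i <- [seq (k, ij) | k <- [:: None; Some false; Some true],
                ij <- [seq (i, j) | i <- iota 0 n.+1, j <- iota 0 n.+1]]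
  | slev i == n].

Lemma mem_ssupp n i : (i \in ssupp n) = (slev i == n).
Proof.
case: i => k [u v]; rewrite mem_filter; apply: andb_idr => /eqP lev_n.
apply: (allpairs_f (fun k ij => (k, ij))); first by case: k lev_n => [[]|].
have le_n : (u + v <= n)%N by rewrite -lev_n /slev /= -addnn -addnA leq_addr.
apply: (allpairs_f (fun i j => (i, j))); rewrite mem_iota /= add0n ltnS.
  exact: leq_trans (leq_addr _ _) le_n.
exact: leq_trans (leq_addl _ _) le_n.
Qed.

Section StrandDef.
Variables (A : nzRingType) (e0 e1 e2 a b c r s t : A).
Local Notation T := (sidx -> A^o).

Definition sidem (i : sidx) : A :=
  match i.1 with None => e1 | Some false => e0 | Some true => e2 end.

Definition sdiff (x : T) : T := fun i =>
  let: (k, (m, n)) := i in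
  match k with
  | Some false => (x (None, (m, n)) : A) * a
  | None => (x (Some false, (m.+1, n)) : A) * b + (x (Some false, (m, n.+1)) : A) * c
            + (x (Some true, (m, n)) : A) * r
  | Some true => (x (None, (m.+1, n)) : A) * s + (x (None, (m, n.+1)) : A) * t
  end.

Lemma sdiff_linear : linear sdiff.
Proof.
have E u (x y : T) i : ((u *: x + y) i : A) = u * (x i : A) + (y i : A) by [].
move=> u x y; apply: funext => -[[[]|] [m n]]; rewrite E /= !E !mulrDl -!mulrA.
- by rewrite mulrDr addrACA.
- by [].
- by rewrite !mulrDr [X in X + _]addrACA [LHS]addrACA.
Qed.

Lemma sdiff_trunc n x : sdiff (trunc (ssupp n.+1) x) = trunc (ssupp n) (sdiff x).
Proof.
apply: funext => -[[[]|] [u v]]; rewrite /trunc /= !mem_ssupp /slev /=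
  ?(addSn, addnS, addn0, doubleS, eqSS); by case: eqP; rewrite ?mul0r ?addr0.
Qed.

End StrandDef.

Section Strand.
Variables (A : nzRingType) (e0 e1 e2 a b c r s t : A).
Local Notation T := (sidx -> A^o).

(** For Z_gamma the elements a, b, c are v_1, v'_2, v'_3 and r, s, t are w_1,
    w'_2, w'_3.  The fields sd_ex* state that an element killed by a right
    multiplication, or by one up to other multiples, is itself a multiple; they
    are what the multiplication table of Lambda is for. *)
Record strand_datum : Prop := StrandDatum {
  sd_idem : [/\ e0 * e0 = e0, e1 * e1 = e1 & e2 * e2 = e2];
  sd_a : e1 * a = a /\ a * e0 = a;
  sd_b : e0 * b = b /\ b * e1 = b;
  sd_c : e0 * c = c /\ c * e1 = c;
  sd_r : e2 * r = r /\ r * e1 = r;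
  sd_s : e1 * s = s /\ s * e2 = s;
  sd_t : e1 * t = t /\ t * e2 = t;
  sd_a0 : [/\ b * a = 0, c * a = 0 & r * a = 0];
  sd_r0 : r * s = 0 /\ r * t = 0;
  sd_bc0 : b * s = 0 /\ c * t = 0;
  sd_cs : c * s = - (b * t);
  sd_sr : s * r = - (a * b);
  sd_tr : t * r = - (a * c);
  sd_exb : forall g h f, g * e0 = g -> g * b + h * c + f * r = 0 -> exists y, g = y * a;
  sd_exc : forall g h f, g * e0 = g -> h * b + g * c + f * r = 0 -> exists y, g = y * a;
  sd_exr : forall f, f * e2 = f -> f * r = 0 -> exists y, f = y * (b * t);
  sd_exa : forall x, x * e1 = x -> x * a = 0 ->
    exists y : A * A * A, x = y.1.1 * b + y.1.2 * c + y.2 * r;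
  sd_exbt : forall g, g * e0 = g -> g * (b * t) = 0 -> exists y, g = y * a }.

Hypothesis sd : strand_datum.
Local Notation E := (sidem e0 e1 e2).
Local Notation D := (sdiff a b c r s t).

Lemma sidem_idem i : E i * E i = E i.
Proof. by have [? ? ?] := sd_idem sd; case: i => [[[]|] ?]. Qed.

Lemma sdiff_val x i : (D x i : A) * E i = D x i.
Proof.
have [[_ aE] [_ bE] [_ cE]] := And3 (sd_a sd) (sd_b sd) (sd_c sd).
have [[_ rE] [_ sE] [_ tE]] := And3 (sd_r sd) (sd_s sd) (sd_t sd).
by case: i => [[[]|] [m n]]; rewrite /= /sidem /= ?mulrDl -!mulrA ?aE ?bE ?cE ?rE ?sE ?tE.
Qed.

Lemma sdiff_sdiff x : D (D x) = 0.
Proof.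
have [ba ca ra] := sd_a0 sd; have [rs rt] := sd_r0 sd; have [bs ct] := sd_bc0 sd.
apply: funext => -[[[]|] [m n]] /=; rewrite !mulrDl -!mulrA.
- by rewrite bs ct rs rt (sd_cs sd) !mulr0 !addr0 mulrN add0r addNr.
- by rewrite ba ca ra !mulr0 !addr0.
- rewrite (sd_sr sd) (sd_tr sd) !mulrN addrACA.
  by rewrite [X in X + _]subrr add0r subrr.
Qed.

(** For a cycle (g, f) all entries of g but the constant one are multiples of a
    because their combinations with b and c are.  Writing g = u a and
    subtracting the boundary of u leaves f with f r = 0, so f = w b t, and w b
    placed one step up in y has boundary f since b s = 0 and b a = 0. *)
Lemma sdiff_exact_even x :
  (forall i, (x i : A) * E i = x i) -> D x = 0 ->
  (exists y, x (Some false, (0, 0)%N) = y * a) ->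
  exists y : nat * nat -> A, forall m n,
    [/\ y (m, n) * e1 = y (m, n), y (m, n) * a = x (Some false, (m, n))
      & y (m.+1, n) * s + y (m, n.+1) * t = x (Some true, (m, n))].
Proof.
move=> xE Dx x00.
have [ba ca ra] := sd_a0 sd; have [rs rt] := sd_r0 sd; have [bs ct] := sd_bc0 sd.
have [[ea aE] [_ bE] [es _] [et _]] := And4 (sd_a sd) (sd_b sd) (sd_s sd) (sd_t sd).
have [_ e1e1 _] := sd_idem sd.
pose G m n : A := x (Some false, (m, n)).
pose F m n : A := x (Some true, (m, n)).
have GE m n : G m n * e0 = G m n := xE (Some false, (m, n)).
have FE m n : F m n * e2 = F m n := xE (Some true, (m, n)).
have DxL m n : G m.+1 n * b + G m n.+1 * c + F m n * r = 0.
  exact: (congr1 (fun f : T => f (None, (m, n))) Dx).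
have Ga (mn : nat * nat) : exists y, G mn.1 mn.2 = y * a.
  case: mn => -[|m] [|n] //=.
  - exact: (sd_exc sd (GE _ _) (DxL 0 n)).
  - exact: (sd_exb sd (GE _ _) (DxL m 0)).
  - exact: (sd_exb sd (GE _ _) (DxL m n.+1)).
have [u uP] := choice Ga.
pose F' m n := F m n - (u (m.+1, n) * s + u (m, n.+1) * t).
have F'r m n : F' m n * r = 0.
  rewrite mulrBl mulrDl -!mulrA (sd_sr sd) (sd_tr sd) !mulrN !mulrA -opprD opprK.
  by rewrite -(uP (m.+1, n)) -(uP (m, n.+1)) /= addrC DxL.
have F'E m n : F' m n * e2 = F' m n.
  by rewrite mulrBl mulrDl -!mulrA (sd_s sd).2 (sd_t sd).2 FE.
have [w wP] := choice (fun mn : nat * nat => sd_exr sd (F'E mn.1 mn.2) (F'r mn.1 mn.2)).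
pose y (mn : nat * nat) := u mn * e1 + (if mn.2 is n.+1 then w (mn.1, n) * b else 0).
exists y => m n; split.
- rewrite mulrDl -mulrA e1e1; congr (_ + _); rewrite /=.
  by case: n => [|n]; rewrite ?mul0r // -mulrA bE.
- rewrite mulrDl -mulrA ea -(uP (m, n)) /=.
  by case: n => [|n]; rewrite ?mul0r -?mulrA ?ba ?mulr0 addr0.
- have -> : y (m.+1, n) * s = u (m.+1, n) * s.
    rewrite mulrDl -mulrA es /=.
    by case: n => [|n]; rewrite ?mul0r -?mulrA ?bs ?mulr0 addr0.
  rewrite mulrDl -mulrA et /= -mulrA -(wP (m, n)) /= addrA.
  by rewrite addrC subrK.
Qed.

(** For a cycle e write e = X b + Y c + Z r.  The other half of the cycle
    condition says that X (m, n+1) and Y (m+1, n) agree after multiplication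
    by b t, hence up to a multiple q a of a.  Therefore X, continued by Y on
    the axis m = 0, is a preimage up to q a c = - q t r, which corrects Z. *)
Lemma sdiff_exact_odd x :
  (forall i, (x i : A) * E i = x i) -> D x = 0 ->
  exists y : (nat * nat -> A) * (nat * nat -> A), forall m n,
    y.1 (m.+1, n) * b + y.1 (m, n.+1) * c + y.2 (m, n) * r = x (None, (m, n)).
Proof.
move=> xE Dx.
have [rs rt] := sd_r0 sd; have [bs ct] := sd_bc0 sd.
have [[_ aE] [eb bE] [ec cE] [er _]] := And4 (sd_a sd) (sd_b sd) (sd_c sd) (sd_r sd).
have [e0e0 e1e1 _] := sd_idem sd.
pose L m n : A := x (None, (m, n)).
have LE m n : L m n * e1 = L m n := xE (None, (m, n)).
have La m n : L m n * a = 0 := congr1 (fun f : T => f (Some false, (m, n))) Dx.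
have Lst m n : L m.+1 n * s + L m n.+1 * t = 0.
  exact: (congr1 (fun f : T => f (Some true, (m, n))) Dx).
have [z zP] := choice (fun mn : nat * nat => sd_exa sd (LE mn.1 mn.2) (La mn.1 mn.2)).
pose X m n := (z (m, n)).1.1 * e0; pose Y m n := (z (m, n)).1.2 * e0.
have LXY m n : L m n = X m n * b + Y m n * c + (z (m, n)).2 * r.
  by rewrite /X /Y -!mulrA eb ec; exact: (zP (m, n)).
have XE m n : X m n * e0 = X m n by rewrite /X -mulrA e0e0.
have YE m n : Y m n * e0 = Y m n by rewrite /Y -mulrA e0e0.
clearbody X Y.
have XY m n : (X m n.+1 - Y m.+1 n) * (b * t) = 0.
  rewrite -(Lst m n) !LXY !mulrDl -!mulrA bs ct rs rt (sd_cs sd) !mulr0 !addr0 add0r.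
  by rewrite mulNr mulrN addrC.
have XYE m n : (X m n.+1 - Y m.+1 n) * e0 = X m n.+1 - Y m.+1 n.
  by rewrite mulrBl XE YE.
have [q qP] := choice (fun mn : nat * nat => sd_exbt sd (XYE mn.1 mn.2) (XY mn.1 mn.2)).
pose g (mn : nat * nat) :=
  match mn with
  | (m.+1, n) => X m n | (0%N, n.+1) => Y 0%N n | (0%N, 0%N) => 0 end.
pose f (mn : nat * nat) :=
  (z mn).2 + (if mn.1 is m.+1 then q (m, mn.2) * t else 0).
exists (g, f) => m n; rewrite [RHS]LXY /= -!addrA; congr (_ + _).
rewrite /f /g; case: m => [|m] /=; first by rewrite addr0.
rewrite mulrDl [_ + q _ * t * r]addrC addrA; congr (_ + _).
rewrite -mulrA (sd_tr sd) mulrN mulrA -(qP (m, n)) /=.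
by rewrite mulrBl opprB addrC subrK.
Qed.

(** The chase takes place in the product of all the terms at once, which is
    exact except for the cokernel A e0 / A a at the bottom. *)
Lemma sdiff_exact x :
  (forall i, (x i : A) * E i = x i) -> D x = 0 ->
  (exists y, x (Some false, (0, 0)%N) = y * a) ->
  exists y, (forall i, (y i : A) * E i = y i) /\ D y = x.
Proof.
move=> xE Dx x00.
have [ye yeP] := sdiff_exact_even xE Dx x00.
have [[g f] gfP] := sdiff_exact_odd xE Dx.
have [e0e0 e1e1 e2e2] := sd_idem sd.
exists (fun i => match i.1 with
  | None => ye i.2 | Some false => g i.2 * e0 | Some true => f i.2 * e2 end); split.
  case=> [[[]|] [m n]]; rewrite /sidem /= -?mulrA ?e0e0 ?e2e2 //.
  by have [] := yeP m n.
apply: funext => -[[[]|] [m n]] /=; try by have [] := yeP m n.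
by rewrite -!mulrA (sd_b sd).1 (sd_c sd).1 (sd_r sd).1; exact: gfP.
Qed.

End Strand.

Section StrandKoszul.
Variables (A : nzRingType) (Adeg : nat -> set A) (gr : ring_grading Adeg).
Variables (e0 e1 e2 a b c r s t : A).
Hypothesis sd : strand_datum e0 e1 e2 a b c r s t.
Hypothesis deg_e : [/\ Adeg 0%N e0, Adeg 0%N e1 & Adeg 0%N e2].
Hypothesis deg_abc : [/\ Adeg 1%N a, Adeg 1%N b & Adeg 1%N c].
Hypothesis deg_rst : [/\ Adeg 1%N r, Adeg 1%N s & Adeg 1%N t].
Local Notation T := (sidx -> A^o).
Local Notation E := (sidem e0 e1 e2).
Local Notation D := (sdiff a b c r s t).

Lemma sidem_deg i : Adeg 0%N (E i).
Proof. by have [? ? ?] := deg_e; case: i => [[[]|] ?]. Qed.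

Lemma sdiff_deg j (x : T) :
  (forall i, zdeg Adeg j (x i)) -> forall i, zdeg Adeg (j + 1) (D x i).
Proof.
have [da db dc] := deg_abc; have [dr ds dt] := deg_rst.
move=> dx [[[]|] [m n]] /=.
- by apply: (zdegD gr); apply: (zdegMr gr).
- by apply: (zdegMr gr).
- by apply: (zdegD gr); [apply: (zdegD gr)|]; apply: (zdegMr gr).
Qed.

Lemma strand_Koszul : Koszul_module Adeg (@quot_deg A Adeg e0 [:: a]).
Proof.
have [da db dc] := deg_abc; have [dr ds dt] := deg_rst.
have [e0e0 e1e1 e2e2] := sd_idem sd.
apply: (@based_Koszul A Adeg gr sidx E ssupp D _ _ _ _ _ _ _ _ _ _ (Some false, (0, 0)%N)) => //.
- exact: sidem_idem sd.
- exact: sidem_deg.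
- exact: sdiff_linear.
- exact: sdiff_val sd.
- exact: sdiff_deg.
- exact: sdiff_trunc.
- by move=> n x _ i _; rewrite (sdiff_sdiff sd).
- move=> n x /basedP xS Dx; have xE i := (xS i).1.
  have [|y [yE Dy]] := sdiff_exact sd xE Dx; last by exists y; split=> // i _; rewrite Dy.
  by exists 0; rewrite mul0r (xS _).2 // mem_ssupp.
- by move=> y; rewrite inE => /eqP ->.
- move=> x xe0; split=> [/lin_span1P[y xy]|[y [yE <-]]].
    exists (fun i => if i == (None, (0, 0)%N) then y * e1 else 0); split.
      move=> i; case: eqP => [->|_]; last by rewrite mul0r.
      by rewrite -mulrA e1e1.
    by rewrite /= -mulrA (sd_a sd).1 xy.
  by apply/lin_span1P; exists (y (None, (0, 0)%N)).
Qed.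

End StrandKoszul.

(** * The resolution of Z_lambda *)

(** The mapping cone of the chain map lifting the embedding of Z_mu into the
    syzygy of Z_gamma.  Here u, d are w_2, v_2.  The summand inl is the
    resolution of Z_gamma shifted down by one, so that its term A e0 in degree
    zero is lost; the summand inr is that of Z_mu shifted up by one. *)
Section Cone.
Variables (A : nzRingType) (Adeg : nat -> set A) (gr : ring_grading Adeg).
Variables (e0 e1 e2 a b c r s t u d : A).
Hypothesis sdl : strand_datum e0 e1 e2 a b c r s t.
Hypothesis sdr : strand_datum e2 e1 e0 t u r c d a.
Hypothesis deg_e : [/\ Adeg 0%N e0, Adeg 0%N e1 & Adeg 0%N e2].
Hypothesis deg_abc : [/\ Adeg 1%N a, Adeg 1%N b & Adeg 1%N c].
Hypothesis deg_rst : [/\ Adeg 1%N r, Adeg 1%N s & Adeg 1%N t].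
Hypothesis deg_ud : Adeg 1%N u /\ Adeg 1%N d.
Hypothesis ut0 : u * t = 0.
Hypothesis cd0 : c * d = 0.
Hypothesis rd_ua : r * d + u * a = 0.
Hypothesis dc_tu : d * c + t * u = 0.
Hypothesis inj_u : forall f x y z, f * e2 = f ->
  f * u + x * b + y * c + z * r = 0 -> exists w, f = w * t.

Local Notation T1 := (sidx -> A^o).
Local Notation I := (sidx + sidx)%type.
Local Notation T := (I -> A^o).
Local Notation El := (sidem e0 e1 e2).
Local Notation Er := (sidem e2 e1 e0).
Local Notation Dl := (sdiff a b c r s t).
Local Notation Dr := (sdiff t u r c d a).

Definition cidem (i : I) : A := match i with inl j => El j | inr j => Er j end.

Definition csupp (n : nat) : seq I :=
  [seq inl i | i <- ssupp n.+1] ++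
  (if n is m.+1 then [seq inr i | i <- ssupp m] else [::]).

(** The chain map from the resolution of Z_mu to that of Z_gamma; it lives on
    the monomials that are powers of y alone. *)
Definition connect (q : T1) : T1 := fun i =>
  match i with
  | (None, (0%N, n)) => (q (Some false, (0%N, n)) : A) * u
  | (Some false, (0%N, n.+1)) => (q (None, (0%N, n)) : A) * d
  | _ => 0
  end.

Definition cdiff (x : T) : T := fun i =>
  match i with
  | inl j => Dl (x \o inl) j + connect (x \o inr) j
  | inr j => Dr (x \o inr) j
  end.

Lemma mem_csuppl n i : (inl i \in csupp n) = (slev i == n.+1).
Proof.
rewrite mem_cat mem_map; last by move=> ? ? [].
rewrite mem_ssupp orbC; case: n => //= n.
by case: mapP => // -[].
Qed.

Lemma mem_csuppr n i : (inr i \in csupp n) = ((slev i).+1 == n).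
Proof.
rewrite mem_cat; case: mapP => [[]//|_] /=; case: n => //= n.
by rewrite mem_map ?mem_ssupp ?eqSS // => ? ? [].
Qed.

Lemma connect_linear : linear connect.
Proof.
have E z (x y : T1) i : ((z *: x + y) i : A) = z * (x i : A) + (y i : A) by [].
move=> z x y; apply: funext => -[[[]|] [[|m] [|n]]]; rewrite E /= ?E ?mulr0 ?addr0 //;
  by rewrite mulrDl mulrA.
Qed.

Lemma cdiff_linear : linear cdiff.
Proof.
move=> z x y; apply: funext => -[i|i]; rewrite /cdiff /=.
  have -> : (z *: x + y) \o inl = z *: (x \o inl) + (y \o inl) by [].
  have -> : (z *: x + y) \o inr = z *: (x \o inr) + (y \o inr) by [].
  rewrite sdiff_linear connect_linear.
  have E (x1 y1 : T1) : (z *: x1 + y1) i = z *: x1 i + y1 i by [].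
  by rewrite !E addrACA -scalerDr.
have -> : (z *: x + y) \o inr = z *: (x \o inr) + (y \o inr) by [].
by rewrite sdiff_linear.
Qed.

Lemma trunc_inl n (x : T) : trunc (csupp n) x \o inl = trunc (ssupp n.+1) (x \o inl).
Proof. by apply: funext => i; rewrite /trunc /= mem_csuppl mem_ssupp. Qed.

Lemma trunc_inr n (x : T) : trunc (csupp n.+1) x \o inr = trunc (ssupp n) (x \o inr).
Proof. by apply: funext => i; rewrite /trunc /= mem_csuppr mem_ssupp. Qed.

Lemma connect_trunc n (q : T1) :
  connect (trunc (ssupp n) q) = trunc (ssupp n.+1) (connect q).
Proof.
apply: funext => -[[[]|] [[|m] [|k]]]; rewrite /trunc /= !mem_ssupp /slev /=
  ?(addSn, addnS, addn0, doubleS, eqSS) ?if_same //;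
  by case: eqP; rewrite ?mul0r.
Qed.

Lemma cdiff_trunc n x : cdiff (trunc (csupp n.+1) x) = trunc (csupp n) (cdiff x).
Proof.
apply: funext => -[i|i].
  rewrite /cdiff trunc_inl trunc_inr sdiff_trunc connect_trunc.
  rewrite /trunc mem_csuppl mem_ssupp.
  by case: ifP => _; rewrite ?addr0.
rewrite /cdiff trunc_inr; case: n => [|n]; last first.
  by rewrite sdiff_trunc /trunc mem_csuppr mem_ssupp.
case: i => [[[]|] [m k]]; rewrite /sdiff /trunc mem_csuppr !mem_ssupp /slev /=
  ?(addSn, addnS, addn0, doubleS) /=; by rewrite ?mul0r ?addr0.
Qed.

Lemma cdiff_val x i : (cdiff x i : A) * cidem i = cdiff x i.
Proof.
case: i => i; last exact: (sdiff_val sdr).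
rewrite /= mulrDl (sdiff_val sdl); congr (_ + _).
have [_ uE] := sd_b sdr; have [_ dE] := sd_s sdr.
by case: i => [[[]|] [[|m] [|n]]]; rewrite /= /sidem /= ?mul0r // -mulrA ?uE ?dE.
Qed.

(** The entry excluded here is the one lost in the shift. *)
Lemma connect_anticomm q i : i != (Some false, (0, 0)%N) ->
  Dl (connect q) i + connect (Dr q) i = 0.
Proof.
have [ud _] := sd_bc0 sdr.
case: i => [[[]|] [[|m] [|n]]] //= _;
  rewrite ?mul0r ?addr0 ?add0r ?mulrDl -?mulrA ?ut0 ?ud ?cd0 ?mulr0 ?addr0 ?add0r //;
  by rewrite -mulrDr 1?addrC ?rd_ua ?dc_tu ?mulr0 // addrC ?rd_ua ?dc_tu ?mulr0.
Qed.

Lemma cdiff_deg j (x : T) :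
  (forall i, zdeg Adeg j (x i)) -> forall i, zdeg Adeg (j + 1) (cdiff x i).
Proof.
have [da db dc] := deg_abc; have [dr ds dt] := deg_rst; have [du dd] := deg_ud.
move=> dx [i|i]; last by apply: (sdiff_deg gr) => // l; exact: dx.
apply: (zdegD gr); first by apply: (sdiff_deg gr) => // l; exact: dx.
by case: i => [[[]|] [[|m] [|n]]] /=; try exact: (zdeg0 gr); apply: (zdegMr gr).
Qed.

Lemma cdiff_cdiff n x : forall i, i \in csupp n -> cdiff (cdiff x) i = 0.
Proof.
case=> i; last by move=> _; exact: (congr1 (fun f : T1 => f i) (sdiff_sdiff sdr (x \o inr))).
rewrite mem_csuppl => i_lev; have i00 : i != (Some false, (0, 0)%N).
  by apply: contraTneq i_lev => ->.
rewrite /cdiff /=.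
have -> : (fun j => match j with
  | inl j0 => Dl (x \o inl) j0 + connect (x \o inr) j0
  | inr j0 => Dr (x \o inr) j0 end : A^o) \o inl = 1 *: Dl (x \o inl) + connect (x \o inr).
  by apply: funext => l; rewrite scale1r.
rewrite sdiff_linear scale1r (sdiff_sdiff sdl) add0r.
exact: connect_anticomm.
Qed.

(** In a cycle (x, q) the first relation between the entries shows, by inj_u,
    that q starts with a multiple of t; so q is a boundary.  Subtracting its
    preimage leaves a cycle of the resolution of Z_gamma. *)
Lemma cdiff_exact n x : x \in based cidem (csupp n.+1) -> cdiff x = 0 ->
  exists y, (forall i, (y i : A) * cidem i = y i) /\
            forall i, i \in csupp n.+1 -> cdiff y i = x i.
Proof.
move=> /basedP xS Dx.
have xl i : El i = cidem (inl i) by [].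
have x0 i : (slev i < 2)%N -> x (inl i) = 0.
  move=> lt2; apply: (xS _).2; rewrite mem_csuppl.
  by apply: contraTneq lt2 => ->.
have Dxl i : Dl (x \o inl) i + connect (x \o inr) i = 0 := congr1 (fun f : T => f (inl i)) Dx.
have Dxr : Dr (x \o inr) = 0 by apply: funext => i; exact: (congr1 (fun f : T => f (inr i)) Dx).
have [||q [qE Dq]] := sdiff_exact sdr _ Dxr.
- by move=> i; exact: (xS (inr i)).1.
- have := Dxl (None, (0, 0)%N); rewrite /= addrC !addrA => /inj_u; apply.
  exact: (xS (inr (Some false, (0, 0)%N))).1.
(* The differential ignores the entry of q at level 0, but connect does not: it
   would produce a nonzero entry in the term that is lost in the shift. *)
pose q' : T1 := fun i => if i == (Some false, (0, 0)%N) then 0 else q i.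
have q'E i : (q' i : A) * Er i = q' i.
  by rewrite /q'; case: eqP => _; rewrite ?mul0r ?qE.
have Dq' : Dr q' = x \o inr.
  by rewrite -Dq; apply: funext => -[[[]|] [m k]]; rewrite /= /q' ?xpair_eqE /= ?andbF.
pose z : T1 := -1 *: connect q' + (x \o inl).
have zE i : z i = (x (inl i) : A) - (connect q' i : A).
  by rewrite addrC -mulN1r.
have zval i : (z i : A) * El i = z i.
  rewrite zE mulrBl (xS (inl i)).1; congr (_ - _).
  have [_ uE] := sd_b sdr; have [_ dE] := sd_s sdr.
  by case: i => [[[]|] [[|m] [|k]]]; rewrite /= /sidem /= ?mul0r // -mulrA ?uE ?dE.
have Dz : Dl z = 0.
  apply: funext => i; rewrite /z sdiff_linear.
  have -> : (-1 *: Dl (connect q') + Dl (x \o inl)) i =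
            - (Dl (connect q') i : A) + (Dl (x \o inl) i : A) by rewrite -[X in _ = X + _]mulN1r.
  have [->|i00] := eqVneq i (Some false, (0, 0)%N).
    by rewrite /= /q' eqxx !mul0r oppr0 add0r x0 ?mul0r.
  have /eqP := connect_anticomm q' i00; rewrite Dq' addr_eq0 => /eqP ->.
  by rewrite opprK addrC Dxl.
have [|y [yE Dy]] := sdiff_exact sdl zval Dz.
  by exists 0; rewrite mul0r zE x0 // subrr.
exists (fun i => match i with inl j => y j | inr j => q' j end); split.
  by case=> i /=; [exact: yE | exact: q'E].
case=> i _; last by rewrite -[RHS]/((x \o inr) i) -Dq'.
have -> : cdiff (fun i => match i with inl j => y j | inr j => q' j end) (inl i) =
          Dl y i + connect q' i by [].
by rewrite Dy zE [LHS]subrK.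
Qed.

(** The generators of the relations are the images of the indices of level 1:
    c, b and r come from the resolution of Z_gamma and u from the cone. *)
Lemma cone_Koszul : Koszul_module Adeg (@quot_deg A Adeg e1 [:: c; b; u; r]).
Proof.
have [da db dc] := deg_abc; have [dr ds dt] := deg_rst; have [du dd] := deg_ud.
have [e0e0 e1e1 e2e2] := sd_idem sdl.
apply: (@based_Koszul A Adeg gr _ cidem csupp cdiff _ _ _ _ _ _ _ _ _ _
          (inl (None, (0, 0)%N))) => //.
- by case=> i; [exact: (sidem_idem sdl) | exact: (sidem_idem sdr)].
- have [d0 d1 d2] := deg_e.
  by case=> -[[[]|] ?].
- exact: cdiff_linear.
- exact: cdiff_val.
- exact: cdiff_deg.
- exact: cdiff_trunc.
- by move=> n x _ i; exact: cdiff_cdiff.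
- exact: cdiff_exact.
- by move=> y; rewrite !inE => /or4P[] /eqP ->.
- move=> x xe1; split=> [/lin_spanP[y xy]|[y [yE <-]]]; last first.
    apply/lin_spanP; exists (fun i => nth 0 [:: y (inl (Some false, (0, 1)%N)) : A;
      y (inl (Some false, (1, 0)%N)); y (inr (Some false, (0, 0)%N));
      y (inl (Some true, (0, 0)%N))] i).
    rewrite !big_ord_recl big_ord0 /= addr0.
    by rewrite addrAC -!addrA addrCA.
  pose l : seq I := [:: inl (Some false, (0, 1)%N); inl (Some false, (1, 0)%N);
                        inr (Some false, (0, 0)%N); inl (Some true, (0, 0)%N)].
  pose yl := [:: y 0%N * e0; y 1%N * e0; y 2%N * e2; y 3%N * e2].
  exists (fun i => nth 0 yl (index i l)); split.
    move=> i; have [il|il] := boolP (i \in l); last first.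
      by rewrite nth_default ?mul0r // leqNgt (_ : size _ = size l) // index_mem.
    by move: il; rewrite !inE => /or4P[] /eqP -> /=; rewrite -mulrA /sidem /= ?e0e0 ?e2e2.
  rewrite xy !big_ord_recl big_ord0 addr0 /= -!mulrA.
  rewrite (sd_b sdl).1 (sd_c sdl).1 (sd_r sdl).1 (sd_b sdr).1.
  by rewrite addrAC -!addrA addrCA.
Qed.

End Cone.

(** * Sparse integer matrices that compute *)
Lemma all_iota0 (P : pred nat) n i : all P (iota 0 n) -> (i < n)%N -> P i.
Proof. by move=> /allP/(_ i) Pi lt_in; apply: Pi; rewrite mem_iota. Qed.

(** Formal combinations with integer coefficients; lzero is a computable
    sufficient condition for all their values to vanish. *)
Section Combinations.
Variables (K : eqType) (V : zmodType) (f : K -> V).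
Implicit Type l : seq (K * int).

Definition lcoef l (n : K) : int := foldr (fun e a => (if e.1 == n then e.2 else 0) + a) 0 l.
Definition lzero l : bool := all (fun e => lcoef l e.1 == 0) l.
Definition lscale (c : int) l : seq (K * int) := [seq (e.1, c * e.2) | e <- l].
Definition lsum l : V := \sum_(e <- l) f e.1 *~ e.2.

Lemma lcoefE l n : lcoef l n = \sum_(e <- l) (if e.1 == n then e.2 else 0).
Proof. by rewrite unlock. Qed.

Lemma lsum_coef l : lsum l = \sum_(n <- undup (map fst l)) f n *~ lcoef l n.
Proof.
under [RHS]eq_bigr do rewrite lcoefE mulrz_sumr.
rewrite /lsum exchange_big big_seq [RHS]big_seq; apply: eq_bigr => e el.
rewrite (bigD1_seq e.1) ?undup_uniq ?mem_undup ?map_f //= eqxx big1 ?addr0 // => n ne.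
by rewrite eq_sym (negbTE ne) mulr0z.
Qed.

Lemma lsum_zero l : lzero l -> lsum l = 0.
Proof.
move=> /allP l0; rewrite lsum_coef big_seq big1 // => n; rewrite mem_undup.
by case/mapP => e el ->; rewrite (eqP (l0 e el)) mulr0z.
Qed.

Lemma lsum_scale c l : lsum (lscale c l) = lsum l *~ c.
Proof.
rewrite /lsum big_map mulrz_suml; apply: eq_bigr => e _.
by rewrite mulrC mulrzA.
Qed.

Lemma lsum_flatten (J : Type) (r : seq J) (F : J -> seq (K * int)) :
  lsum (flatten [seq F j | j <- r]) = \sum_(j <- r) lsum (F j).
Proof. by rewrite /lsum big_flatten big_map. Qed.

End Combinations.

(** A sparse matrix lists pairs of a row number and entries of that row. *)
Definition srow := seq (nat * int).
Definition smat := seq (nat * srow).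

Definition srow_of (M : smat) (i : nat) : srow := flatten [seq e.2 | e <- M & e.1 == i].
Definition smul (l : srow) (M : smat) : srow :=
  flatten [seq lscale c.2 (srow_of M c.1) | c <- l].

Section SparseMatrices.
Variables (k : comNzRingType) (n : nat).
Local Notation N := n.+1.

Definition unit_row (i : nat) : 'rV[k]_N := \row_(j < N) (i == j :> nat)%:R.
Definition svec (l : srow) : 'rV[k]_N := lsum unit_row l.
Definition smx (M : smat) : 'M[k]_N := \matrix_(i < N, j < N) (lcoef (srow_of M i) j)%:~R.

Lemma svecE l j : svec l 0 j = (lcoef l j)%:~R.
Proof.
rewrite summxE lcoefE rmorph_sum; apply: eq_bigr => e _.
rewrite -scaler_int !mxE; case: (_ == _); first by rewrite mulr1.
by rewrite mulr0.
Qed.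

Lemma rowE_vec (u : 'rV[k]_N) : u = \sum_(i < N) u 0 i *: unit_row i.
Proof.
apply/rowP => j; rewrite summxE (bigD1 j) //= !mxE eqxx mulr1 big1 ?addr0 // => i ij.
by rewrite !mxE (_ : _ == _ = false) ?mulr0 //; exact: negbTE ij.
Qed.

Lemma vec_smx (i : 'I_N) M : unit_row i *m smx M = svec (srow_of M i).
Proof.
apply/rowP => j; rewrite svecE mxE (bigD1 i) //= !mxE eqxx mul1r big1 ?addr0 // => l li.
by rewrite !mxE (_ : _ == _ = false) ?mul0r //; apply: negbTE; rewrite eq_sym.
Qed.

Definition sbounded (M : smat) := all (fun r => all (fun e : nat * int => (e.1 < N)%N) r.2) M.

Lemma srow_of_bounded M i e : sbounded M -> e \in srow_of M i -> (e.1 < N)%N.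
Proof.
move=> /allP Mb /flattenP[r /mapP[q]]; rewrite mem_filter => /andP[_ qM] -> er.
by have /allP/(_ _ er) := Mb _ qM.
Qed.

Lemma svec_smul l M : all (fun e : nat * int => (e.1 < N)%N) l ->
  svec (smul l M) = svec l *m smx M.
Proof.
move=> /allP lb; rewrite /svec lsum_flatten mulmx_suml big_seq [RHS]big_seq.
apply: eq_bigr => c cl; rewrite lsum_scale.
rewrite -[lsum _ _]/(svec (srow_of M (Ordinal (lb c cl)))) -vec_smx.
by rewrite -!scaler_int -scalemxAl.
Qed.

Lemma smul_bounded l M : sbounded M -> all (fun e : nat * int => (e.1 < N)%N) (smul l M).
Proof.
move=> Mb; apply/allP => e /flattenP[r /mapP[c cl ->]] /mapP[q qM ->] /=.
exact: srow_of_bounded Mb qM.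
Qed.

Lemma svec_foldl_smul l Ms : all sbounded Ms -> all (fun e : nat * int => (e.1 < N)%N) l ->
  svec (foldl smul l Ms) = svec l *m \prod_(M <- Ms) smx M.
Proof.
elim: Ms l => [|M Ms IH] l /=; first by rewrite big_nil mulmx1.
move=> /andP[Mb Msb] lb; rewrite big_cons IH ?smul_bounded // svec_smul //.
by rewrite -mulmxA mulmxE.
Qed.

Definition mxcheck (ts : seq (int * seq smat)) : bool :=
  all (fun t => all sbounded t.2) ts &&
  all (fun i => lzero (flatten [seq lscale t.1 (foldl smul [:: (i, Posz 1)] t.2) | t <- ts]))
      (iota 0 N).

Lemma mxcheckP ts : mxcheck ts -> \sum_(t <- ts) (\prod_(M <- t.2) smx M) *~ t.1 = 0.
Proof.
move=> /andP[/allP tb /allP ts0]; apply/row_matrixP => i; rewrite row0.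
have /ts0/(lsum_zero unit_row) : (i : nat) \in iota 0 N by rewrite mem_iota add0n ltn_ord.
rewrite lsum_flatten => E0; rewrite -[RHS]E0 rowE.
have -> : delta_mx 0 i = unit_row i by apply/rowP => j; rewrite !mxE eq_sym.
rewrite mulmx_sumr big_seq [RHS]big_seq; apply: eq_bigr => t /tb tMb.
rewrite lsum_scale -[lsum _ _]/(svec _) svec_foldl_smul //=; last by rewrite ltn_ord.
by rewrite -!scaler_int scalemxAr /svec /lsum big_seq1 mulr1z.
Qed.

End SparseMatrices.

(** * Free algebras and presentations *)
Section FreeAlgebra.
Variables (k : comNzRingType) (I : choiceType).
Local Notation F := (free_alg k I).

Lemma free_monomM (m1 m2 : {fmonom I}) : << mmul m1 m2 >> = << m1 >> * << m2 >> :> F.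
Proof. by rewrite malgME !msuppU1 !big_seq_fset1 !mcoeffUU mulr1. Qed.

Lemma free_monomE (m : {fmonom I}) : << m >> = \prod_(i <- m) free_gen k i :> F.
Proof.
rewrite -[in LHS](fmK m); elim: (m : seq I) => [|i w IH]; first by rewrite big_nil -fmoneE.
by rewrite big_cons -IH -free_monomM /mmul /= fmmulE fmU.
Qed.

Lemma free_algE (x : F) : x = \sum_(m <- msupp x) (x@_m)%:A * << m >>.
Proof.
rewrite {1}(monalgE x); apply: eq_bigr => m _; rewrite mulr_algl.
by apply/malgP => m'; rewrite mcoeffZ !mcoeffU mulr_natr.
Qed.

Variables (S : algType k) (g : I -> S).

Definition free_word (m : {fmonom I}) : S := \prod_(i <- m) g i.

Fact free_word_mmorphism : mmorphism free_word.
Proof.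
by split=> [m1 m2|]; rewrite /free_word; [rewrite fmM big_cat | rewrite fm1 big_nil].
Qed.
HB.instance Definition _ :=
  monalg.isMultiplicative.Build _ S free_word free_word_mmorphism.

Definition free_lift : F -> S := mmap (in_alg S) free_word.

Fact free_lift_zmod : zmod_morphism free_lift.
Proof. exact: raddfB. Qed.
HB.instance Definition _ := GRing.isZmodMorphism.Build F S free_lift free_lift_zmod.

Fact free_lift_monoid : monoid_morphism free_lift.
Proof.
have [fM f1] : multiplicative free_lift.
  apply: commr_mmap_is_multiplicative => x m m'.
  by rewrite /GRing.comm /= mulr_algl mulr_algr.
by split.
Qed.
HB.instance Definition _ := GRing.isMonoidMorphism.Build F S free_lift free_lift_monoid.

Lemma free_lift_scale c x : free_lift (c%:A * x) = c *: free_lift x.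
Proof. by rewrite mulr_algl /free_lift mmapZ /= mulr_algl. Qed.

Lemma free_lift_gen i : free_lift (free_gen k i) = g i.
Proof. by rewrite /free_lift mmapU /= scale1r mul1r /free_word fmU big_seq1. Qed.

End FreeAlgebra.

Lemma quot_lift_exists (A S : nzRingType) (X : relations A) (f : {rmorphism A -> S}) :
  (forall x, rel_set X x -> f x = 0) ->
  exists g : {rmorphism quot_ring X -> S}, forall x, g (quot_pi X x) = f x.
Proof.
move=> fX; pose g0 := quot_lift (X := X) f.
pose g : {rmorphism quot_ring X -> S} :=
  HB.pack g0 (GRing.isZmodMorphism.Build (quot_ring X) S g0 (quot_liftB fX))
    (GRing.isMonoidMorphism.Build (quot_ring X) S g0 (quot_liftM fX)).
by exists g => x; exact: quot_liftE.
Qed.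

(** * A basis of Lambda and its multiplication table

    The vertices lambda, gamma, mu are numbered 0, 1, 2.  The arrows v_i, v'_i,
    w_i, w'_i are numbered i, 3 + i, 6 + i, 9 + i with i starting at 0. *)
Local Notation p1 := (Posz 1).
Local Notation m1 := (Negz 0).

Section Tables.
Local Open Scope nat_scope.

(** The certificate ((i, x), (j, (t, u, v))) says that the product of the basis
    element i by the arrow x is found by multiplying the basis element j on the
    left of the relation relator t u v. *)
Definition product_cert := ((nat * nat) * (nat * (nat * nat * nat)))%type.

(** Vertex and arrows of the 48 basis words, by increasing length; every word
    arises from an earlier one by appending an arrow. *)
Definition basis_words : seq (nat * seq nat) := [::
    (0, [::]); (1, [::]); (2, [::]); (0, [:: 0]); (0, [:: 1]); (0, [:: 2]);
    (0, [:: 9]); (0, [:: 10]); (0, [:: 11]); (1, [:: 3]); (1, [:: 4]);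
    (1, [:: 5]); (2, [:: 6]); (2, [:: 7]); (2, [:: 8]); (0, [:: 0; 3]);
    (0, [:: 0; 4]); (0, [:: 0; 5]); (0, [:: 1; 3]); (0, [:: 1; 4]);
    (0, [:: 1; 5]); (0, [:: 2; 3]); (0, [:: 2; 4]); (0, [:: 2; 5]);
    (0, [:: 9; 6]); (1, [:: 3; 0]); (1, [:: 3; 10]); (1, [:: 3; 11]);
    (1, [:: 4; 11]); (2, [:: 6; 1]); (2, [:: 6; 2]); (2, [:: 6; 9]);
    (2, [:: 7; 2]); (0, [:: 0; 3; 0]); (0, [:: 0; 3; 10]);
    (0, [:: 0; 3; 11]); (0, [:: 1; 3; 0]); (0, [:: 1; 3; 10]);
    (0, [:: 2; 3; 0]); (1, [:: 3; 0; 3]); (1, [:: 3; 0; 4]);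
    (1, [:: 3; 0; 5]); (2, [:: 6; 1; 3]); (2, [:: 6; 1; 4]);
    (2, [:: 6; 2; 3]); (0, [:: 0; 3; 0; 3]); (1, [:: 3; 0; 3; 0]);
    (2, [:: 6; 1; 3; 10])].

(** For each arrow the matrix of the right multiplication by it. *)
Definition mul_table : seq smat := [::
   [::
    (0, [:: (3, p1)]); (9, [:: (25, p1)]); (13, [:: (29, m1)]);
    (14, [:: (30, m1)]); (15, [:: (33, p1)]); (18, [:: (36, p1)]);
    (21, [:: (38, p1)]); (39, [:: (46, p1)])];
   [::
    (0, [:: (4, p1)]); (10, [:: (25, p1)]); (12, [:: (29, p1)]);
    (14, [:: (32, m1)]); (16, [:: (33, p1)]); (19, [:: (36, p1)]);
    (22, [:: (38, p1)]); (24, [:: (36, p1)]); (40, [:: (46, p1)])];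
   [::
    (0, [:: (5, p1)]); (11, [:: (25, p1)]); (12, [:: (30, p1)]);
    (13, [:: (32, p1)]); (17, [:: (33, p1)]); (20, [:: (36, p1)]);
    (23, [:: (38, p1)]); (24, [:: (38, p1)]); (41, [:: (46, p1)])];
   [::
    (1, [:: (9, p1)]); (3, [:: (15, p1)]); (4, [:: (18, p1)]);
    (5, [:: (21, p1)]); (25, [:: (39, p1)]); (29, [:: (42, p1)]);
    (30, [:: (44, p1)]); (33, [:: (45, p1)])];
   [::
    (1, [:: (10, p1)]); (3, [:: (16, p1)]); (4, [:: (19, p1)]);
    (5, [:: (22, p1)]); (25, [:: (40, p1)]); (29, [:: (43, p1)]);
    (32, [:: (44, p1)]); (36, [:: (45, p1)])];
   [::
    (1, [:: (11, p1)]); (3, [:: (17, p1)]); (4, [:: (20, p1)]);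
    (5, [:: (23, p1)]); (25, [:: (41, p1)]); (30, [:: (43, p1)]);
    (32, [:: (42, m1)]); (38, [:: (45, p1)])];
   [::
    (2, [:: (12, p1)]); (6, [:: (24, p1)]); (7, [:: (16, m1)]);
    (8, [:: (17, m1)]); (26, [:: (40, m1)]); (27, [:: (41, m1)]);
    (31, [:: (43, p1)]); (37, [:: (45, m1)])];
   [::
    (2, [:: (13, p1)]); (6, [:: (18, m1)]);
    (7, [:: (15, p1); (19, m1); (24, p1)]); (8, [:: (20, m1)]);
    (26, [:: (39, p1)]); (28, [:: (41, m1)]); (31, [:: (42, m1)]);
    (34, [:: (45, p1)])];
   [::
    (2, [:: (14, p1)]); (6, [:: (21, m1)]); (7, [:: (22, m1)]);
    (8, [:: (15, p1); (23, m1); (24, p1)]); (27, [:: (39, p1)]);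
    (28, [:: (40, p1)]); (31, [:: (44, m1)]); (35, [:: (45, p1)])];
   [::
    (0, [:: (6, p1)]); (10, [:: (26, m1)]); (11, [:: (27, m1)]);
    (12, [:: (31, p1)]); (16, [:: (34, m1)]); (17, [:: (35, m1)]);
    (19, [:: (37, m1)]); (23, [:: (37, m1)]); (24, [:: (37, m1)]);
    (43, [:: (47, m1)])];
   [::
    (0, [:: (7, p1)]); (9, [:: (26, p1)]); (11, [:: (28, m1)]);
    (13, [:: (31, p1)]); (15, [:: (34, p1)]); (18, [:: (37, p1)]);
    (20, [:: (35, m1)]); (23, [:: (34, p1)]); (42, [:: (47, p1)])];
   [::
    (0, [:: (8, p1)]); (9, [:: (27, p1)]); (10, [:: (28, p1)]);
    (14, [:: (31, p1)]); (15, [:: (35, p1)]); (19, [:: (35, p1)]);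
    (21, [:: (37, p1)]); (22, [:: (34, m1)]); (44, [:: (47, p1)])]].

(** The order matters: each certificate leaves exactly one product that is not
    yet known. *)
Definition product_certs : seq product_cert := [::
    (7, 6, (0, (6, 0, 1))); (8, 6, (0, (6, 0, 2))); (6, 7, (0, (6, 1, 0)));
    (8, 7, (0, (6, 1, 2))); (6, 8, (0, (6, 2, 0))); (7, 8, (0, (6, 2, 1)));
    (7, 7, (0, (7, 0, 1))); (8, 8, (0, (7, 0, 2))); (9, 1, (1, (0, 0, 1)));
    (9, 2, (1, (0, 0, 2))); (10, 0, (1, (0, 1, 0))); (10, 2, (1, (0, 1, 2)));
    (11, 0, (1, (0, 2, 0))); (11, 1, (1, (0, 2, 1)));
    (10, 1, (1, (1, 0, 1))); (11, 2, (1, (1, 0, 2))); (9, 9, (1, (5, 0, 0)));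
    (10, 9, (1, (5, 0, 1))); (11, 9, (1, (5, 0, 2)));
    (10, 10, (1, (5, 1, 1))); (11, 10, (1, (5, 1, 2)));
    (11, 11, (1, (5, 2, 2))); (12, 10, (2, (2, 0, 1)));
    (12, 11, (2, (2, 0, 2))); (13, 9, (2, (2, 1, 0)));
    (13, 11, (2, (2, 1, 2))); (14, 9, (2, (2, 2, 0)));
    (14, 10, (2, (2, 2, 1))); (13, 10, (2, (3, 0, 1)));
    (14, 11, (2, (3, 0, 2))); (12, 0, (2, (4, 0, 0)));
    (13, 0, (2, (4, 0, 1))); (14, 0, (2, (4, 0, 2)));
    (13, 1, (2, (4, 1, 1))); (14, 1, (2, (4, 1, 2)));
    (14, 2, (2, (4, 2, 2))); (15, 1, (3, (0, 0, 1)));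
    (15, 2, (3, (0, 0, 2))); (16, 0, (3, (0, 1, 0)));
    (16, 2, (3, (0, 1, 2))); (17, 0, (3, (0, 2, 0)));
    (17, 1, (3, (0, 2, 1))); (16, 1, (3, (1, 0, 1)));
    (17, 2, (3, (1, 0, 2))); (15, 9, (3, (5, 0, 0)));
    (16, 9, (3, (5, 0, 1))); (17, 9, (3, (5, 0, 2)));
    (16, 10, (3, (5, 1, 1))); (17, 11, (3, (5, 2, 2)));
    (18, 1, (4, (0, 0, 1))); (18, 2, (4, (0, 0, 2)));
    (19, 0, (4, (0, 1, 0))); (19, 2, (4, (0, 1, 2)));
    (20, 0, (4, (0, 2, 0))); (20, 1, (4, (0, 2, 1)));
    (19, 1, (4, (1, 0, 1))); (20, 2, (4, (1, 0, 2)));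
    (18, 9, (4, (5, 0, 0))); (19, 9, (4, (5, 0, 1)));
    (19, 10, (4, (5, 1, 1))); (20, 11, (4, (5, 2, 2)));
    (21, 1, (5, (0, 0, 1))); (21, 2, (5, (0, 0, 2)));
    (22, 0, (5, (0, 1, 0))); (22, 2, (5, (0, 1, 2)));
    (23, 0, (5, (0, 2, 0))); (23, 1, (5, (0, 2, 1)));
    (22, 1, (5, (1, 0, 1))); (23, 2, (5, (1, 0, 2)));
    (21, 9, (5, (5, 0, 0))); (22, 10, (5, (5, 1, 1)));
    (23, 11, (5, (5, 2, 2))); (24, 10, (6, (2, 0, 1)));
    (24, 11, (6, (2, 0, 2))); (18, 11, (6, (2, 1, 2)));
    (21, 10, (6, (2, 2, 1))); (24, 9, (6, (3, 0, 1)));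
    (21, 11, (6, (3, 0, 2))); (24, 0, (6, (4, 0, 0)));
    (24, 1, (6, (4, 0, 1))); (24, 2, (6, (4, 0, 2)));
    (16, 11, (7, (2, 0, 2))); (19, 11, (7, (2, 1, 2)));
    (22, 9, (7, (2, 2, 0))); (22, 11, (7, (3, 0, 2)));
    (17, 10, (8, (2, 0, 1))); (20, 9, (8, (2, 1, 0)));
    (23, 9, (8, (2, 2, 0))); (23, 10, (8, (2, 2, 1)));
    (20, 10, (8, (3, 0, 1))); (26, 6, (9, (6, 0, 1)));
    (27, 6, (9, (6, 0, 2))); (27, 7, (9, (6, 1, 2)));
    (26, 8, (9, (6, 2, 1))); (26, 7, (9, (7, 0, 1)));
    (27, 8, (9, (7, 0, 2))); (28, 6, (10, (6, 0, 2)));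
    (28, 7, (10, (6, 1, 2))); (28, 8, (10, (7, 0, 2)));
    (31, 7, (12, (6, 1, 0))); (29, 5, (12, (6, 1, 2)));
    (31, 8, (12, (6, 2, 0))); (30, 4, (12, (6, 2, 1)));
    (31, 6, (12, (7, 0, 1))); (30, 5, (12, (7, 0, 2)));
    (32, 3, (13, (6, 2, 0))); (32, 4, (13, (6, 2, 1)));
    (32, 5, (13, (7, 0, 2))); (35, 7, (15, (6, 1, 2)));
    (34, 8, (15, (6, 2, 1))); (34, 7, (15, (7, 0, 1)));
    (35, 8, (15, (7, 0, 2))); (33, 5, (16, (6, 1, 2)));
    (34, 6, (16, (7, 0, 2))); (33, 4, (16, (7, 1, 2)));
    (35, 6, (17, (7, 0, 1))); (36, 5, (18, (6, 0, 2)));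
    (37, 8, (18, (6, 2, 1))); (36, 3, (18, (7, 0, 2)));
    (37, 7, (18, (7, 1, 2))); (37, 6, (19, (7, 0, 2)));
    (36, 4, (19, (7, 1, 2))); (38, 4, (21, (6, 0, 1)));
    (38, 5, (21, (6, 0, 2))); (38, 3, (21, (7, 0, 1)));
    (39, 1, (25, (0, 0, 1))); (39, 2, (25, (0, 0, 2)));
    (40, 0, (25, (0, 1, 0))); (40, 2, (25, (0, 1, 2)));
    (41, 0, (25, (0, 2, 0))); (41, 1, (25, (0, 2, 1)));
    (40, 1, (25, (1, 0, 1))); (41, 2, (25, (1, 0, 2)));
    (39, 9, (25, (5, 0, 0))); (40, 10, (25, (5, 1, 1)));
    (41, 11, (25, (5, 2, 2))); (40, 11, (26, (2, 0, 2)));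
    (39, 11, (26, (2, 1, 2))); (40, 9, (26, (3, 0, 2)));
    (39, 10, (26, (3, 1, 2))); (41, 10, (27, (2, 0, 1)));
    (41, 9, (27, (3, 0, 1))); (42, 1, (29, (0, 0, 1)));
    (42, 2, (29, (0, 0, 2))); (43, 0, (29, (0, 1, 0)));
    (43, 2, (29, (0, 1, 2))); (42, 0, (29, (1, 0, 2)));
    (43, 1, (29, (1, 1, 2))); (42, 9, (29, (5, 0, 0)));
    (43, 9, (29, (5, 0, 1))); (42, 11, (29, (5, 0, 2)));
    (43, 10, (29, (5, 1, 1))); (43, 11, (29, (5, 1, 2)));
    (44, 1, (30, (0, 0, 1))); (44, 2, (30, (0, 0, 2)));
    (44, 0, (30, (1, 0, 1))); (44, 9, (30, (5, 0, 0)));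
    (44, 10, (30, (5, 0, 1))); (44, 11, (30, (5, 0, 2)));
    (45, 1, (33, (0, 0, 1))); (45, 2, (33, (0, 0, 2)));
    (45, 0, (33, (1, 0, 1))); (45, 9, (33, (5, 0, 0)));
    (45, 10, (33, (5, 0, 1))); (45, 11, (33, (5, 0, 2)));
    (46, 4, (39, (6, 0, 1))); (46, 5, (39, (6, 0, 2)));
    (46, 3, (39, (7, 0, 1))); (47, 6, (42, (6, 0, 1)));
    (47, 8, (42, (6, 2, 1))); (47, 7, (42, (7, 0, 1)))].

Definition arrow_src (x : nat) : nat := nth 0 [:: 0; 0; 0; 1; 1; 1; 2; 2; 2; 0; 0; 0] x.
Definition arrow_tgt (x : nat) : nat := nth 0 [:: 1; 1; 1; 0; 0; 0; 0; 0; 0; 2; 2; 2] x.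

(** The eight families of defining relations, in the order of lambda_rel. *)
Definition relator (t i j : nat) : seq (int * (nat * nat)) :=
  nth [::] [::
    [:: (p1, (3 + i, j))];
    [:: (p1, (3 + i, i)); (m1, (3 + j, j))];
    [:: (p1, (6 + i, 9 + j))];
    [:: (p1, (6 + i, 9 + i)); (m1, (6 + j, 9 + j))];
    [:: (p1, (6 + i, j)); (p1, (6 + j, i))];
    [:: (p1, (3 + i, 9 + j)); (p1, (3 + j, 9 + i))];
    [:: (p1, (i, 3 + j)); (p1, (9 + j, 6 + i))];
    [:: (p1, (i, 3 + i)); (p1, (9 + i, 6 + i)); (m1, (j, 3 + j)); (m1, (9 + j, 6 + j))]] t.

Definition relator_ok (t i j : nat) : bool :=
  [&& t < 8, i < 3, j < 3 & (t \in [:: 0; 2; 6]) ==> (i != j)].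

End Tables.

Definition bsrc i := (nth (0, [::]) basis_words i).1%N.
Definition bword i := (nth (0%N, [::]) basis_words i).2.
Definition bend i := last (bsrc i) (map arrow_tgt (bword i)).
Definition mulm (x : nat) : smat := nth [::] mul_table x.
Definition idem_mat (s : nat) : smat :=
  [seq (i, [:: (i, p1)]) | i <- iota 0 48 & bend i == s].

(** The products of a basis word and an arrow that need no relation: those that
    do not compose, and those that are again basis words. *)
Definition off_vertex i x := (bend i != arrow_src x) && (srow_of (mulm x) i == [::]).
Definition on_word i x :=
  let m := index (bsrc i, rcons (bword i) x) basis_words in
  (m < 48)%N && (srow_of (mulm x) i == [:: (m, p1)]).

(** The relation multiplied on the left by the basis element j, after the first
    arrow of each of its words has been absorbed. *)
Definition expand j t u v : seq ((nat * nat) * int) :=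
  flatten [seq [seq ((l.1, q.2.2), q.1 * l.2) | l <- srow_of (mulm q.2.1) j] | q <- relator t u v].

Definition pair_ok (known : seq (nat * nat)) (ix : nat * nat) :=
  [|| off_vertex ix.1 ix.2, on_word ix.1 ix.2 | ix \in known].

(** The coefficient of the new product has to be 1 or 2 up to sign, as it is
    divided by. *)
Definition cert_ok known (c : product_cert) : bool :=
  let: (ix, (j, (t, u, v))) := c in
  [&& relator_ok t u v, (j < 48)%N,
      all (fun q => pair_ok known (j, q.2.1)) (relator t u v),
      all (fun f => pair_ok known f.1 || (f.1 == ix)) (expand j t u v)
    & absz (lcoef (expand j t u v) ix) \in [:: 1%N; 2%N]].

Fixpoint certify known (cs : seq product_cert) : bool :=
  if cs is c :: cs' then cert_ok known c && certify (c.1 :: known) cs'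
  else all (fun i => all (fun x => pair_ok known (i, x)) (iota 0 12)) (iota 0 48).

Lemma product_certs_ok : certify [::] product_certs.
Proof. by vm_compute. Qed.

Lemma mul_table_bounded : all (fun x => sbounded 47 (mulm x)) (iota 0 12).
Proof. by vm_compute. Qed.

Lemma relator_mx_ok :
  all (fun t => all (fun i => all (fun j => relator_ok t i j ==>
    mxcheck 47 [seq (q.1, [:: mulm q.2.1; mulm q.2.2]) | q <- relator t i j])
  (iota 0 3)) (iota 0 3)) (iota 0 8).
Proof. by vm_compute. Qed.

Lemma idem_mx_ok :
  all (fun s => all (fun i =>
    srow_of (idem_mat s) i == (if bend i == s then [:: (i, p1)] else [::]))
  (iota 0 48)) (iota 0 3).
Proof. by vm_compute. Qed.

Lemma mul_table_src_ok :
  all (fun x => all (fun i => (bend i != arrow_src x) ==> (srow_of (mulm x) i == [::]))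
  (iota 0 48)) (iota 0 12).
Proof. by vm_compute. Qed.

Lemma mul_table_tgt_ok :
  all (fun x => all (fun i => all (fun e : nat * int => (bend e.1 == arrow_tgt x) &&
     (size (bword e.1) == (size (bword i)).+1)) (srow_of (mulm x) i))
  (iota 0 48)) (iota 0 12).
Proof. by vm_compute. Qed.

Lemma basis_ok :
  all (fun i => [&& bend i < 3, bsrc i < 3, size (bword i) < 5
    & all (gtn 12) (bword i)])%N (iota 0 48).
Proof. by vm_compute. Qed.

(** Matrices K and L_d with e_s = c0 K + sum L_d d, where c K = 0 for c in cs.
    An element x of A e_s with x c0 in the sum of the left ideals A c then lies
    in the sum of the left ideals A d. *)
Definition exact_cert (s : nat) (c0 : seq nat) (cs ds : seq (seq nat))
    (KL : smat * seq smat) : bool :=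
  [&& size KL.2 == size ds,
      mxcheck 47 ((p1, [:: idem_mat s]) :: (m1, rcons (map mulm c0) KL.1) ::
        [seq (m1, l.1 :: map mulm l.2) | l <- zip KL.2 ds])
    & all (fun c => mxcheck 47 [:: (p1, rcons (map mulm c) KL.1)]) cs].

Definition gamma_b_cert : smat * seq smat := ([::
    (10, [:: (1, p1)]); (19, [:: (4, p1)]); (22, [:: (5, p1)]);
    (44, [:: (32, p1)])],
  [:: [::
    (3, [:: (0, p1)]); (25, [:: (9, p1)]); (29, [:: (13, m1)]);
    (30, [:: (14, m1)]); (33, [:: (15, p1)]); (36, [:: (18, p1)]);
    (38, [:: (21, p1)]); (46, [:: (39, p1)])]]).

Definition gamma_c_cert : smat * seq smat := ([::
    (11, [:: (1, p1)]); (20, [:: (4, p1)]); (23, [:: (5, p1)]);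
    (42, [:: (32, m1)])],
  [:: [::
    (3, [:: (0, p1)]); (25, [:: (9, p1)]); (29, [:: (13, m1)]);
    (30, [:: (14, m1)]); (33, [:: (15, p1)]); (36, [:: (18, p1)]);
    (38, [:: (21, p1)]); (46, [:: (39, p1)])]]).

Definition gamma_r_cert : smat * seq smat := ([::
    (12, [:: (2, p1)]); (16, [:: (7, m1)]); (17, [:: (8, m1)]);
    (24, [:: (6, p1)]); (40, [:: (26, m1)]); (41, [:: (27, m1)]);
    (43, [:: (31, p1)]); (45, [:: (37, m1)])],
  [:: [::
    (28, [:: (1, p1)]); (34, [:: (5, m1)]); (35, [:: (4, p1)]);
    (47, [:: (32, p1)])]]).

Definition gamma_a_cert : smat * seq smat := ([::
    (3, [:: (0, p1)]); (25, [:: (9, p1)]); (29, [:: (13, m1)]);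
    (30, [:: (14, m1)]); (33, [:: (15, p1)]); (36, [:: (18, p1)]);
    (38, [:: (21, p1)]); (46, [:: (39, p1)])],
  [:: [::
    (10, [:: (1, p1)]); (16, [:: (3, p1)]); (19, [:: (4, p1)]);
    (22, [:: (5, p1)]); (40, [:: (25, p1)]); (43, [:: (29, p1)]);
    (44, [:: (32, p1)]); (45, [:: (36, p1)])];
   [::
    (11, [:: (1, p1)]); (17, [:: (3, p1)]); (20, [:: (4, p1)]);
    (23, [:: (5, p1)]); (41, [:: (25, p1)]); (42, [:: (32, m1)])];
   [::
    (12, [:: (2, p1)]); (24, [:: (6, p1)])]]).

Definition gamma_bt_cert : smat * seq smat := ([::
    (28, [:: (1, p1)]); (34, [:: (5, m1)]); (35, [:: (4, p1)]);
    (47, [:: (32, p1)])],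
  [:: [::
    (3, [:: (0, p1)]); (25, [:: (9, p1)]); (29, [:: (13, m1)]);
    (30, [:: (14, m1)]); (33, [:: (15, p1)]); (36, [:: (18, p1)]);
    (38, [:: (21, p1)]); (46, [:: (39, p1)])]]).

Definition mu_b_cert : smat * seq smat := ([::
    (13, [:: (2, p1)]); (15, [:: (7, p1)]); (18, [:: (6, m1)]);
    (39, [:: (26, p1)])],
  [:: [::
    (8, [:: (0, p1)]); (27, [:: (9, p1)]); (28, [:: (10, p1)]);
    (31, [:: (14, p1)]); (34, [:: (22, m1)]); (35, [:: (15, p1)]);
    (37, [:: (21, p1)]); (47, [:: (44, p1)])]]).

Definition mu_c_cert : smat * seq smat := ([::
    (12, [:: (2, p1)]); (15, [:: (6, m1)]); (16, [:: (7, m1)]);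
    (24, [:: (6, p1)]); (40, [:: (26, m1)])],
  [:: [::
    (8, [:: (0, p1)]); (27, [:: (9, p1)]); (28, [:: (10, p1)]);
    (31, [:: (14, p1)]); (34, [:: (22, m1)]); (35, [:: (15, p1)]);
    (37, [:: (21, p1)]); (47, [:: (44, p1)])]]).

Definition mu_r_cert : smat * seq smat := ([::
    (11, [:: (1, p1)]); (17, [:: (3, p1)]); (20, [:: (4, p1)]);
    (23, [:: (5, p1)]); (41, [:: (25, p1)]); (42, [:: (32, m1)]);
    (43, [:: (30, p1)]); (45, [:: (38, p1)])],
  [:: [::
    (29, [:: (2, m1)]); (33, [:: (7, p1)]); (36, [:: (6, m1)]);
    (46, [:: (26, p1)])]]).

Definition mu_a_cert : smat * seq smat := ([::
    (8, [:: (0, p1)]); (27, [:: (9, p1)]); (28, [:: (10, p1)]);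
    (31, [:: (14, p1)]); (34, [:: (22, m1)]); (35, [:: (19, p1)]);
    (37, [:: (21, p1)]); (47, [:: (44, p1)])],
  [:: [::
    (13, [:: (2, p1)]); (15, [:: (7, p1)]); (18, [:: (6, m1)]);
    (20, [:: (8, m1)]); (39, [:: (26, p1)]); (41, [:: (28, m1)]);
    (42, [:: (31, m1)]); (45, [:: (34, p1)])];
   [::
    (12, [:: (2, p1)]); (15, [:: (6, m1)]); (16, [:: (7, m1)]);
    (17, [:: (8, m1)]); (24, [:: (6, p1)]); (40, [:: (26, m1)]);
    (43, [:: (31, p1)])];
   [::
    (11, [:: (1, p1)]); (23, [:: (5, p1)])]]).

Definition mu_bt_cert : smat * seq smat := ([::
    (29, [:: (2, m1)]); (33, [:: (7, p1)]); (36, [:: (6, m1)]);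
    (46, [:: (26, p1)])],
  [:: [::
    (8, [:: (0, p1)]); (27, [:: (9, p1)]); (28, [:: (10, p1)]);
    (31, [:: (14, p1)]); (34, [:: (22, m1)]); (35, [:: (15, p1)]);
    (37, [:: (21, p1)]); (47, [:: (44, p1)])]]).

Definition lambda_u_cert : smat * seq smat := ([::
    (13, [:: (2, p1)]); (15, [:: (7, p1)]); (18, [:: (6, m1)]);
    (39, [:: (26, p1)])],
  [:: [::
    (8, [:: (0, p1)]); (27, [:: (9, p1)]); (28, [:: (10, p1)]);
    (31, [:: (14, p1)]); (34, [:: (22, m1)]); (35, [:: (15, p1)]);
    (37, [:: (21, p1)]); (47, [:: (44, p1)])]]).

Section CertificatesOk.
Local Open Scope nat_scope.

Lemma gamma_b_cert_ok : exact_cert 1 [:: 4] [:: [:: 5]; [:: 6]]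
  [:: [:: 0]] gamma_b_cert.
Proof. by vm_compute. Qed.

Lemma gamma_c_cert_ok : exact_cert 1 [:: 5] [:: [:: 4]; [:: 6]]
  [:: [:: 0]] gamma_c_cert.
Proof. by vm_compute. Qed.

Lemma gamma_r_cert_ok : exact_cert 2 [:: 6] [::]
  [:: [:: 4; 11]] gamma_r_cert.
Proof. by vm_compute. Qed.

Lemma gamma_a_cert_ok : exact_cert 0 [:: 0] [::]
  [:: [:: 4]; [:: 5]; [:: 6]] gamma_a_cert.
Proof. by vm_compute. Qed.

Lemma gamma_bt_cert_ok : exact_cert 1 [:: 4; 11] [::]
  [:: [:: 0]] gamma_bt_cert.
Proof. by vm_compute. Qed.

Lemma mu_b_cert_ok : exact_cert 2 [:: 7] [:: [:: 6]; [:: 5]]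
  [:: [:: 11]] mu_b_cert.
Proof. by vm_compute. Qed.

Lemma mu_c_cert_ok : exact_cert 2 [:: 6] [:: [:: 7]; [:: 5]]
  [:: [:: 11]] mu_c_cert.
Proof. by vm_compute. Qed.

Lemma mu_r_cert_ok : exact_cert 1 [:: 5] [::]
  [:: [:: 7; 0]] mu_r_cert.
Proof. by vm_compute. Qed.

Lemma mu_a_cert_ok : exact_cert 0 [:: 11] [::]
  [:: [:: 7]; [:: 6]; [:: 5]] mu_a_cert.
Proof. by vm_compute. Qed.

Lemma mu_bt_cert_ok : exact_cert 2 [:: 7; 0] [::]
  [:: [:: 11]] mu_bt_cert.
Proof. by vm_compute. Qed.

Lemma lambda_u_cert_ok : exact_cert 2 [:: 7] [:: [:: 4]; [:: 5]; [:: 6]]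
  [:: [:: 11]] lambda_u_cert.
Proof. by vm_compute. Qed.

End CertificatesOk.

Lemma bendE i : bend i = last (bsrc i) (map arrow_tgt (bword i)).
Proof. by []. Qed.
Lemma bsrcE i : bsrc i = (nth (0%N, [::]) basis_words i).1.
Proof. by []. Qed.
Lemma bwordE i : bword i = (nth (0%N, [::]) basis_words i).2.
Proof. by []. Qed.

Local Opaque mulm idem_mat bend bsrc bword.
Local Opaque gamma_b_cert gamma_c_cert gamma_r_cert gamma_a_cert gamma_bt_cert.
Local Opaque mu_b_cert mu_c_cert mu_r_cert mu_a_cert mu_bt_cert lambda_u_cert.

Lemma mulrz_m1 (V : zmodType) (x : V) : x *~ m1 = - x.
Proof. by []. Qed.

(** * The presentation of Lambda in terms of the numbered arrows *)
Section Presentation.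
Variables (k : comNzRingType) (p : nat).
Hypothesis p_gt0 : (0 < p)%N.

Definition weights : seq (int * int) := W p ++ mW p.

Lemma weights_uniq : uniq weights.
Proof.
by rewrite /weights; case: p p_gt0 => // n _; rewrite /= !inE /= !xpair_eqE ?eqxx /= ?andbF.
Qed.

Definition arrow_num (x : arrow p) : nat :=
  match x with inl a => index (ssval a) weights | inr a => 6 + index (ssval a) weights end.

Definition tarrow (n : nat) : tensor k p :=
  if (n < 6)%N then tv k p (nth 0 weights n) else tw k p (nth 0 weights (n - 6)).

Lemma arrow_num_lt x : (arrow_num x < 12)%N.
Proof.
case: x => -[w ww] /=; have lt6 : (index w weights < 6)%N by rewrite (index_mem w weights).
  exact: leq_trans lt6 _.
by rewrite (ltn_add2l 6 _ 6).
Qed.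

Lemma tarrowE n : (n < 12)%N ->
  exists2 x, arrow_num x = n & tarrow n = quot_pi (tensor_relations k p) (fa k x).
Proof.
move=> lt_n; rewrite /tarrow; case: ltnP => [lt6|ge6].
  have nw : nth 0 weights n \in weights by rewrite mem_nth.
  exists (inl (SeqSub nw)); first exact: (@index_uniq _ 0 n weights lt6 weights_uniq).
  by rewrite /tv insubT.
have lt6 : (n - 6 < 6)%N by rewrite ltn_subLR.
have nw : nth 0 weights (n - 6) \in weights by rewrite mem_nth.
exists (inr (SeqSub nw)).
  rewrite -[RHS](subnKC ge6); congr (6 + _)%N.
  exact: (@index_uniq _ 0 (n - 6) weights lt6 weights_uniq).
by rewrite /tw insubT.
Qed.

Lemma index_weights (w : int * int) : (w \in W p) = (index w weights < 3)%N.
Proof.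
rewrite /weights index_cat; case: ifPn => [wW|_]; first by rewrite -index_mem in wW.
by rewrite ltnNge leq_addr.
Qed.

Lemma index_lt6 (a : weight p) : (index (ssval a) weights < 6)%N.
Proof. by rewrite (index_mem (ssval a) weights) (ssvalP a). Qed.

Lemma lv_arrow_src x : lv x = arrow_src (arrow_num x) :> nat.
Proof.
case: x => a; rewrite /lv /arrow_num index_weights; have := index_lt6 a;
  by case: (index _ _) => [|[|[|[|[|[|]]]]]].
Qed.

Lemma rv_arrow_tgt x : rv x = arrow_tgt (arrow_num x) :> nat.
Proof.
case: x => a; rewrite /rv /arrow_num index_weights; have := index_lt6 a;
  by case: (index _ _) => [|[|[|[|[|[|]]]]]].
Qed.

Definition relval (S : nzRingType) (Y : nat -> S) (r : seq (int * (nat * nat))) : S :=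
  \sum_(q <- r) (Y q.2.1 * Y q.2.2) *~ q.1.

Lemma relvalE (S : nzRingType) (Y : nat -> S) t i j : relval Y (relator t i j) =
  match t with
  | 0%N => Y (3 + i) * Y j
  | 1%N => Y (3 + i) * Y i - Y (3 + j) * Y j
  | 2%N => Y (6 + i) * Y (9 + j)
  | 3%N => Y (6 + i) * Y (9 + i) - Y (6 + j) * Y (9 + j)
  | 4%N => Y (6 + i) * Y j + Y (6 + j) * Y i
  | 5%N => Y (3 + i) * Y (9 + j) + Y (3 + j) * Y (9 + i)
  | 6%N => Y i * Y (3 + j) + Y (9 + j) * Y (6 + i)
  | 7%N => (Y i * Y (3 + i) + Y (9 + i) * Y (6 + i)) - (Y j * Y (3 + j) + Y (9 + j) * Y (6 + j))
  | _ => 0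
  end.
Proof.
case: t => [|[|[|[|[|[|[|[|t]]]]]]]]; rewrite /relval /relator /= ?nth_nil ?big_nil //;
  rewrite ?big_cons big_nil addr0 /= ?mulr1z ?mulrz_m1 //.
by rewrite opprD !addrA.
Qed.

Lemma relval_rmorph (S S' : nzRingType) (f : {rmorphism S -> S'}) Y r :
  f (relval Y r) = relval (f \o Y) r.
Proof.
by rewrite rmorph_sum; apply: eq_bigr => q _; rewrite rmorphMz rmorphM.
Qed.

Lemma mW_nth a : a \in mW p -> exists2 i, (i < 3)%N & a = nth 0 (mW p) i.
Proof. by move=> aW; exists (index a (mW p)); rewrite ?index_mem ?nth_index. Qed.

Lemma tarrow_mW i : (i < 3)%N ->
  [/\ tv k p (nth 0 (mW p) i) = tarrow (3 + i), tv k p (- nth 0 (mW p) i) = tarrow i,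
      tw k p (nth 0 (mW p) i) = tarrow (9 + i) & tw k p (- nth 0 (mW p) i) = tarrow (6 + i)].
Proof.
have oppE (a b : int) : - (a, b) = (- a, - b) by [].
by case: i => [|[|[|]]] // _; split; rewrite /tarrow //= oppE ?opprK ?oppr0.
Qed.

Lemma lambda_rel_relator y : @lambda_rel k p y ->
  exists t i j, relator_ok t i j /\ y = relval tarrow (relator t i j).
Proof.
have mWne i j : (nth 0 (mW p) i != nth 0 (mW p) j) -> i != j by apply: contraNneq => ->.
case=> a b /mW_nth[i i3 ->] /mW_nth[j j3 ->] => [/mWne ij||/mWne ij||||/mWne ij|];
  have [v'i vi w'i wi] := tarrow_mW i3; have [v'j vj w'j wj] := tarrow_mW j3;
  rewrite ?v'i ?vi ?w'i ?wi ?v'j ?vj ?w'j ?wj.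
- by exists 0%N, i, j; rewrite relvalE; split=> //; apply/and4P.
- by exists 1%N, i, j; rewrite relvalE; split=> //; apply/and4P.
- by exists 2%N, i, j; rewrite relvalE; split=> //; apply/and4P.
- by exists 3%N, i, j; rewrite relvalE; split=> //; apply/and4P.
- by exists 4%N, i, j; rewrite relvalE; split=> //; apply/and4P.
- by exists 5%N, i, j; rewrite relvalE; split=> //; apply/and4P.
- by exists 6%N, i, j; rewrite relvalE; split=> //; apply/and4P.
- by exists 7%N, i, j; rewrite relvalE; split=> //; apply/and4P.
Qed.

Lemma relator_lambda_rel t i j : relator_ok t i j ->
  @lambda_rel k p (relval tarrow (relator t i j)).
Proof.
move=> /and4P[t8 i3 j3 tij].
have nW l : (l < 3)%N -> nth 0 (mW p) l \in mW p by move=> l3; rewrite mem_nth.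
have [v'i vi w'i wi] := tarrow_mW i3; have [v'j vj w'j wj] := tarrow_mW j3.
have mW_uniq : uniq (mW p) by have := weights_uniq; rewrite cat_uniq => /and3P[].
have neW : i != j -> nth 0 (mW p) i != nth 0 (mW p) j by rewrite nth_uniq.
rewrite relvalE; case: t t8 tij => [|[|[|[|[|[|[|[|]]]]]]]] //= _ tij;
  rewrite -?v'i -?vi -?w'i -?wi -?v'j -?vj -?w'j -?wj.
- exact: rel_vv0 (nW _ i3) (nW _ j3) (neW tij).
- exact: rel_vv (nW _ i3) (nW _ j3).
- exact: rel_ww0 (nW _ i3) (nW _ j3) (neW tij).
- exact: rel_ww (nW _ i3) (nW _ j3).
- exact: rel_wv (nW _ i3) (nW _ j3).
- exact: rel_vw (nW _ i3) (nW _ j3).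
- exact: rel_vvww0 (nW _ i3) (nW _ j3) (neW tij).
- exact: rel_vvww (nW _ i3) (nW _ j3).
Qed.

Definition X (n : nat) : Lambda k p := quot_pi (lambda_relations k p) (tarrow n).

Definition vtx (s : nat) : vertex := nth vl [:: vl; vg; vm] s.

Lemma vtxK (s : vertex) : vtx s = s.
Proof. by apply: val_inj; case: s => -[|[|[|]]]. Qed.

Lemma quot_pi_rel (A : nzRingType) (R : relations A) x : rel_set R x -> quot_pi R x = 0.
Proof.
move=> Rx; rewrite -(raddf0 (quot_pi R)); apply/quot_pi_eq; rewrite subr0.
exact: ideal_gen_sub.
Qed.

Local Notation T := (tensor_relations k p).
Local Notation L := (lambda_relations k p).

Fact Lpi_zmod : zmod_morphism (@Lpi k p).
Proof.
move=> x y; have e := congr1 (quot_pi L) (quot_piB T x y).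
have e' := quot_piB L (quot_pi T x) (quot_pi T y).
exact (etrans e e').
Qed.

Fact Lpi_monoid : monoid_morphism (@Lpi k p).
Proof.
have [L1 LM] := quot_pi_monoid L; have [T1 TM] := quot_pi_monoid T.
split=> [|x y]; first exact (etrans (congr1 (quot_pi L) T1) L1).
exact (etrans (congr1 (quot_pi L) (TM x y)) (LM _ _)).
Qed.

HB.instance Definition _ := GRing.isZmodMorphism.Build (gen_alg k p) (Lambda k p)
  (@Lpi k p) Lpi_zmod.
HB.instance Definition _ := GRing.isMonoidMorphism.Build (gen_alg k p) (Lambda k p)
  (@Lpi k p) Lpi_monoid.

Lemma LpiB x y : @Lpi k p (x - y) = Lpi x - Lpi y.
Proof. exact: Lpi_zmod. Qed.
Lemma LpiM x y : @Lpi k p (x * y) = Lpi x * Lpi y.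
Proof. exact: Lpi_monoid.2. Qed.
Lemma Lpi1 : @Lpi k p 1 = 1.
Proof. exact: Lpi_monoid.1. Qed.
Lemma Lpi0 : @Lpi k p 0 = 0.
Proof. by rewrite -{1}(subrr 0) LpiB subrr. Qed.

Lemma Lpi_scale c x : @Lpi k p (c%:A * x) = c *: Lpi x.
Proof.
have sL (u : Lambda k p) : c *: u = quot_pi L (c%:A : tensor k p) * u by [].
have sT : (c%:A : tensor k p) = quot_pi T (c%:A : gen_alg k p) * 1 by [].
rewrite LpiM sL sT mulr1.
by rewrite -[quot_pi L (quot_pi T _)]/(Lpi _).
Qed.

Lemma Lpi_surj y : exists x, y = @Lpi k p x.
Proof. by have [z ->] := quot_pi_surj y; have [x ->] := quot_pi_surj z; exists x. Qed.

Lemma quot_pi2_rel (A : nzRingType) (R : relations A) (R' : relations (quot_ring R)) x :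
  rel_set R x -> quot_pi R' (quot_pi R x) = 0.
Proof. by move=> /quot_pi_rel ->; exact: raddf0. Qed.

Lemma Lpi_rel x : tensor_rel x -> @Lpi k p x = 0.
Proof. by move=> hx; have e := @quot_pi2_rel _ T L x hx; exact e. Qed.

Lemma arrow_num_inj : injective arrow_num.
Proof.
have ssval_inj (a b : weight p) : index (ssval a) weights = index (ssval b) weights -> a = b.
  move=> e; apply: val_inj.
  by rewrite /= -(nth_index 0 (ssvalP a)) -(nth_index 0 (ssvalP b)) -/weights e.
case=> a [] b; rewrite /arrow_num => e.
- by congr inl; exact: ssval_inj.
- by have := index_lt6 a; rewrite e ltnNge leq_addr.
- by have := index_lt6 b; rewrite -e ltnNge leq_addr.
- by congr inr; apply: ssval_inj; exact: addnI e.
Qed.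

Lemma Lpi_arrow x : @Lpi k p (fa k x) = X (arrow_num x).
Proof.
by rewrite /X; have [y /arrow_num_inj -> ->] := tarrowE (arrow_num_lt x).
Qed.

Lemma X_arrow n : (n < 12)%N -> exists2 x, arrow_num x = n & X n = Lpi (fa k x).
Proof. by move=> /tarrowE[x <- _]; exists x; rewrite ?Lpi_arrow. Qed.

Lemma Le_mul s t : Le k p s * Le k p t = if s == t then Le k p s else 0.
Proof.
have := Lpi_rel (rel_idem k p s t); rewrite LpiB LpiM => /eqP.
by rewrite subr_eq0 => /eqP; case: ifP => _ -> //; rewrite Lpi0.
Qed.

Lemma Le_sum : \sum_s Le k p s = 1.
Proof.
have := Lpi_rel (Defs.rel_unit k p); rewrite LpiB Lpi1 => /eqP.
by rewrite subr_eq0 (raddf_sum (@Lpi k p)) => /eqP ->.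
Qed.

Lemma Le_X s n : (n < 12)%N -> Le k p s * X n = if s == arrow_src n :> nat then X n else 0.
Proof.
move=> /X_arrow[x <- ->]; rewrite -lv_arrow_src.
have := Lpi_rel (rel_left k s x); rewrite LpiB LpiM => /eqP.
rewrite subr_eq0 -val_eqE => /eqP; case: ifP => _ -> //; by rewrite Lpi0.
Qed.

Lemma X_Le s n : (n < 12)%N -> X n * Le k p s = if s == arrow_tgt n :> nat then X n else 0.
Proof.
move=> /X_arrow[x <- ->]; rewrite -rv_arrow_tgt.
have := Lpi_rel (rel_right k s x); rewrite LpiB LpiM => /eqP.
rewrite subr_eq0 -val_eqE => /eqP; case: ifP => _ -> //; by rewrite Lpi0.
Qed.

Lemma relator_X t i j : relator_ok t i j -> relval X (relator t i j) = 0.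
Proof.
move=> /relator_lambda_rel/(@quot_pi_rel _ (lambda_relations k p)).
by rewrite relval_rmorph.
Qed.

End Presentation.

(** * The 48-dimensional representation *)
Section Representation.
Variables (k : comNzRingType) (p : nat).
Hypothesis p_gt0 : (0 < p)%N.
Local Notation M := 'M[k]_48.
Local Notation mulM x := (smx k 47 (mulm x)).
Local Notation idM s := (smx k 47 (idem_mat s)).
Local Notation vec i := (unit_row k 47 i).

Lemma idem_mat_vec i s : (i < 48)%N -> (s < 3)%N ->
  vec i *m idM s = if bend i == s then vec i else 0.
Proof.
move=> i48 s3; rewrite (@vec_smx k 47 (Ordinal i48)).
have /eqP -> := all_iota0 (all_iota0 idem_mx_ok s3) i48.
by case: ifP => _; rewrite /svec /lsum ?big_nil // big_seq1 mulr1z.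
Qed.

Lemma row_basis_ext (A B : M) : (forall i, (i < 48)%N -> vec i *m A = vec i *m B) -> A = B.
Proof.
move=> AB; apply/row_matrixP => i; rewrite !rowE.
have -> : delta_mx 0 i = vec i by apply/rowP => j; rewrite !mxE eq_sym.
exact: AB.
Qed.

Lemma idem_mat_mul s t : (s < 3)%N -> (t < 3)%N -> idM s *m idM t = if s == t then idM s else 0.
Proof.
move=> s3 t3; apply: row_basis_ext => i i48; rewrite mulmxA idem_mat_vec //.
case: (s =P t) => [<-|st].
  by rewrite idem_mat_vec //; case: ifP => bs; rewrite ?mul0mx // idem_mat_vec // bs.
rewrite mulmx0; case: eqP => [bs|_]; last by rewrite mul0mx.
by rewrite idem_mat_vec // bs; case: eqP.
Qed.

Lemma idem_mat_sum : \sum_(s : vertex) idM s = 1.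
Proof.
apply: row_basis_ext => i i48; rewrite mulmx1 mulmx_sumr.
have /and4P[b3 _ _ _] := all_iota0 basis_ok i48.
rewrite (bigD1 (Ordinal b3 : vertex)) // idem_mat_vec // eqxx big1 /= ?addr0 // => s si.
by rewrite idem_mat_vec //; case: eqP => // bs; case/eqP: si; apply: val_inj.
Qed.

Lemma mul_mat_vec i x : (i < 48)%N -> vec i *m mulM x = svec k 47 (srow_of (mulm x) i).
Proof. by move=> i48; rewrite (@vec_smx k 47 (Ordinal i48)). Qed.

Lemma idem_mul_mat s x : (s < 3)%N -> (x < 12)%N ->
  idM s *m mulM x = if s == arrow_src x then mulM x else 0.
Proof.
move=> s3 x12; apply: row_basis_ext => i i48; rewrite mulmxA idem_mat_vec //.
have /implyP src := all_iota0 (all_iota0 mul_table_src_ok x12) i48.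
have off : bend i != arrow_src x -> vec i *m mulM x = 0.
  by move=> /src/eqP e; rewrite mul_mat_vec // e /svec /lsum big_nil.
case: (s =P _) => [->|sx].
  by case: eqP => // /eqP bs; rewrite mul0mx off.
case: eqP => bs; rewrite ?mul0mx mulmx0 //.
by rewrite off // bs; apply/eqP.
Qed.

Lemma mul_mat_idem s x : (s < 3)%N -> (x < 12)%N ->
  mulM x *m idM s = if s == arrow_tgt x then mulM x else 0.
Proof.
move=> s3 x12; apply: row_basis_ext => i i48; rewrite mulmxA mul_mat_vec //.
have xb := all_iota0 mul_table_bounded x12.
have /allP tgt := all_iota0 (all_iota0 mul_table_tgt_ok x12) i48.
have -> : (if s == arrow_tgt x then mulM x else 0) = (s == arrow_tgt x)%:R *: mulM x.
  by case: eqP => _; rewrite ?scale1r ?scale0r.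
rewrite -scalemxAr mul_mat_vec // /svec /lsum mulmx_suml scaler_sumr big_seq [RHS]big_seq.
apply: eq_bigr => e ei; have /andP[/eqP et _] := tgt e ei.
rewrite -!scaler_int -scalemxAl idem_mat_vec ?(srow_of_bounded xb ei) // et eq_sym.
by case: eqP => _; rewrite ?scale1r // scale0r scaler0.
Qed.

Lemma mul_mat_relator t i j : relator_ok t i j ->
  relval (fun x => mulM x) (relator t i j) = 0.
Proof.
move=> ok; have /and4P[t8 i3 j3 _] := ok.
have := all_iota0 (all_iota0 (all_iota0 relator_mx_ok t8) i3) j3.
rewrite ok => /(mxcheckP k); rewrite big_map => E; rewrite -[RHS]E.
by apply: eq_bigr => q _; rewrite !big_cons big_nil mulr1.
Qed.

Definition rep_gen (g : gen p) : M :=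
  match g with inl s => idM s | inr x => mulM (arrow_num x) end.

Definition rep : gen_alg k p -> M := free_lift rep_gen.
HB.instance Definition _ := GRing.RMorphism.on rep.

Lemma repB x y : rep (x - y) = rep x - rep y.
Proof. exact: (rmorphB rep). Qed.
Lemma repM x y : rep (x * y) = rep x *m rep y.
Proof. exact: (rmorphM rep). Qed.
Lemma rep0 : rep 0 = 0.
Proof. exact: (rmorph0 rep). Qed.
Lemma rep1 : rep 1 = 1.
Proof. exact: (rmorph1 rep). Qed.
Lemma rep_sum (J : Type) (r : seq J) F : rep (\sum_(j <- r) F j) = \sum_(j <- r) rep (F j).
Proof. exact: (rmorph_sum rep). Qed.

Lemma rep_tensor x : tensor_rel x -> rep x = 0.
Proof.
have repE s : rep (fe k p s) = idM s := free_lift_gen rep_gen (inl s).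
have repA y : rep (fa k y) = mulM (arrow_num y) := free_lift_gen rep_gen (inr y).
case=> [s t||s y|s y]; rewrite repB.
- rewrite repM !repE idem_mat_mul // val_eqE.
  by case: eqP => _; rewrite ?rep0 ?repE subrr.
- rewrite rep1 rep_sum; under eq_bigr do rewrite repE.
  by rewrite idem_mat_sum subrr.
- rewrite repM repE repA idem_mul_mat ?arrow_num_lt // -lv_arrow_src // val_eqE.
  by case: eqP => _; rewrite ?rep0 ?repA subrr.
- rewrite repM repE repA mul_mat_idem ?arrow_num_lt // -rv_arrow_tgt // val_eqE.
  by case: eqP => _; rewrite ?rep0 ?repA subrr.
Qed.

Lemma Lambda_rep : exists g : {rmorphism Lambda k p -> M}, forall x, g (Lpi x) = rep x.
Proof.
have [h hE] := @quot_lift_exists _ _ (tensor_relations k p) rep rep_tensor.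
have hA n : (n < 12)%N -> h (tarrow k p n) = mulM n.
  move=> /(tarrowE k p_gt0)[x <- ->]; rewrite hE.
  exact: (free_lift_gen rep_gen (inr x)).
have [|g gE] := @quot_lift_exists _ _ (lambda_relations k p) h.
  move=> y /lambda_rel_relator[t [i [j [ok ->]]]]; rewrite relval_rmorph.
  rewrite -[RHS](mul_mat_relator ok) !relvalE; have /and4P[t8 i3 j3 _] := ok.
  have lt12 c l : (l < 3)%N -> (c <= 9)%N -> (c + l < 12)%N.
    by move=> l3 c9; rewrite -[12%N]/(9 + 3)%N -addnS leq_add.
  by case: t {ok} t8 => [|[|[|[|[|[|[|[|]]]]]]]] //= _; rewrite !hA ?lt12 // ?(lt12 0%N).
by exists g => x; rewrite /Lpi gE hE.
Qed.

End Representation.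

(** * Linear algebra in an algebra with this presentation *)

(** Only the multiplication rules of the generators, a representation and an
    induction principle enter, so A may be any algebra with such a presentation;
    in the end it is Lambda, with vertices E and arrows X. *)
Section Presented.
Variables (k : fieldType) (A : algType k) (E : vertex -> A) (X : nat -> A).
Local Notation M := 'M[k]_48.
Local Notation mulM x := (smx k 47 (mulm x)).
Local Notation idM s := (smx k 47 (idem_mat s)).
Local Notation vec i := (unit_row k 47 i).
Hypothesis two_neq0 : 2%:R != 0 :> k.
Hypothesis E_mul : forall s t, E s * E t = if s == t then E s else 0.
Hypothesis E_sum : \sum_s E s = 1.
Hypothesis E_X : forall s n, (n < 12)%N -> E s * X n = if s == arrow_src n :> nat then X n else 0.
Hypothesis X_E : forall s n, (n < 12)%N -> X n * E s = if s == arrow_tgt n :> nat then X n else 0.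
Hypothesis X_rel : forall t i j, relator_ok t i j -> relval X (relator t i j) = 0.

Definition word (w : seq nat) : A := \prod_(x <- w) X x.
Definition bas (i : nat) : A := E (vtx (bsrc i)) * word (bword i).
Definition from_coord (u : 'rV[k]_48) : A := \sum_(i < 48) u 0 i *: bas i.

Lemma from_coord_linear : linear from_coord.
Proof.
move=> c u v; rewrite /from_coord scaler_sumr -big_split; apply: eq_bigr => i _.
by rewrite !mxE scalerDl scalerA.
Qed.
HB.instance Definition _ := GRing.isLinear.Build k 'rV[k]_48 A *:%R from_coord from_coord_linear.

Lemma from_coord_sum (J : Type) (r : seq J) F :
  from_coord (\sum_(j <- r) F j) = \sum_(j <- r) from_coord (F j).
Proof. exact: (raddf_sum from_coord). Qed.

Lemma from_coordMz u n : from_coord (u *~ n) = from_coord u *~ n.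
Proof. exact: (raddfMz from_coord). Qed.

Lemma from_coordZ c u : from_coord (c *: u) = c *: from_coord u.
Proof. by rewrite linearZ. Qed.

Lemma from_coord0 : from_coord 0 = 0.
Proof. exact: (raddf0 from_coord). Qed.

Lemma from_coord_vec i : (i < 48)%N -> from_coord (vec i) = bas i.
Proof.
move=> i48; rewrite /from_coord (bigD1 (Ordinal i48)) //= mxE eqxx scale1r big1 ?addr0 // => j ij.
by rewrite mxE (_ : _ == _ = false) ?scale0r //; apply: negbTE; rewrite eq_sym.
Qed.

Lemma from_coord_lsum (K : eqType) (f : K -> 'rV[k]_48) l :
  from_coord (lsum f l) = lsum (from_coord \o f) l.
Proof. by rewrite /lsum from_coord_sum; apply: eq_bigr => e _; rewrite from_coordMz. Qed.

Lemma word_rcons w x : word (rcons w x) = word w * X x.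
Proof. by rewrite /word -cats1 big_cat big_seq1. Qed.

Lemma basis_word_lt i : (i < 48)%N -> all (gtn 12) (bword i).
Proof. by move=> i48; have /and4P[_ _ _ ?] := all_iota0 basis_ok i48. Qed.

Lemma bas_E i (s : vertex) : (i < 48)%N ->
  bas i * E s = if bend i == s then bas i else 0.
Proof.
move=> i48; have := basis_word_lt i48; rewrite /bas bendE.
have /and4P[_ src3 _ _] := all_iota0 basis_ok i48.
case/lastP: (bword i) => [|w x].
  rewrite /word big_nil mulr1 E_mul -val_eqE => _.
  by have := vtxK (Ordinal src3 : vertex) => /(congr1 val) /= ->.
rewrite all_rcons map_rcons last_rcons word_rcons => /andP[x12 _].
rewrite -!mulrA X_E // eq_sym.
by case: eqP => _; rewrite ?mulr0.
Qed.

(** The error in the multiplication table at the basis element ix.1 and the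
    arrow ix.2. *)
Definition defect (ix : nat * nat) : A :=
  bas ix.1 * X ix.2 - from_coord (vec ix.1 *m mulM ix.2).

Lemma defect_off_vertex i x : (i < 48)%N -> (x < 12)%N -> off_vertex i x -> defect (i, x) = 0.
Proof.
move=> i48 x12 /andP[bx /eqP row0]; rewrite /defect mul_mat_vec // row0.
rewrite /svec /lsum big_nil from_coord0 subr0 -[X x]mul1r -E_sum mulr_suml mulr_sumr.
rewrite big1 // => s _; rewrite mulrA bas_E //=; case: eqP => [bs|_]; last by rewrite mul0r.
rewrite -[bas i]mulr1 -E_sum mulr_sumr mulr_suml big1 // => t _.
rewrite bas_E //=; case: eqP => [bt|_]; last by rewrite mul0r.
rewrite -[bas i](_ : bas i * E t = _); last by rewrite bas_E // bt eqxx.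
by rewrite -mulrA E_X // -bt (negbTE bx) mulr0.
Qed.

Lemma defect_on_word i x : (i < 48)%N -> on_word i x -> defect (i, x) = 0.
Proof.
move=> i48 /andP[m48 /eqP row]; rewrite /defect mul_mat_vec // row.
set m := index _ _ in m48 *.
have mE : nth (0%N, [::]) basis_words m = (bsrc i, rcons (bword i) x).
  by apply: nth_index; rewrite -index_mem.
rewrite /svec /lsum big_seq1 mulr1z from_coord_vec //= {2}/bas.
have -> : bsrc m = bsrc i by rewrite [LHS]bsrcE mE.
have -> : bword m = rcons (bword i) x by rewrite [LHS]bwordE mE.
by rewrite word_rcons mulrA subrr.
Qed.

Lemma mulm_bounded x : (x < 12)%N -> sbounded 47 (mulm x).
Proof. exact: all_iota0 mul_table_bounded. Qed.

Lemma relator_lt12 t u v q : relator_ok t u v -> q \in relator t u v ->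
  (q.2.1 < 12)%N /\ (q.2.2 < 12)%N.
Proof.
have : all (fun t => all (fun i => all (fun j => all (fun q : int * (nat * nat) =>
   (q.2.1 < 12) && (q.2.2 < 12))%N (relator t i j)) (iota 0 3)) (iota 0 3)) (iota 0 8) by [].
move=> lt /and4P[t8 u3 v3 _] qr; apply/andP.
by have /allP/(_ q qr) := all_iota0 (all_iota0 (all_iota0 lt t8) u3) v3.
Qed.

(** Relations hold both in A and for the matrices, so that multiplying one by a
    basis element gives a linear relation between errors. *)
Lemma defect_relator j t u v : (j < 48)%N -> relator_ok t u v ->
  (forall q, q \in relator t u v -> defect (j, q.2.1) = 0) ->
  lsum defect (expand j t u v) = 0.
Proof.
move=> j48 ok dj.
transitivity (bas j * relval X (relator t u v) -
              from_coord (vec j *m relval (fun x => mulM x) (relator t u v))); last first.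
  by rewrite X_rel // mul_mat_relator // mulr0 mulmx0 from_coord0 subrr.
rewrite /expand lsum_flatten /relval mulr_sumr mulmx_sumr from_coord_sum -sumrB.
rewrite big_seq [RHS]big_seq; apply: eq_bigr => q qr.
have [y12 x12] := relator_lt12 ok qr.
have e1 : vec j *m ((mulM q.2.1 * mulM q.2.2) *~ q.1) =
          (vec j *m mulM q.2.1 *m mulM q.2.2) *~ q.1.
  by rewrite -mulmxA; exact: (raddfMz (mulmx (vec j))).
rewrite e1 from_coordMz mulrzAr mulrA -mulrzBl.
move/eqP: (dj q qr); rewrite subr_eq0 /= => /eqP ->.
rewrite mul_mat_vec // /svec from_coord_lsum {1 2 3}/lsum big_map mulr_suml mulmx_suml.
rewrite from_coord_sum -sumrB mulrz_suml big_seq [RHS]big_seq; apply: eq_bigr => l lr.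
have l48 := srow_of_bounded (mulm_bounded y12) lr.
rewrite /= from_coord_vec // /defect /= mulrzAl.
have -> : vec l.1 *~ l.2 *m mulM q.2.2 = (vec l.1 *m mulM q.2.2) *~ l.2.
  exact: (raddfMz (mulmxr (mulM q.2.2))).
by rewrite from_coordMz -mulrzBl mulrzA_C mulrC.
Qed.

(** All errors but one in the linear relation vanish, hence also the last one. *)
Lemma cert_sound known c : cert_ok known c ->
  (forall i x, (i < 48)%N -> (x < 12)%N -> pair_ok known (i, x) -> defect (i, x) = 0) ->
  defect c.1 = 0.
Proof.
case: c => ix [j [[t u] v]] /and5P[ok j48 /allP firsts /allP pairs lc] known0.
have firsts0 q : q \in relator t u v -> defect (j, q.2.1) = 0.
  move=> qr; have [y12 _] := relator_lt12 ok qr.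
  exact: known0 j48 y12 (firsts q qr).
have := defect_relator j48 ok firsts0; rewrite lsum_coef.
have pair0 e : e \in expand j t u v -> e.1 != ix -> defect e.1 = 0.
  move=> ee /negbTE eix; have := pairs e ee; rewrite eix orbF.
  have /flattenP[_ /mapP[q qr ->] /mapP[l lr el]] := ee; rewrite el /=.
  have [y12 x12] := relator_lt12 ok qr.
  exact: known0 (srow_of_bounded (mulm_bounded y12) lr) x12.
have ix_in : ix \in undup (map fst (expand j t u v)).
  rewrite mem_undup; apply: contraLR lc => ixF.
  suff -> : lcoef (expand j t u v) ix = 0 by [].
  rewrite lcoefE big_seq big1 // => e ee; case: eqP => // eix.
  by move: ixF; rewrite -eix map_f.
rewrite (bigD1_seq ix) ?undup_uniq //= big_seq_cond big1 ?addr0 => [|n /andP[]]; last first.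
  by rewrite mem_undup => /mapP[e ee ->] ne; rewrite pair0 // mul0rz.
rewrite -scaler_int => /eqP; rewrite scaler_eq0 => /orP[|/eqP //].
have nz : (`|lcoef (expand j t u v) ix|%N)%:R != 0 :> k.
  by move: lc; rewrite !inE => /orP[] /eqP ->; rewrite ?oner_eq0.
case: (lcoef _ _) nz => n /=; first by move/negbTE => ->.
by rewrite NegzE rmorphN oppr_eq0 => /negbTE ->.
Qed.

Lemma certify_sound known cs : certify known cs ->
  (forall ix, ix \in known -> defect ix = 0) ->
  forall i x, (i < 48)%N -> (x < 12)%N -> defect (i, x) = 0.
Proof.
have okP kn : (forall ix, ix \in kn -> defect ix = 0) ->
    forall i x, (i < 48)%N -> (x < 12)%N -> pair_ok kn (i, x) -> defect (i, x) = 0.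
  move=> kn0 i x i48 x12 /or3P[|| /kn0 //]; first exact: defect_off_vertex.
  exact: defect_on_word.
elim: cs known => [|c cs IH] known.
  move=> ok kn0 i x i48 x12; apply: (okP _ kn0) => //.
  have ok' : all (fun i => all (fun x => pair_ok known (i, x)) (iota 0 12)) (iota 0 48) := ok.
  exact: (all_iota0 (all_iota0 ok' i48) x12).
move=> /andP[ok oks] kn0; apply: (IH _ oks) => ix; rewrite inE => /orP[/eqP ->|/kn0 //].
exact: cert_sound ok (okP _ kn0).
Qed.

Lemma mul_table_correct i x : (i < 48)%N -> (x < 12)%N -> defect (i, x) = 0.
Proof. by apply: (certify_sound product_certs_ok). Qed.

Lemma from_coord_X u x : (x < 12)%N -> from_coord u * X x = from_coord (u *m mulM x).
Proof.
move=> x12; rewrite {2}(rowE_vec u) mulmx_suml from_coord_sum mulr_suml.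
apply: eq_bigr => i _; rewrite -scalerAl -scalemxAl.
rewrite from_coordZ; congr (_ *: _).
have /eqP := mul_table_correct (ltn_ord i) x12.
by rewrite subr_eq0 => /eqP.
Qed.

Lemma from_coord_E u (s : vertex) : from_coord u * E s = from_coord (u *m idM s).
Proof.
rewrite {2}(rowE_vec u) mulmx_suml from_coord_sum mulr_suml.
apply: eq_bigr => i _; rewrite -scalerAl -scalemxAl.
rewrite from_coordZ; congr (_ *: _).
rewrite bas_E // idem_mat_vec //.
by case: eqP => _; rewrite ?from_coord0 // from_coord_vec.
Qed.

Definition one_vec : 'rV[k]_48 := \sum_(s : vertex) vec s.

Lemma from_coord_one : from_coord one_vec = 1.
Proof.
rewrite from_coord_sum -E_sum; apply: eq_bigr => s _.
have s3 := ltn_ord s; rewrite from_coord_vec ?(leq_trans s3) // /bas.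
have -> : bword s = [::] by case: s s3 => -[|[|[|]]].
have -> : bsrc s = s by case: s s3 => -[|[|[|]]].
by rewrite /word big_nil mulr1 vtxK.
Qed.

Variables (Adeg : nat -> set A) (g : {rmorphism A -> M}).
Hypothesis A_ind : forall P : A -> Prop,
  P 0 -> (forall x y, P x -> P y -> P (x + y)) -> (forall c x, P x -> P (c *: x)) ->
  P 1 -> (forall x y, P x -> P y -> P (x * y)) -> (forall s, P (E s)) ->
  (forall n, (n < 12)%N -> P (X n)) -> forall x, P x.
Hypothesis gE : forall s, g (E s) = idM s.
Hypothesis gX : forall n, (n < 12)%N -> g (X n) = mulM n.
Hypothesis gZ : forall c x, g (c *: x) = c *: g x.
Hypothesis Adeg0 : forall n, Adeg n 0.
Hypothesis AdegD : forall n x y, Adeg n x -> Adeg n y -> Adeg n (x + y).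
Hypothesis AdegZ : forall n c x, Adeg n x -> Adeg n (c *: x).
Hypothesis AdegM : forall m n x y, Adeg m x -> Adeg n y -> Adeg (m + n)%N (x * y).
Hypothesis AdegE : forall s, Adeg 0%N (E s).
Hypothesis AdegX : forall n, (n < 12)%N -> Adeg 1%N (X n).
Hypothesis Adeg_ind : forall P : nat -> A -> Prop,
  (forall n, P n 0) -> (forall n x y, P n x -> P n y -> P n (x + y)) ->
  (forall n c x, P n x -> P n (c *: x)) -> P 0%N 1 ->
  (forall m n x y, P m x -> P n y -> P (m + n)%N (x * y)) -> (forall s, P 0%N (E s)) ->
  (forall n, (n < 12)%N -> P 1%N (X n)) -> forall n x, Adeg n x -> P n x.

Lemma from_coordM u y : from_coord u * y = from_coord (u *m g y).
Proof.
move: y u; apply: A_ind.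
- by move=> u; rewrite mulr0 rmorph0 mulmx0 from_coord0.
- by move=> x y IHx IHy u; rewrite mulrDr IHx IHy rmorphD mulmxDr raddfD.
- by move=> c x IH u; rewrite -scalerAr IH gZ -scalemxAr from_coordZ.
- by move=> u; rewrite mulr1 rmorph1 mulmx1.
- by move=> x y IHx IHy u; rewrite mulrA IHx IHy rmorphM -mulmxA.
- by move=> s u; rewrite gE from_coord_E.
- by move=> n n12 u; rewrite gX // from_coord_X.
Qed.

(** Acting on the vector of 1 by the representation gives coordinates. *)
Definition coord (x : A) : 'rV[k]_48 := one_vec *m g x.

Lemma coordK : cancel coord from_coord.
Proof. by move=> x; rewrite -from_coordM from_coord_one // mul1r. Qed.

Lemma coordM x y : coord (x * y) = coord x *m g y.
Proof. by rewrite /coord rmorphM mulmxA. Qed.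

Lemma coordB : zmod_morphism coord.
Proof. by move=> x y; rewrite /coord rmorphB mulmxBr. Qed.
HB.instance Definition _ := GRing.isZmodMorphism.Build A 'rV[k]_48 coord coordB.

Lemma g_word w : all (gtn 12) w -> g (word w) = \prod_(D <- map mulm w) smx k 47 D.
Proof.
move=> /allP w12; rewrite /word rmorph_prod big_map big_seq [RHS]big_seq.
by apply: eq_bigr => x xw; rewrite gX //; exact: w12.
Qed.

Definition mask n (u : 'rV[k]_48) : 'rV[k]_48 :=
  \row_i (if size (bword i) == n then u 0 i else 0).

Lemma mask_linear n : linear (mask n).
Proof.
by move=> c u v; apply/rowP => i; rewrite !mxE; case: ifP; rewrite ?mulr0 ?addr0.
Qed.
HB.instance Definition _ n := GRing.isLinear.Build k 'rV[k]_48 'rV[k]_48 *:%R (mask n)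
  (mask_linear n).

Lemma mask_vec n i : (i < 48)%N -> mask n (vec i) = if size (bword i) == n then vec i else 0.
Proof.
move=> i48; apply/rowP => j; rewrite !mxE; have [ij|/negbTE ij] := boolP (i == j :> nat).
  by rewrite -(eqP ij); case: ifP => _; rewrite !mxE ?ij.
by rewrite if_same; case: ifP => _; rewrite !mxE ?ij.
Qed.

Lemma mask_sum n (J : Type) (r : seq J) F : mask n (\sum_(j <- r) F j) = \sum_(j <- r) mask n (F j).
Proof. exact: (raddf_sum (mask n)). Qed.

Lemma maskZ n c u : mask n (c *: u) = c *: mask n u.
Proof. by rewrite linearZ. Qed.

Lemma mask_idM n u (s : vertex) : mask n (u *m idM s) = mask n u *m idM s.
Proof.
rewrite (rowE_vec u) mulmx_suml !mask_sum mulmx_suml; apply: eq_bigr => i _.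
rewrite -scalemxAl !maskZ -scalemxAl; congr (_ *: _).
rewrite mask_vec // idem_mat_vec //; case: ifP => bs; case: ifP => sz;
  rewrite ?mul0mx ?mask_vec ?sz //.
- by rewrite idem_mat_vec // bs.
- by rewrite raddf0 idem_mat_vec // bs.
- by rewrite raddf0.
Qed.

Lemma mask_mulM n u x : (x < 12)%N -> mask n.+1 (u *m mulM x) = mask n u *m mulM x.
Proof.
move=> x12; rewrite (rowE_vec u) mulmx_suml !mask_sum mulmx_suml; apply: eq_bigr => i _.
rewrite -scalemxAl !maskZ -scalemxAl; congr (_ *: _).
have /allP tgt := all_iota0 (all_iota0 mul_table_tgt_ok x12) (ltn_ord i).
have row : forall m, mask m (vec i *m mulM x) =
    if m == (size (bword i)).+1 then vec i *m mulM x else 0.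
  move=> m; have -> (B : bool) (v : 'rV[k]_48) : (if B then v else 0) = B%:R *: v.
    by case: B; rewrite ?scale1r ?scale0r.
  rewrite mul_mat_vec // /svec /lsum mask_sum scaler_sumr big_seq [RHS]big_seq.
  apply: eq_bigr => e er; have /andP[_ /eqP se] := tgt e er.
  rewrite -!scaler_int maskZ mask_vec ?(srow_of_bounded (mulm_bounded x12) er) //.
  by rewrite se eq_sym; case: eqP => _; rewrite ?scale1r // scale0r !scaler0.
rewrite row mask_vec // eqSS eq_sym; case: eqP => _ //.
by rewrite mul0mx.
Qed.

Lemma mask_mul n x m u : Adeg n x -> mask m u = u -> mask (m + n)%N (u *m g x) = u *m g x.
Proof.
move=> nx; move: n x nx m u; apply: Adeg_ind.
- by move=> n m u _; rewrite rmorph0 mulmx0 raddf0.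
- by move=> n x y IHx IHy m u mu; rewrite rmorphD mulmxDr raddfD /= IHx ?IHy.
- by move=> n c x IH m u mu; rewrite gZ -scalemxAr maskZ IH.
- by move=> m u mu; rewrite rmorph1 mulmx1 addn0.
- by move=> n n' x y IHx IHy m u mu; rewrite rmorphM -mulmxE mulmxA addnA IHy ?IHx.
- by move=> s m u mu; rewrite gE addn0 mask_idM mu.
- by move=> n n12 m u mu; rewrite gX // addn1 mask_mulM // mu.
Qed.

Lemma mask_coord n x : Adeg n x -> mask n (coord x) = coord x.
Proof.
move=> nx; apply: (mask_mul (m := 0%N) nx).
rewrite mask_sum; apply: eq_bigr => s _; have s3 := ltn_ord s.
rewrite mask_vec ?(leq_trans s3) //.
by case: s s3 => -[|[|[|]]].
Qed.

Lemma mask_mask m n u : mask m (mask n u) = if m == n then mask n u else 0.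
Proof.
apply/rowP => i; rewrite !mxE; case: (m =P n) => [<-|mn]; rewrite !mxE.
  by case: (size _ == m).
by case: (size _ =P m) => // ->; case: eqP.
Qed.

Definition comp n (x : A) : A := from_coord (mask n (coord x)).

Lemma bas_deg i : (i < 48)%N -> Adeg (size (bword i)) (bas i).
Proof.
move=> i48; rewrite /bas -[size _]add0n; apply: AdegM; first exact: AdegE.
have := basis_word_lt i48; elim/last_ind: (bword i) => [|w x IH].
  rewrite /word big_nil -E_sum => _; apply: (big_ind (Adeg 0%N)) => // ? ?.
  exact: AdegD.
rewrite all_rcons word_rcons size_rcons -[(size w).+1]addn1 => /andP[x12 w12].
by apply: AdegM; [exact: IH | exact: AdegX].
Qed.

Lemma comp_deg n x : Adeg n (comp n x).
Proof.
apply: (big_ind (Adeg n)) => [||i _]; [exact: Adeg0 | exact: AdegD |].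
rewrite mxE; case: eqP => [<-|_]; last by rewrite scale0r; exact: Adeg0.
by apply: AdegZ; exact: bas_deg.
Qed.

Lemma comp_zmod n : zmod_morphism (comp n).
Proof. by move=> x y; rewrite /comp coordB !raddfB. Qed.

Lemma comp_id n x : Adeg n x -> comp n x = x.
Proof. by move=> nx; rewrite /comp mask_coord // coordK. Qed.

Lemma comp_ne m n x : m != n -> Adeg n x -> comp m x = 0.
Proof.
move=> mn nx; rewrite /comp -(mask_coord nx) mask_mask (negbTE mn).
exact: from_coord0.
Qed.

Lemma comp_sum x : x = \sum_(n < 5) comp n x.
Proof.
rewrite -from_coord_sum -{1}[x]coordK; congr (from_coord _).
apply/rowP => i; rewrite summxE.
have /and4P[_ _ sz _] := all_iota0 basis_ok (ltn_ord i).
rewrite (bigD1 (Ordinal sz)) // [X in _ = X + _]mxE eqxx big1 /= ?addr0 // => n ni.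
by rewrite mxE; case: eqP => // e; case/eqP: ni; apply: val_inj.
Qed.

Definition presented_grading : ring_grading Adeg :=
  RingGrading comp_zmod comp_deg comp_id comp_ne comp_sum AdegM.

(** In coordinates e_s = c0 K + sum L_d d becomes x = x c0 K + sum (x L_d) d,
    and x c0 K vanishes because x c0 is a combination of elements c killed
    by K. *)
Lemma exact_certP (s : vertex) c0 cs ds KL (x : A) (ys : seq A) :
  exact_cert s c0 cs ds KL -> all (all (gtn 12)) (c0 :: cs ++ ds) ->
  x * E s = x -> x * word c0 + \sum_(q <- zip ys cs) q.1 * word q.2 = 0 ->
  exists z : nat -> A, x = \sum_(l < size ds) z l * word (nth [::] ds l).
Proof.
case: KL => K Ls /and3P[/eqP szL /(mxcheckP k) main /allP kill].
rewrite /= all_cat => /and3P[c12 /allP cs12 /allP ds12] xE rel.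
pose C := smx k 47 K.
have Dd : idM s = g (word c0) *m C + \sum_(l <- zip Ls ds) smx k 47 l.1 *m g (word l.2).
  move: main; rewrite 2!big_cons big_map /= big_seq1 mulr1z mulrz_m1 -cats1 big_cat big_seq1.
  rewrite -g_word // => /eqP; rewrite addr_eq0 opprD opprK => /eqP ->.
  congr (_ + _); rewrite -sumrN big_seq [RHS]big_seq; apply: eq_bigr => l lz.
  rewrite mulrz_m1 opprK big_cons -g_word //; apply: ds12.
  by move: lz; rewrite -{2}(unzip2_zip (s := Ls) (t := ds)) ?szL // => /(map_f snd).
have Ck c : c \in cs -> g (word c) *m C = 0.
  move=> ccs; have /(mxcheckP k) := kill c ccs.
  by rewrite big_seq1 mulr1z -cats1 big_cat big_seq1 -g_word ?cs12.
exists (fun l => from_coord (coord x *m smx k 47 (nth [::] Ls l))).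
have xc : coord x = coord x *m idM s by rewrite -{1}xE coordM gE.
rewrite -{1}[x]coordK {1}xc Dd mulmxDr.
have -> : coord x *m (g (word c0) *m C) = 0.
  rewrite mulmxA -coordM; move/eqP: rel; rewrite addr_eq0 => /eqP ->.
  rewrite raddfN raddf_sum mulNmx mulmx_suml big_seq big1 ?oppr0 // => q qz.
  rewrite /= coordM -mulmxA Ck ?mulmx0 //.
  by move: qz; elim: ys (cs) => [|y ys' IH] [|c cs'] //=; rewrite !inE => /orP[/eqP -> /=|/IH ->];
    rewrite ?eqxx ?orbT.
rewrite add0r mulmx_sumr from_coord_sum (big_nth ([::], [::])) size_zip szL minnn big_mkord.
apply: eq_bigr => l _; rewrite nth_zip ?szL //= mulmxA.
by rewrite from_coordM.
Qed.

Lemma relX t i j : relator_ok t i j ->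
  match t with
  | 0%N => X (3 + i) * X j = 0
  | 2%N => X (6 + i) * X (9 + j) = 0
  | 4%N => X (6 + i) * X j + X (6 + j) * X i = 0
  | 5%N => X (3 + i) * X (9 + j) + X (3 + j) * X (9 + i) = 0
  | 6%N => X i * X (3 + j) + X (9 + j) * X (6 + i) = 0
  | _ => True
  end.
Proof. by move=> /X_rel; rewrite relvalE; case: t => [|[|[|[|[|[|[|t]]]]]]]. Qed.

Lemma double_eq0 (x : A) : x + x = 0 -> x = 0.
Proof. by move/eqP; rewrite -mulr2n -scaler_nat scaler_eq0 (negbTE two_neq0) => /eqP. Qed.

Lemma word1 x : word [:: x] = X x.
Proof. exact: big_seq1. Qed.

Lemma word2 x y : word [:: x; y] = X x * X y.
Proof. by rewrite /word big_cons big_seq1. Qed.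

Lemma strand_gamma : strand_datum (E vg) (E vl) (E vm)
  (X 0) (X 4) (X 5) (X 6) (X 10) (X 11).
Proof.
split; rewrite ?E_X ?X_E ?E_mul //=.
- split.
  + exact: (@relX 0 1 0 isT).
  + exact: (@relX 0 2 0 isT).
  + exact: (double_eq0 (@relX 4 0 0 isT)).
- split.
  + exact: (@relX 2 0 1 isT).
  + exact: (@relX 2 0 2 isT).
- split.
  + exact: (double_eq0 (@relX 5 1 1 isT)).
  + exact: (double_eq0 (@relX 5 2 2 isT)).
- by apply/eqP; rewrite -addr_eq0 addrC (@relX 5 1 2 isT).
- by apply/eqP; rewrite -addr_eq0 addrC (@relX 6 0 1 isT).
- by apply/eqP; rewrite -addr_eq0 addrC (@relX 6 0 2 isT).
- move=> x y z xE rel; have [|z' ->] :=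
      exact_certP (s := vg) (ys := [:: y; z]) gamma_b_cert_ok isT xE.
    by rewrite big_cons big_seq1 !word1 addrA.
  by exists (z' 0%N); rewrite big_ord1 word1.
- move=> x y z xE rel; have [|z' ->] :=
      exact_certP (s := vg) (ys := [:: y; z]) gamma_c_cert_ok isT xE.
    by rewrite big_cons big_seq1 !word1 addrA [x * _ + _]addrC.
  by exists (z' 0%N); rewrite big_ord1 word1.
- move=> x xE rel; have [|z' ->] := exact_certP (s := vm) (ys := [::]) gamma_r_cert_ok isT xE.
    by rewrite big_nil addr0 word1.
  by exists (z' 0%N); rewrite big_ord1 word2.
- move=> x xE rel; have [|z' ->] := exact_certP (s := vl) (ys := [::]) gamma_a_cert_ok isT xE.
    by rewrite big_nil addr0 word1.
  by exists (z' 0%N, z' 1%N, z' 2%N); rewrite !big_ord_recl big_ord0 !word1 addr0 addrA.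
- move=> x xE rel; have [|z' ->] := exact_certP (s := vg) (ys := [::]) gamma_bt_cert_ok isT xE.
    by rewrite big_nil addr0 word2.
  by exists (z' 0%N); rewrite big_ord1 word1.
Qed.

Lemma strand_mu : strand_datum (E vm) (E vl) (E vg)
  (X 11) (X 7) (X 6) (X 5) (X 1) (X 0).
Proof.
split; rewrite ?E_X ?X_E ?E_mul //=.
- split.
  + exact: (@relX 2 1 2 isT).
  + exact: (@relX 2 0 2 isT).
  + exact: (double_eq0 (@relX 5 2 2 isT)).
- split.
  + exact: (@relX 0 2 1 isT).
  + exact: (@relX 0 2 0 isT).
- split.
  + exact: (double_eq0 (@relX 4 1 1 isT)).
  + exact: (double_eq0 (@relX 4 0 0 isT)).
- by apply/eqP; rewrite -addr_eq0 (@relX 4 0 1 isT).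
- by apply/eqP; rewrite -addr_eq0 (@relX 6 1 2 isT).
- by apply/eqP; rewrite -addr_eq0 (@relX 6 0 2 isT).
- move=> x y z xE rel; have [|z' ->] :=
      exact_certP (s := vm) (ys := [:: y; z]) mu_b_cert_ok isT xE.
    by rewrite big_cons big_seq1 !word1 addrA.
  by exists (z' 0%N); rewrite big_ord1 word1.
- move=> x y z xE rel; have [|z' ->] :=
      exact_certP (s := vm) (ys := [:: y; z]) mu_c_cert_ok isT xE.
    by rewrite big_cons big_seq1 !word1 addrA [x * _ + _]addrC.
  by exists (z' 0%N); rewrite big_ord1 word1.
- move=> x xE rel; have [|z' ->] := exact_certP (s := vg) (ys := [::]) mu_r_cert_ok isT xE.
    by rewrite big_nil addr0 word1.
  by exists (z' 0%N); rewrite big_ord1 word2.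
- move=> x xE rel; have [|z' ->] := exact_certP (s := vl) (ys := [::]) mu_a_cert_ok isT xE.
    by rewrite big_nil addr0 word1.
  by exists (z' 0%N, z' 1%N, z' 2%N); rewrite !big_ord_recl big_ord0 !word1 addr0 addrA.
- move=> x xE rel; have [|z' ->] := exact_certP (s := vm) (ys := [::]) mu_bt_cert_ok isT xE.
    by rewrite big_nil addr0 word2.
  by exists (z' 0%N); rewrite big_ord1 word1.
Qed.

(** Right multiplication by w_2 is injective from Z_mu to the syzygy of
    Z_gamma. *)
Lemma gamma_injective x y1 y2 y3 : x * E vm = x ->
  x * X 7 + y1 * X 4 + y2 * X 5 + y3 * X 6 = 0 -> exists z, x = z * X 11.
Proof.
move=> xE rel; have [|z' ->] :=
      exact_certP (s := vm) (ys := [:: y1; y2; y3]) lambda_u_cert_ok isT xE.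
  by rewrite !big_cons big_nil !word1 addr0 !addrA.
by exists (z' 0%N); rewrite big_ord1 word1.
Qed.

Lemma strand_Koszul_gamma : Koszul_module Adeg (@quot_deg A Adeg (E vg) [:: X 0]).
Proof. by apply: (strand_Koszul presented_grading strand_gamma); split; auto. Qed.

Lemma strand_Koszul_mu : Koszul_module Adeg (@quot_deg A Adeg (E vm) [:: X 11]).
Proof. by apply: (strand_Koszul presented_grading strand_mu); split; auto. Qed.

Lemma cone_Koszul_lambda :
  Koszul_module Adeg (@quot_deg A Adeg (E vl) [:: X 5; X 4; X 7; X 6]).
Proof.
apply: (cone_Koszul presented_grading strand_gamma strand_mu (d := X 1)); try by split; auto.
- exact: (@relX 2 1 2 isT).
- exact: (@relX 0 2 1 isT).
- exact: (@relX 4 0 1 isT).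
- exact: (@relX 6 1 2 isT).
- exact: gamma_injective.
Qed.

End Presented.

(** * Induction on the elements of Lambda and on its graded pieces *)
Section FreeDegree.
Variables (k : comNzRingType) (I : choiceType) (d : pred I).
Local Notation F := (free_alg k I).

Definition homog n (f : F) : Prop := forall m, m \in msupp f -> count d m = n.

Lemma homog0 n : homog n 0.
Proof. by move=> m; rewrite msupp0. Qed.

Lemma homogD n f h : homog n f -> homog n h -> homog n (f + h).
Proof.
move=> nf nh m /(fsubsetP (msuppD_le f h)); rewrite in_fsetU => /orP[]; [exact: nf|exact: nh].
Qed.

Lemma homogZ n c f : homog n f -> homog n (c%:A * f).
Proof. by move=> nf m; rewrite mulr_algl => /(fsubsetP (msuppZ_le c f)); exact: nf. Qed.

Lemma homogM m n f h : homog m f -> homog n h -> homog (m + n)%N (f * h).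
Proof.
move=> mf nh w /msuppM_le[w1 [w2 [w1f w2h]]] ->.
by rewrite fmM count_cat (mf _ w1f) (nh _ w2h).
Qed.

Lemma homog_gen i : homog (d i) (free_gen k i).
Proof. by move=> m; rewrite msuppU1 in_fset1 => /eqP ->; rewrite fmU /= addn0. Qed.

Lemma homog_ind (P : nat -> F -> Prop) :
  (forall n, P n 0) -> (forall n f h, P n f -> P n h -> P n (f + h)) ->
  (forall n c f, P n f -> P n (c%:A * f)) -> P 0%N 1 ->
  (forall m n f h, P m f -> P n h -> P (m + n)%N (f * h)) ->
  (forall i, P (d i) (free_gen k i)) -> forall n f, homog n f -> P n f.
Proof.
move=> P0 PD PZ P1 PM Pg n f nf; rewrite (free_algE f) big_seq.
apply: (big_ind (P n)) => [||m mf]; [exact: P0 | exact: PD |].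
apply: PZ; rewrite -(nf m mf) free_monomE.
elim: (m : seq I) => [|i w IH]; first by rewrite big_nil.
by rewrite big_cons /=; apply: PM.
Qed.

Lemma free_ind (P : F -> Prop) :
  P 0 -> (forall f h, P f -> P h -> P (f + h)) -> (forall c f, P f -> P (c%:A * f)) ->
  P 1 -> (forall f h, P f -> P h -> P (f * h)) -> (forall i, P (free_gen k i)) ->
  forall f, P f.
Proof.
move=> P0 PD PZ P1 PM Pg f; rewrite (free_algE f).
apply: (big_ind P) => [||m _]; [exact: P0 | exact: PD |].
apply: PZ; rewrite free_monomE; apply: (big_ind P) => [||i _]; [exact: P1 | exact: PM |].
exact: Pg.
Qed.

End FreeDegree.

Section LambdaInduction.
Variables (k : fieldType) (p : nat).
Hypothesis p_gt0 : (0 < p)%N.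
Local Notation L := (Lambda k p).
Local Notation X := (@X k p).
Local Notation is_arrow := (fun g : gen p => if g is inr _ then true else false).

Lemma LpiD x y : @Lpi k p (x + y) = Lpi x + Lpi y.
Proof. exact: (raddfD (@Lpi k p)). Qed.

Lemma Lambda_ind (P : L -> Prop) :
  P 0 -> (forall x y, P x -> P y -> P (x + y)) -> (forall c x, P x -> P (c *: x)) ->
  P 1 -> (forall x y, P x -> P y -> P (x * y)) -> (forall s, P (Le k p s)) ->
  (forall n, (n < 12)%N -> P (X n)) -> forall x, P x.
Proof.
move=> P0 PD PZ P1 PM PE PX x; have [f ->] := Lpi_surj x.
move: f; apply: (@free_ind k (gen p) (fun f => P (@Lpi k p f))).
- by have e := Lpi0 k p; rewrite e.
- by move=> f h Pf Ph; have e := LpiD f h; rewrite e; exact: PD.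
- by move=> c f Pf; have e := Lpi_scale c f; rewrite e; exact: PZ.
- by have e := Lpi1 k p; rewrite e.
- by move=> f h Pf Ph; have e := LpiM f h; rewrite e; exact: PM.
- case=> [s|a]; first exact: PE.
  by have e := Lpi_arrow k p_gt0 a; rewrite e; apply: PX; exact: arrow_num_lt.
Qed.

Lemma Lambda_deg_ind (P : nat -> L -> Prop) :
  (forall n, P n 0) -> (forall n x y, P n x -> P n y -> P n (x + y)) ->
  (forall n c x, P n x -> P n (c *: x)) -> P 0%N 1 ->
  (forall m n x y, P m x -> P n y -> P (m + n)%N (x * y)) -> (forall s, P 0%N (Le k p s)) ->
  (forall n, (n < 12)%N -> P 1%N (X n)) -> forall n x, Lambda_deg n x -> P n x.
Proof.
move=> P0 PD PZ P1 PM PE PX n x [f nf <-].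
move: n f nf; apply: (@homog_ind k (gen p) is_arrow (fun n f => P n (@Lpi k p f))).
- by move=> n; have e := Lpi0 k p; rewrite e.
- by move=> n f h Pf Ph; have e := LpiD f h; rewrite e; exact: PD.
- by move=> n c f Pf; have e := Lpi_scale c f; rewrite e; exact: PZ.
- by have e := Lpi1 k p; rewrite e.
- by move=> m n f h Pf Ph; have e := LpiM f h; rewrite e; exact: PM.
- case=> [s|a]; first exact: PE.
  by have e := Lpi_arrow k p_gt0 a; rewrite e; apply: PX; exact: arrow_num_lt.
Qed.

Lemma Lambda_deg0 n : @Lambda_deg k p n 0.
Proof. by exists 0; [exact: (@homog0 k (gen p) is_arrow n) | exact: Lpi0]. Qed.

Lemma Lambda_degD n x y : @Lambda_deg k p n x -> Lambda_deg n y -> Lambda_deg n (x + y).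
Proof.
move=> [f nf <-] [h nh <-]; exists (f + h); last exact: LpiD.
exact: (@homogD k (gen p) is_arrow n f h nf nh).
Qed.

Lemma Lambda_degZ n c x : @Lambda_deg k p n x -> Lambda_deg n (c *: x).
Proof.
move=> [f nf <-]; exists (c%:A * f); last exact: Lpi_scale.
exact: (@homogZ k (gen p) is_arrow n c f nf).
Qed.

Lemma Lambda_degM m n x y : @Lambda_deg k p m x -> Lambda_deg n y ->
  Lambda_deg (m + n)%N (x * y).
Proof.
move=> [f nf <-] [h nh <-]; exists (f * h); last exact: LpiM.
exact: (@homogM k (gen p) is_arrow m n f h nf nh).
Qed.

Lemma Lambda_deg_Le s : Lambda_deg 0%N (Le k p s).
Proof. by exists (fe k p s); last by []; exact: (@homog_gen k (gen p) is_arrow (inl s)). Qed.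

Lemma Lambda_deg_X n : (n < 12)%N -> Lambda_deg 1%N (X n).
Proof.
move=> n12; have [a _ ->] := X_arrow k p_gt0 n12.
by exists (fa k a); last by []; exact: (@homog_gen k (gen p) is_arrow (inr a)).
Qed.

End LambdaInduction.

(** * The Koszul property *)
Theorem theorem7p5 (k : closedFieldType) (p : nat)
    (charkp : p \in [pchar k]) (p_gt3 : (3 < p)%N) :
  [/\ Koszul_module (@Lambda_deg k p) (@Z_lambda_deg k p),
      Koszul_module (@Lambda_deg k p) (@Z_gamma_deg k p)
    & Koszul_module (@Lambda_deg k p) (@Z_mu_deg k p)].
Proof.
have p_gt0 : (0 < p)%N by exact: leq_trans p_gt3.
have two_neq0 : 2%:R != 0 :> k.
  by rewrite -(dvdn_pcharf charkp) gtnNdvd // (leq_trans _ p_gt3).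
have [g gE] := Lambda_rep k p_gt0.
have gLe s : g (Le k p s) = smx k 47 (idem_mat s).
  by rewrite gE; exact: (free_lift_gen (@rep_gen k p) (inl s)).
have gX n : (n < 12)%N -> g (X k p n) = smx k 47 (mulm n).
  move=> n12; have [a <- ->] := X_arrow k p_gt0 n12.
  by rewrite gE; exact: (free_lift_gen (@rep_gen k p) (inr a)).
have gZ c x : g (c *: x) = c *: g x.
  have [f ->] := Lpi_surj x; have e := Lpi_scale c f; rewrite -e !gE.
  exact: (free_lift_scale (@rep_gen k p) c f).
have quot_degE e s : @quot_deg (Lambda k p) (@Lambda_deg k p) e s = @left_quot_deg k p e s by [].
have LeX s n := @Le_X k p p_gt0 s n; have XLe s n := @X_Le k p p_gt0 s n.
split.
- have := cone_Koszul_lambda two_neq0 (@Le_mul k p) (Le_sum k p) LeX XLe (@relator_X k p p_gt0)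
    (@Lambda_ind k p p_gt0) gLe gX gZ (@Lambda_deg0 k p) (@Lambda_degD k p) (@Lambda_degZ k p)
    (@Lambda_degM k p) (@Lambda_deg_Le k p) (@Lambda_deg_X k p p_gt0) (@Lambda_deg_ind k p p_gt0).
  have -> : [:: X k p 5; X k p 4; X k p 7; X k p 6] = Z_lambda_rels k p by [].
  by rewrite quot_degE => K; exact K.
- have := strand_Koszul_gamma two_neq0 (@Le_mul k p) (Le_sum k p) LeX XLe (@relator_X k p p_gt0)
    (@Lambda_ind k p p_gt0) gLe gX gZ (@Lambda_deg0 k p) (@Lambda_degD k p) (@Lambda_degZ k p)
    (@Lambda_degM k p) (@Lambda_deg_Le k p) (@Lambda_deg_X k p p_gt0) (@Lambda_deg_ind k p p_gt0).
  have -> : [:: X k p 0] = Z_gamma_rels k p by [].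
  by rewrite quot_degE => K; exact K.
- have := strand_Koszul_mu two_neq0 (@Le_mul k p) (Le_sum k p) LeX XLe (@relator_X k p p_gt0)
    (@Lambda_ind k p p_gt0) gLe gX gZ (@Lambda_deg0 k p) (@Lambda_degD k p) (@Lambda_degZ k p)
    (@Lambda_degM k p) (@Lambda_deg_Le k p) (@Lambda_deg_X k p p_gt0) (@Lambda_deg_ind k p p_gt0).
  have -> : [:: X k p 11] = Z_mu_rels k p by [].
  by rewrite quot_degE => K; exact K.
Qed.
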